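(* Let $X_1$ and $X_2$ be two infinite Riemann surfaces equipped with their conformal hyperbolic metrics such that $X_1=\mathcal{C}(X_1)$ and $X_2=\mathcal{C}(X_2)$. Let $G(\tilde X_i)$ be the space of geodesics of the universal covering $\tilde X_i$ of $X_i$, for $i=1,2$. Then a homeomorphism $h:X_1\to X_2$ induces a $\pi_1(X_1)$- and $\pi_1(X_2)$-equivariant homeomorphism $\widetilde h:G(\tilde X_1)\to G(\tilde X_2)$.
   Context: A Riemann surface $X$ is infinite if $\pi_1(X)$ is infinitely generated; it then carries a unique complete conformal hyperbolic metric, and its universal covering $\tilde X$ is isometric to the hyperbolic plane, with ideal boundary circle $\partial_\infty\tilde X$; $\pi_1(X)$ acts on $\tilde X$ by isometries with $X=\tilde X/\pi_1(X)$. The convex core $\mathcal{C}(X)$ is the quotient by $\pi_1(X)$ of the convex hull in $\tilde X$ of the limit set of $\pi_1(X)$; $X=\mathcal{C}(X)$ holds exactly when the limit set is all of $\partial_\infty\tilde X$ ($\pi_1(X)$ is of the first kind). $G(\tilde X)=(\partial_\infty\tilde X\times\partial_\infty\tilde X-\Delta)/(\mathbb{Z}/2\mathbb{Z})$ is the space of unoriented complete geodesics of $\tilde X$, each identified with its unordered pair of distinct ideal endpoints ($\Delta$ is the diagonal), with the quotient of the product topology. Equivariance: a lift $H:\tilde X_1\to\tilde X_2$ of $h$ determines an isomorphism $\rho:\pi_1(X_1)\to\pi_1(X_2)$ with $H\circ\kappa=\rho(\kappa)\circ H$; $\widetilde h$ is equivariant if $\widetilde h(\kappa(g))=\rho(\kappa)(\widetilde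 h(g))$ for all $\kappa\in\pi_1(X_1)$ and $g\in G(\tilde X_1)$. *)

(* Defs.v *)
From HB Require Import structures.
From mathcomp Require Import all_boot all_order all_algebra.
From mathcomp Require Import generic_quotient complex.
From mathcomp Require Import all_classical all_reals all_analysis.
Set Implicit Arguments. Unset Strict Implicit. Unset Printing Implicit Defensive.
Import Order.TTheory GRing.Theory Num.Theory numFieldNormedType.Exports.
Local Open Scope classical_set_scope.
Local Open Scope ring_scope.
Local Open Scope quotient_scope.

(* R[i]^o is R[i] seen as a normed module over itself: this carries the usual
   topology of the complex numbers, and [derivable f z 1], ['D_1 f z] are
   complex differentiability and the complex derivative. *)
Notation Cplx R := (R[i]^o).

Notation modulus z := (Normc.normc z).

Definition homeomorphism (X Y : topologicalType) (f : X -> Y) : Prop :=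
  continuous f /\ exists g, [/\ continuous g, cancel f g & cancel g f].

(** Riemann surfaces and conformal metrics *)

(* Only the values of [coord] on [dom] are meaningful. *)
Record chart (R : realType) (X : topologicalType) := Chart {
  dom : set X;
  coord : X -> Cplx R;
  dom_open : open dom;
  coord_continuous : {within dom, continuous coord};
  coord_inj : set_inj dom coord;
  coord_open : forall V : set X, open V -> V `<=` dom -> open (coord @` V) }.

(* Only the values of [T] on the open set [coord c @` (dom c `&` dom c')]
   are constrained. *)
Definition transition (R : realType) (X : topologicalType) (c c' : chart R X)
    (T : Cplx R -> Cplx R) : Prop :=
  forall x, dom c x -> dom c' x -> coord c' x = T (coord c x).

Record riemannSurface (R : realType) := RiemannSurface {
  rs_space :> topologicalType;
  rs_hausdorff : hausdorff_space rs_space;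
  rs_connected : connected [set: rs_space];
  atlas : set (chart R rs_space);
  atlas_cover : forall x, exists2 c, atlas c & dom c x;
  atlas_holomorphic : forall c c', atlas c -> atlas c' ->
    exists2 T, transition c c' T &
      forall x, dom c x -> dom c' x -> derivable T (coord c x) 1 }.

(* The metric reads [density c * |dz|] in the chart [c]. *)
Record conformalMetric (R : realType) (X : riemannSurface R) := ConformalMetric {
  density : chart R X -> X -> R;
  density_gt0 : forall c x, atlas c -> dom c x -> 0 < density c x;
  density_transition : forall c c' T, atlas c -> atlas c' -> transition c c' T ->
    forall x, dom c x -> dom c' x ->
    density c x = density c' x * modulus ('D_1 T (coord c x)) }.

(** The hyperbolic plane (Poincare disc) and its ideal boundary *)

Definition hplane (R : realType) : topologicalType :=
  set_type [set z : Cplx R | modulus z < 1].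

Definition ideal (R : realType) : topologicalType :=
  set_type [set z : Cplx R | modulus z = 1].

Definition hval (R : realType) (z : hplane R) : Cplx R := set_val z.
Definition ival (R : realType) (xi : ideal R) : Cplx R := set_val xi.

(* d(z, w) = 2 artanh |z - w| / |1 - z^* w|, the distance of the metric
   2 |dz| / (1 - |z|^2) of curvature -1. *)
Definition hdist (R : realType) (z w : hplane R) : R :=
  let t := modulus (hval z - hval w) / modulus (1 - (hval z)^*%C * hval w) in
  ln ((1 + t) / (1 - t)).

(* The trace on the open disc of the neighbourhoods of an ideal point. *)
Definition nbhs_ideal (R : realType) (xi : ideal R) : set_system (hplane R) :=
  filter_from (nbhs (ival xi)) (preimage (@hval R)).

(* The isometric parametrization [g] runs from [xi] to [eta]. *)
Definition geodesic_line (R : realType) (g : R -> hplane R) (xi eta : ideal R)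
    : Prop :=
  [/\ forall s t, hdist (g s) (g t) = `|s - t|,
      hval (g t) @[t --> -oo] --> ival xi &
      hval (g t) @[t --> +oo] --> ival eta].

Definition geodesically_convex (R : realType) (A : set (hplane R)) : Prop :=
  forall z w u, A z -> A w -> hdist z u + hdist u w = hdist z w -> A u.

Definition convex_hull (R : realType) (L : set (ideal R)) : set (hplane R) :=
  [set z | forall A, geodesically_convex A ->
    (forall g xi eta, L xi -> L eta -> geodesic_line g xi eta ->
      range g `<=` A) ->
    A z].

(* The continuous extension of [T] to the ideal boundary; the default value
   is irrelevant when [T] is an isometry. *)
Definition boundary_map (R : realType) (T : hplane R -> hplane R)
    (xi : ideal R) : ideal R :=
  xget xi [set eta | hval (T z) @[z --> nbhs_ideal xi] --> ival eta].

(** The space of unoriented geodesics *)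

Definition ideal_pair (R : realType) : topologicalType :=
  set_type [set u : ideal R * ideal R | u.1 <> u.2].

Definition same_ends (R : realType) (u v : ideal_pair R) : bool :=
  let u' : ideal R * ideal R := set_val u in
  let v' : ideal R * ideal R := set_val v in
  (u' == v') || (u' == (v'.2, v'.1)).

Lemma same_ends_refl (R : realType) : reflexive (@same_ends R).
Proof. by move=> u; rewrite /same_ends eqxx. Qed.

Lemma same_ends_sym (R : realType) : symmetric (@same_ends R).
Proof.
move=> u v; rewrite /same_ends; case: (set_val u) => a b.
by case: (set_val v) => c d /=; apply/idP/idP => /orP[]/eqP[-> ->];
  rewrite eqxx ?orbT.
Qed.

Lemma same_ends_trans (R : realType) : transitive (@same_ends R).
Proof.
move=> v u w; rewrite /same_ends; case: (set_val u) => a b.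
case: (set_val v) => c d; case: (set_val w) => e f /=.
by move=> /orP[]/eqP[-> ->] /orP[]/eqP[-> ->]; rewrite eqxx ?orbT.
Qed.

Canonical same_ends_equiv (R : realType) :=
  EquivRel (@same_ends R) (@same_ends_refl R) (@same_ends_sym R)
    (@same_ends_trans R).

Definition geodesics (R : realType) : topologicalType :=
  quotient_topology {eq_quot (@same_ends R)}.

(* The default value in [insubd] is irrelevant when [T] is an isometry, as the
   boundary map is then injective. *)
Definition geodesics_map (R : realType) (T : hplane R -> hplane R)
    (g : geodesics R) : geodesics R :=
  let u : ideal_pair R := repr g in
  \pi_(geodesics R) (insubd u
    (boundary_map T (set_val u).1, boundary_map T (set_val u).2)).

(** Universal coverings and the fundamental group *)

Definition evenly_covered (X Y : topologicalType) (p : X -> Y) (U : set Y) : Prop :=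
  exists (I : Type) (W : I -> set X),
    [/\ p @^-1` U = \bigcup_i W i,
        trivIset setT W,
        forall i, open (W i),
        forall i, set_bij (W i) U p &
        forall i V, open V -> V `<=` W i -> open (p @` V)].

Definition covering_map (X Y : topologicalType) (p : X -> Y) : Prop :=
  [/\ continuous p, range p = setT &
      forall y, exists2 U, open U /\ U y & evenly_covered p U].

(* [p] pulls the metric [m] back to 2 |dz| / (1 - |z|^2); [F] is [p] read in
   the chart [c], and is only constrained on the open set [p @^-1` dom c]. As
   the disc is simply connected, [p] is a universal covering; a conformal
   metric is complete and hyperbolic exactly when it admits such a [p]. *)
Definition hyperbolic_universal_covering (R : realType) (X : riemannSurface R)
    (m : conformalMetric X) (p : hplane R -> X) : Prop :=
  covering_map p /\
  forall c, atlas c -> exists F : Cplx R -> Cplx R,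
    forall z, dom c (p z) ->
      [/\ coord c (p z) = F (hval z),
          derivable F (hval z) 1 &
          density m c (p z) * modulus ('D_1 F (hval z)) =
            2 / (1 - modulus (hval z) ^+ 2)].

(* The fundamental group, through its action on the universal covering by
   deck transformations. *)
Definition pi1 (R : realType) (X : topologicalType) (p : hplane R -> X)
    : set (hplane R -> hplane R) :=
  [set k | homeomorphism k /\ p \o k = p].

Definition finitely_generated (T : Type) (G : set (T -> T)) : Prop :=
  exists2 S : set (T -> T), finite_set S /\ S `<=` G &
    forall G' : set (T -> T), S `<=` G' -> G' id ->
      (forall f g, G' f -> G' g -> G' (f \o g)) ->
      (forall f g, G' f -> cancel f g -> cancel g f -> G' g) ->
      G `<=` G'.

Definition group_isomorphism (T1 T2 : Type) (G1 : set (T1 -> T1))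
    (G2 : set (T2 -> T2)) (rho : (T1 -> T1) -> (T2 -> T2)) : Prop :=
  set_bij G1 G2 rho /\
  forall k k', G1 k -> G1 k' -> rho (k \o k') = rho k \o rho k'.

Definition limit_set (R : realType) (G : set (hplane R -> hplane R))
    : set (ideal R) :=
  [set xi | exists z, closure [set hval (k z) | k in G] (ival xi)].

Definition convex_core (R : realType) (X : topologicalType) (p : hplane R -> X)
    : set X :=
  p @` convex_hull (limit_set (pi1 p)).

Definition is_lift (R : realType) (X1 X2 : topologicalType)
    (p1 : hplane R -> X1) (p2 : hplane R -> X2) (h : X1 -> X2)
    (H : hplane R -> hplane R) : Prop :=
  continuous H /\ p2 \o H = h \o p1.

Definition equivariant (R : realType) (G : set (hplane R -> hplane R))
    (rho : (hplane R -> hplane R) -> (hplane R -> hplane R))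
    (f : geodesics R -> geodesics R) : Prop :=
  forall k g, G k -> f (geodesics_map k g) = geodesics_map (rho k) (f g).

(* Main.v *)
Require Import Defs.
From mathcomp Require Import all_boot all_order all_algebra.
From mathcomp Require Import all_classical all_reals all_analysis.
From mathcomp Require Import generic_quotient ring lra complex.
Set Implicit Arguments. Unset Strict Implicit. Unset Printing Implicit Defensive.
Import Order.TTheory GRing.Theory Num.Theory numFieldNormedType.Exports.
Local Notation Re := complex.Re.
Local Notation Im := complex.Im.
Local Open Scope classical_set_scope.
Local Open Scope ring_scope.
Local Open Scope complex_scope.
Local Open Scope quotient_scope.
Local Notation "x ^*" := (conjc x) : ring_scope.
Local Notation "x %:C" := (real_complex_def (Phant _) x) : ring_scope.

(* Deck transformations preserve the metric of the disc, so they are Moebius and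
   act on the circle at infinity. It is enough to extend every lift [H] of [h]
   continuously to the circle: the same applies to [H^-1], and the resulting
   equivariant homeomorphism of the circle acts on pairs of points.

   As the second group is of the first kind, attracting fixed points of its
   hyperbolic elements are dense in the circle. If [H] had no limit at a point
   [xi], then images of short segments near [xi] would cross the rays to all the
   points on one side of a cluster value. Whenever the ray to the attracting
   point of [rho g] is crossed in this way, [g] moves points close to [xi] by a
   bounded distance, hence fixes [xi]. By discreteness the stabilizer of [xi] is
   commutative, whereas hyperbolic elements [rho g] with three different
   attracting points do not commute. *)

(** * The complex plane *)

(** The surfaces may be of infinite type and [h] is only a homeomorphism, so a lift [H] need not be
    a quasi-isometry and images of geodesics cannot be followed up to bounded distance. The only
    control on [H] and its inverse is on compact discs. Attracting fixed points make this
    sufficient: powers of a hyperbolic element bring every point of the radius towards its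
    attracting point back into one fixed compact disc, and conjugation by [H] turns a displacement
    bound on a compact disc into a bound at all points that [H] sends to that radius. Near the
    circle a hyperbolic ball of fixed radius has small Euclidean size, so an element with bounded
    displacement at points tending to [xi] must fix [xi]. Topological arguments use Euclidean
    segments and rays from the origin; hyperbolic geodesics enter only through the convex hull. *)

Section Modulus.
Context {R : realType}.
Implicit Types (x y z w : R[i]) (a b : R).

Lemma modulus_ge0 z : 0 <= modulus z.
Proof. by case: z => a b; rewrite /Normc.normc sqrtr_ge0. Qed.

Lemma modulus_sqr z : modulus z ^+ 2 = Re z ^+ 2 + Im z ^+ 2.
Proof. by case: z => a b; rewrite /Normc.normc sqr_sqrtr// addr_ge0// sqr_ge0. Qed.

Lemma modulusM x y : modulus (x * y) = modulus x * modulus y.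
Proof. exact: Normc.normcM. Qed.

Lemma modulusV x : modulus x^-1 = (modulus x)^-1.
Proof. exact: Normc.normcV. Qed.

Lemma modulusN x : modulus (- x) = modulus x.
Proof. exact: normcN. Qed.

Lemma modulusD x y : modulus (x + y) <= modulus x + modulus y.
Proof. exact: le_normcD. Qed.

Lemma modulusC x y : modulus (x - y) = modulus (y - x).
Proof. by rewrite -modulusN opprB. Qed.

Lemma modulusB3 y x z : modulus (x - z) <= modulus (x - y) + modulus (y - z).
Proof. by rewrite -{1}(subrK y x) -addrA; exact: modulusD. Qed.

Lemma modulus_subl x y : modulus x - modulus y <= modulus (x - y).
Proof. by rewrite lerBlDr -{1}(subrK y x) modulusD. Qed.

Lemma modulus0 : modulus (0 : R[i]) = 0.
Proof. exact: Normc.normc0. Qed.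

Lemma modulus1 : modulus (1 : R[i]) = 1.
Proof. exact: Normc.normc1. Qed.

Lemma modulus_eq0 z : (modulus z == 0) = (z == 0).
Proof.
by apply/eqP/eqP => [/Normc.eq0_normc //|->]; exact: modulus0.
Qed.

Lemma modulus_gt0 z : (0 < modulus z) = (z != 0).
Proof. by rewrite lt_def modulus_eq0 modulus_ge0 andbT. Qed.

Lemma modulusJ z : modulus z^* = modulus z.
Proof. by case: z => a b; rewrite /Normc.normc /= sqrrN. Qed.

Lemma modulus_real a : modulus a%:C = `|a|.
Proof. by rewrite /Normc.normc/= expr0n/= addr0 sqrtr_sqr. Qed.

Lemma modulus_i : modulus ('i%C : R[i]) = 1.
Proof. by rewrite /Normc.normc/= expr0n/= add0r expr1n sqrtr1. Qed.

Lemma cReM x y : Re (x * y) = Re x * Re y - Im x * Im y.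
Proof. by case: x; case: y. Qed.
Lemma cImM x y : Im (x * y) = Re x * Im y + Im x * Re y.
Proof. by case: x => ? ?; case: y => ? ?. Qed.
Lemma cReD x y : Re (x + y) = Re x + Re y.
Proof. by case: x; case: y. Qed.
Lemma cImD x y : Im (x + y) = Im x + Im y.
Proof. by case: x; case: y. Qed.
Lemma cReN x : Re (- x) = - Re x.
Proof. by case: x. Qed.
Lemma cImN x : Im (- x) = - Im x.
Proof. by case: x. Qed.
Lemma cReJ x : Re x^* = Re x.
Proof. by case: x. Qed.
Lemma cImJ x : Im x^* = - Im x.
Proof. by case: x. Qed.
Lemma cRe_real a : Re (a%:C) = a.
Proof. by []. Qed.
Lemma cIm_real a : Im (a%:C) = 0.
Proof. by []. Qed.
Definition ReImE := (cReM, cImM, cReD, cImD, cReN, cImN, cReJ, cImJ, cRe_real, cIm_real).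

Lemma complex_ext x y : Re x = Re y -> Im x = Im y -> x = y.
Proof. by case: x; case: y => ? ? ? ? /= -> ->. Qed.

Lemma Re_le_modulus z : `|Re z| <= modulus z.
Proof.
rewrite -(ler_pXn2r (n := 2))// ?nnegrE ?modulus_ge0// modulus_sqr real_normK ?num_real//.
by rewrite lerDl sqr_ge0.
Qed.

Lemma Im_le_modulus z : `|Im z| <= modulus z.
Proof.
rewrite -(ler_pXn2r (n := 2))// ?nnegrE ?modulus_ge0// modulus_sqr real_normK ?num_real//.
by rewrite lerDr sqr_ge0.
Qed.

Lemma modulus_le_ReIm z : modulus z <= `|Re z| + `|Im z|.
Proof.
rewrite -(ler_pXn2r (n := 2)) ?nnegrE ?modulus_ge0 ?addr_ge0// modulus_sqr sqrrD.
rewrite !real_normK ?num_real// -addrA addrCA addrC -addrA lerD2l lerDl.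
by rewrite mulrn_wge0// mulr_ge0.
Qed.

Lemma mulJ z : z * z^* = ((modulus z ^+ 2)%:C).
Proof.
rewrite modulus_sqr; apply: complex_ext; rewrite !ReImE; ring.
Qed.

Lemma mulJl z : z^* * z = ((modulus z ^+ 2)%:C).
Proof. by rewrite mulrC mulJ. Qed.

Lemma unit_mulJ z : modulus z = 1 -> z * z^* = 1.
Proof. by move=> h; rewrite mulJ h expr1n. Qed.

Lemma modulus_le_sqr z a : 0 <= a -> modulus z ^+ 2 <= a ^+ 2 -> modulus z <= a.
Proof. by move=> a0; rewrite ler_pXn2r// ?nnegrE// modulus_ge0. Qed.

Lemma modulusB_sqr x y : modulus (x - y) ^+ 2 =
  modulus x ^+ 2 + modulus y ^+ 2 - 2 * Re (x * y^*).
Proof. rewrite !modulus_sqr !ReImE; ring. Qed.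

Lemma modulusD_sqr x y : modulus (x + y) ^+ 2 =
  modulus x ^+ 2 + modulus y ^+ 2 + 2 * Re (x * y^*).
Proof. rewrite !modulus_sqr !ReImE; ring. Qed.

End Modulus.

(** * Neighbourhoods by real radii, and connectedness of the unit interval *)

Section Topology.
Context {R : realType}.

(** Balls of [R[i]] have their radius in [R[i]]; positivity there forces a zero imaginary part, so
    real radii suffice. *)
Lemma nbhs_complexP (z : Cplx R) (A : set (Cplx R)) :
  nbhs z A <-> exists2 e : R, 0 < e & forall w, modulus (w - z) < e -> A w.
Proof.
rewrite -nbhs_ballE /nbhs_ball_ /=; split.
  move=> [e /= e0 eA].
  have [e0' eE] : 0 < Re e /\ e = ((Re e)%:C).
    by move: e0; case: e {eA} => a b; rewrite ltcE /= => /andP[/eqP -> ->].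
  exists (Re e) => // w we; apply: eA; rewrite /ball/= normc_def.
  rewrite eE ltcR -modulus_sqr sqrtr_sqr ger0_norm ?modulus_ge0//.
  by rewrite modulusC.
move=> [e e0 eA]; exists ((e%:C)); first by rewrite /= ltcR.
move=> w; rewrite /ball/= normc_def ltcR -modulus_sqr sqrtr_sqr.
by rewrite ger0_norm ?modulus_ge0// modulusC => /eA.
Qed.

Lemma nbhs_initialP (T : choiceType) (U : topologicalType) (f : T -> U) (x : T)
   (A : set (initial_topology f)) : 
  nbhs (x : initial_topology f) A <-> exists2 B : set U, nbhs (f x) B & f @^-1` B `<=` A.
Proof.
split.
  rewrite nbhsE => -[B [[V oV VB] Bx] BA]; exists V.
    by exists V => //; split => //; have : B x by []; rewrite -VB.
  by move=> y Vy; apply: BA; rewrite -VB.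
move=> [B nB BA]; apply: filterS BA _.
exact: (@initial_continuous T U f x).
Qed.

Lemma nbhs_hplaneP (z : hplane R) (A : set (hplane R)) :
  nbhs z A <-> exists2 e : R, 0 < e & forall w, modulus (hval w - hval z) < e -> A w.
Proof.
rewrite nbhs_initialP; split.
  by move=> [B /nbhs_complexP[e e0 eB] BA]; exists e => // w we; apply/BA/eB.
move=> [e e0 eA]; exists [set w | modulus (w - hval z) < e].
  by apply/nbhs_complexP; exists e.
by move=> w /= we; exact: eA.
Qed.

Lemma nbhs_idealP (z : ideal R) (A : set (ideal R)) :
  nbhs z A <-> exists2 e : R, 0 < e & forall w, modulus (ival w - ival z) < e -> A w.
Proof.
rewrite nbhs_initialP; split.
  by move=> [B /nbhs_complexP[e e0 eB] BA]; exists e => // w we; apply/BA/eB.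
move=> [e e0 eA]; exists [set w | modulus (w - ival z) < e].
  by apply/nbhs_complexP; exists e.
by move=> w /= we; exact: eA.
Qed.

Lemma nbhs_idealE (xi : ideal R) (A : set (hplane R)) :
  nbhs_ideal xi A <-> exists2 e : R, 0 < e & forall w, modulus (hval w - ival xi) < e -> A w.
Proof.
split.
  by move=> [B /nbhs_complexP[e e0 eB] BA]; exists e => // w we; apply/BA/eB.
move=> [e e0 eA]; exists [set w | modulus (w - ival xi) < e].
  by apply/nbhs_complexP; exists e.
by move=> w /= we; exact: eA.
Qed.

Lemma hval_lt1 (z : hplane R) : modulus (hval z) < 1.
Proof. by have := set_valP z. Qed.

Lemma ival_eq1 (z : ideal R) : modulus (ival z) = 1.
Proof. by have := set_valP z. Qed.

Lemma hval_inj : injective (@hval R).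
Proof. exact: val_inj. Qed.

Lemma ival_inj : injective (@ival R).
Proof. exact: val_inj. Qed.

Definition hpoint (z : R[i]) (h : modulus z < 1) : hplane R :=
  SigSub (mem_set h : z \in [set z : Cplx R | modulus z < 1]).

Definition ipoint (z : R[i]) (h : modulus z = 1) : ideal R :=
  SigSub (mem_set h : z \in [set z : Cplx R | modulus z = 1]).

Lemma hpointK (z : R[i]) (h : modulus z < 1) : hval (hpoint h) = z.
Proof. by []. Qed.

(** Connectedness of [[0, 1]], for a predicate that is locally constant relative to the interval:
    the supremum of the initial segments on which [P] holds satisfies [P] and cannot be passed by
    less than [e] unless it is close to 1. *)
Lemma locally_constant01 (P : R -> Prop) :
  (forall t, 0 <= t <= 1 -> exists2 e, 0 < e &
     forall s, 0 <= s <= 1 -> `|s - t| < e -> (P s <-> P t)) ->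
  P 0 -> P 1.
Proof.
move=> Ploc P0.
pose A := [set t | 0 <= t <= 1 /\ forall s, 0 <= s <= t -> P s].
have A0 : A 0.
  by split; [rewrite lexx ler01|move=> s; rewrite -eq_le => /eqP <-].
have A1 : ubound A 1 by move=> t [/andP[]].
have hsA : has_sup A by split; [exists 0|exists 1].
have c0 : 0 <= sup A by apply: ub_le_sup => //; exists 1.
have c1 : sup A <= 1 by apply: ge_sup => //; exists 0.
have [e e0 eP] := Ploc (sup A) (introT andP (conj c0 c1)).
have [t [/andP[t0 t1] tP]] := @sup_adherent R A e e0 hsA => st.
have tc : t <= sup A by apply: ub_le_sup => //; [exists 1|split => //; rewrite t0].
have Pc : P (sup A).
  apply/(eP t); [by rewrite t0|by rewrite distrC ger0_norm ?subr_ge0// ltrBlDl -ltrBlDr|].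
  by apply: tP; rewrite t0 lexx.
have Ps s : 0 <= s <= 1 -> s < sup A + e -> P s.
  move=> /andP[s0 s1] se; case: (leP s t) => [st'|ts]; first by apply: tP; rewrite s0.
  apply/(eP s); rewrite ?s0 ?s1//.
  rewrite ltr_norml; lra.
case: (ltP 1 (sup A + e)) => [h|h]; first by apply: Ps; rewrite // ler01 lexx.
exfalso; have : A (sup A + e / 2).
  split; first by apply/andP; split; lra.
  move=> s /andP[s0 s1]; apply: Ps; first by rewrite s0/=; lra.
  lra.
move=> /(ub_le_sup (ex_intro _ 1 A1)); lra.
Qed.

End Topology.

(** * Moebius transformations of the disc *)

Section Moebius.
Context {R : realType}.
Implicit Types (a b c d z w : R[i]).

(** The group SU(1,1): matrices of determinant 1 with rows [a], [b] and [b^*], [a^*]. They act on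
    the disc by [mob], whose denominator is [mden]. *)
Definition su11 a b := modulus a ^+ 2 - modulus b ^+ 2 = 1.
Definition mden a b z := b^* * z + a^*.
Definition mob a b z := (a * z + b) / mden a b z.

Lemma su11E a b : su11 a b -> a * a^* - b * b^* = 1.
Proof. by move=> h; rewrite !mulJ -rmorphB h. Qed.

Lemma su11P a b : a * a^* - b * b^* = 1 -> su11 a b.
Proof. by rewrite !mulJ -rmorphB => -[]. Qed.

Lemma su11_gt a b : su11 a b -> modulus b < modulus a.
Proof.
move=> h; rewrite -(ltr_pXn2r (n := 2))// ?nnegrE ?modulus_ge0//.
by rewrite -subr_gt0 h.
Qed.

Lemma su11_ge1 a b : su11 a b -> 1 <= modulus a.
Proof.
move=> h; rewrite -(ler_pXn2r (n := 2))// ?nnegrE ?modulus_ge0//.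
rewrite expr1n -h; have := sqr_ge0 (modulus b); lra.
Qed.

Lemma mden_ge a b z : modulus z <= 1 -> modulus a - modulus b * modulus z <= modulus (mden a b z).
Proof.
move=> z1; rewrite /mden (addrC (b^* * _)) -[X in modulus (_ + X)]opprK.
apply: (le_trans _ (modulus_subl _ _)).
by rewrite modulusN modulusM !modulusJ.
Qed.

Lemma mden_le a b z : modulus z <= 1 -> modulus (mden a b z) <= modulus a + modulus b.
Proof.
move=> z1; rewrite /mden (addrC (b^* * _)) (le_trans (modulusD _ _))//.
by rewrite modulusM !modulusJ lerD2l ler_piMr ?modulus_ge0.
Qed.

Lemma mden_gt0 a b z : su11 a b -> modulus z <= 1 -> 0 < modulus (mden a b z).
Proof.
move=> h z1; apply: lt_le_trans _ (mden_ge _ _ z1).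
rewrite subr_gt0; apply: le_lt_trans _ (su11_gt h).
by rewrite ler_piMr ?modulus_ge0.
Qed.

Lemma mden_neq0 a b z : su11 a b -> modulus z <= 1 -> mden a b z != 0.
Proof. by move=> h z1; rewrite -modulus_gt0 mden_gt0. Qed.

Lemma mob_sub a b z w : su11 a b -> modulus z <= 1 -> modulus w <= 1 ->
  mob a b z - mob a b w = (z - w) / (mden a b z * mden a b w).
Proof.
move=> h z1 w1; have hz := mden_neq0 h z1; have hw := mden_neq0 h w1.
(* Inserting the determinant, which is 1, leaves a rational identity without side condition on [a]
   and [b]. *)
have -> : z - w = (a * a^* - b * b^*) * (z - w) by rewrite su11E// mul1r.
by move: hz hw; rewrite /mob /mden => hz hw; field; rewrite hz hw.
Qed.

Lemma mob_subJ a b z w : su11 a b -> modulus z <= 1 -> modulus w <= 1 ->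
  1 - (mob a b z)^* * mob a b w = (1 - z^* * w) / ((mden a b z)^* * mden a b w).
Proof.
move=> h z1 w1; have hz := mden_neq0 h z1; have hw := mden_neq0 h w1.
have hz' : (mden a b z)^* != 0 by rewrite conjc_eq0.
have -> : 1 - z^* * w = (a * a^* - b * b^*) * (1 - z^* * w) by rewrite su11E// mul1r.
move: hz' hw; rewrite /mob /mden !(rmorphM, rmorphD, fmorphV) /= ?conjcK => hz' hw.
by field; rewrite hz' hw.
Qed.

Lemma mob_modulus a b z : su11 a b -> modulus z <= 1 ->
  1 - modulus (mob a b z) ^+ 2 = (1 - modulus z ^+ 2) / modulus (mden a b z) ^+ 2.
Proof.
move=> h z1; have := mob_subJ h z1 z1.
have e1 (s : R) : 1 - s%:C = (1 - s)%:C :> R[i] by rewrite rmorphB rmorph1.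
by rewrite !mulJl !e1 -fmorphV -rmorphM => -[].
Qed.

Lemma mob_lt1 a b z : su11 a b -> modulus z < 1 -> modulus (mob a b z) < 1.
Proof.
move=> h z1; rewrite -(ltr_pXn2r (n := 2))// ?nnegrE ?modulus_ge0//.
rewrite expr1n -subr_gt0 mob_modulus// ?(ltW z1)// divr_gt0//.
  by rewrite subr_gt0 -(expr1n _ 2) ltr_pXn2r// ?nnegrE ?modulus_ge0.
by rewrite exprn_gt0// mden_gt0// ltW.
Qed.

Lemma mob_eq1 a b z : su11 a b -> modulus z = 1 -> modulus (mob a b z) = 1.
Proof.
move=> h z1; have := @mob_modulus a b z h; rewrite z1 lexx expr1n subrr mul0r.
move=> /(_ isT) /eqP; rewrite subr_eq0 => /eqP/esym/eqP.
by rewrite sqrp_eq1 ?modulus_ge0// => /eqP.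
Qed.

Lemma mob_le1 a b z : su11 a b -> modulus z <= 1 -> modulus (mob a b z) <= 1.
Proof.
move=> h; rewrite le_eqVlt => /orP[/eqP z1|z1]; first by rewrite mob_eq1.
by rewrite ltW// mob_lt1.
Qed.

Lemma su11_comp a b c d : su11 a b -> su11 c d ->
  su11 (a * c + b * d^*) (a * d + b * c^*).
Proof.
move=> /su11E h /su11E h'; apply: su11P.
rewrite !(rmorphM, rmorphD) /= ?conjcK.
have -> : 1 = (a * a^* - b * b^*) * (c * c^* - d * d^*) by rewrite h h' mulr1.
ring.
Qed.

Lemma mob_comp a b c d z : su11 a b -> su11 c d -> modulus z <= 1 ->
  mob a b (mob c d z) = mob (a * c + b * d^*) (a * d + b * c^*) z.
Proof.
move=> h h' z1; have h2 := mden_neq0 (su11_comp h h') z1.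
have hz := mden_neq0 h' z1; have hw := mden_neq0 h (mob_le1 h' z1).
move: hz hw h2; rewrite /mob /mden !(rmorphM, rmorphD) /= ?conjcK => hz hw h2.
by field; rewrite hz h2 /=.
Qed.

Lemma su11_inv a b : su11 a b -> su11 a^* (- b).
Proof. by rewrite /su11 modulusJ modulusN. Qed.

Lemma mob_id z : mob 1 0 z = z.
Proof. by rewrite /mob /mden rmorph0 rmorph1 mul0r add0r mul1r addr0 divr1. Qed.

Lemma mob_real a z : a^* = a -> a != 0 -> mob a 0 z = z.
Proof.
move=> aE a0; rewrite /mob /mden rmorph0 mul0r add0r addr0 aE. by rewrite mulrC mulKf.
Qed.

Lemma mobK a b z : su11 a b -> modulus z <= 1 -> mob a^* (- b) (mob a b z) = z.
Proof.
move=> h z1; rewrite mob_comp//; last exact: su11_inv.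
have -> : a^* * a + - b * b^* = 1 by rewrite mulNr (mulrC _ a) su11E.
have -> : a^* * b + - b * a^* = 0 by ring.
by rewrite mob_id.
Qed.

Lemma mobVK a b z : su11 a b -> modulus z <= 1 -> mob a b (mob a^* (- b) z) = z.
Proof.
move=> h z1; have := mobK (su11_inv h) z1; by rewrite conjcK opprK.
Qed.

Lemma mob_0 a b : mob a b 0 = b / a^*.
Proof. by rewrite /mob /mden !mulr0 !add0r. Qed.

Lemma su11_neq0 a b : su11 a b -> a != 0.
Proof. by move=> h; rewrite -modulus_gt0 (lt_le_trans ltr01)// (su11_ge1 h). Qed.

Lemma su11_mob0 a b : su11 a b -> 1 - modulus (mob a b 0) ^+ 2 = (modulus a ^+ 2)^-1.
Proof.
move=> h; rewrite mob_modulus// ?modulus0// ?ler01//.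
by rewrite expr0n subr0 mul1r /mden mulr0 add0r modulusJ.
Qed.

(** The matrix with entries 1 and [a], divided by the square root of its determinant. *)
Lemma mob_to a : modulus a < 1 -> exists c d, su11 c d /\ mob c d 0 = a.
Proof.
move=> a1; pose r : R := (Num.sqrt (1 - modulus a ^+ 2))^-1.
have ha : 0 < 1 - modulus a ^+ 2.
  by rewrite subr_gt0 -(expr1n _ 2) ltr_pXn2r// ?nnegrE ?modulus_ge0.
have r0 : 0 < r by rewrite invr_gt0 sqrtr_gt0.
have r2 : r ^+ 2 = (1 - modulus a ^+ 2)^-1 by rewrite exprVn sqr_sqrtr// ltW.
exists r%:C, (r%:C * a); split.
  rewrite /su11 modulusM modulus_real gtr0_norm// exprMn r2.
  by rewrite -{1}(mulr1 _^-1) -mulrBr mulVf// gt_eqF.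
by rewrite mob_0 conjc_real mulrC mulKf// -modulus_gt0 modulus_real normr_gt0 gt_eqF.
Qed.

(** When [a] is large, a disc of fixed radius below 1 is sent close to the image of the origin. *)
Lemma mob_0_dist a b z : su11 a b -> modulus z < 1 ->
  modulus (mob a b z - mob a b 0) <= (modulus a ^+ 2 * (1 - modulus z))^-1.
Proof.
move=> h z1; rewrite mob_sub// ?modulus0 ?ler01// ?(ltW z1)// subr0.
have a0 : 0 < modulus a by rewrite modulus_gt0 (su11_neq0 h).
have hd : modulus a * (1 - modulus z) <= modulus (mden a b z).
  apply: le_trans _ (mden_ge _ _ (ltW z1)).
  by rewrite mulrBr mulr1 lerB// ler_wpM2r ?modulus_ge0// ltW// su11_gt.
have p0 : 0 < modulus a * (1 - modulus z) by rewrite mulr_gt0// subr_gt0.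
rewrite modulusM modulusV modulusM [X in _ * modulus X]/mden mulr0 add0r modulusJ.
rewrite ler_pdivrMr ?mulr_gt0 ?mden_gt0 ?(ltW z1)//.
rewrite (mulrC _^-1) ler_pdivlMr; last by rewrite expr2 -mulrA mulr_gt0.
have : 0 <= modulus a ^+ 2 * (1 - modulus z) by rewrite expr2 -mulrA ltW// mulr_gt0.
rewrite expr2 => h0; apply: (le_trans (ler_piMl h0 (ltW z1))).
by rewrite -mulrA (mulrC _ (modulus a)) ler_wpM2l// ltW.
Qed.

End Moebius.

(** * Compactness of the closed disc *)

Section Compactness.
Context {R : realType}.

Lemma complex_square_compact :
  compact ((fun p : R * R => (p.1 +i* p.2 : Cplx R)) @` (`[-1, 1] `*` `[-1, 1])).
Proof.
apply: continuous_compact; last by apply: compact_setX; exact: segment_compact.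
apply: continuous_subspaceT => -[x y] A /nbhs_complexP[e e0 eA].
have e20 : 0 < e / 2 by rewrite divr_gt0.
exists (ball x (e / 2), ball y (e / 2)); first by split; exact: nbhsx_ballx.
move=> [x' y'] [/= bx by']; apply: eA.
apply: le_lt_trans (modulus_le_ReIm _) _; rewrite /= (splitr e) ltrD//.
  by move: bx; rewrite /ball/= distrC.
by move: by'; rewrite /ball/= distrC.
Qed.

(** Compactness in the form of a uniform constant: [e] is both the radius of a neighbourhood and a
    constant valid on it. Centres [a] range over the whole plane, because the compact set in the
    proof is a square containing the disc. *)
Lemma disc_uniform (P : R -> R[i] -> Prop) :
  (forall d d' z, d' <= d -> P d z -> P d' z) ->
  (forall a, exists2 e, 0 < e & forall z, modulus (z - a) < e -> P e z) ->
  exists2 d, 0 < d & forall z, modulus z <= 1 -> P d z.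
Proof.
move=> Pmono Ploc.
have /compact_near_coveringP/(_ R (0^'+) P) := complex_square_compact.
case=> [a _|].
  have [e e0 eP] := Ploc a.
  exists ([set z | modulus (z - a) < e], [set d | d < e]).
    split; first by apply/nbhs_complexP; exists e.
    by near=> d; exact: (near (@nbhs_right_lt R 0 e e0) d).
  by move=> [z d] [/= za de]; exact: (Pmono e _ _ (ltW de) (eP _ za)).
rewrite /at_right/=.
move=> e /= e0 eP; exists (e / 2); first by rewrite divr_gt0.
move=> z z1; apply: (eP (e / 2)) => /=.
- by rewrite sub0r normrN gtr0_norm ?divr_gt0// ltr_pdivrMr// ltr_pMr// ltr1n.
- by rewrite divr_gt0.
exists (Re z, Im z); last by case: z {z1}.
split; rewrite /= in_itv/= -ler_norml.
- exact: le_trans (Re_le_modulus _) z1.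
- exact: le_trans (Im_le_modulus _) z1.
Unshelve. all: by end_near. Qed.

(** Contrapositive of [disc_uniform]; it yields cluster values without choosing sequences. *)
Lemma disc_cluster (Q : R -> R[i] -> Prop) :
  (forall d d' z, d' <= d -> Q d' z -> Q d z) ->
  (forall d, 0 < d -> exists2 z, modulus z <= 1 & Q d z) ->
  exists a, forall e, 0 < e -> exists2 z, modulus (z - a) < e & Q e z.
Proof.
move=> Qmono Qex; apply: contrapT => noa.
have [||d d0 dP] := @disc_uniform (fun d z => ~ Q d z).
- by move=> d d' z dd nQ Q'; apply/nQ/(Qmono _ _ _ dd).
- move=> a; apply: contrapT => nea; apply: noa; exists a => e e0.
  apply: contrapT => neq; apply: nea; exists e => // z za Qz; apply: neq.
  by exists z.
have [z z1 Qz] := Qex d d0; exact: (dP z z1 Qz).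
Qed.

End Compactness.

(** * Coverings and lifts *)

Section Covering.
Context {E X : topologicalType} (p : E -> X).
Hypothesis pcov : covering_map p.

Lemma covering_continuous : continuous p. Proof. by case: pcov. Qed.

Lemma covering_section (y : X) : exists2 U : set X, open U /\ U y &
  forall e, U (p e) -> exists g : X -> E,
    g (p e) = e /\ forall y', U y' -> p (g y') = y' /\ {for y', continuous g}.
Proof.
case: pcov => _ _ /(_ y)[U [oU Uy] [I [W [pU trivW oW bijW openW]]]].
exists U => // e Upe.
have [i _ Wie] : (\bigcup_i W i) e by rewrite -pU.
have [homo inj surj] := bijW i.
(* Outside [U] the section takes the default value [e]; being total, it composes with [f] without
   restriction. *)
pose g y' := xget e [set e' | W i e' /\ p e' = y'].
have gP y' : U y' -> W i (g y') /\ p (g y') = y'.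
  by move=> /surj[e' We' <-]; apply: (@xgetPex _ e [set e1 | W i e1 /\ p e1 = p e']); exists e'.
have gK e' : W i e' -> g (p e') = e'.
  move=> We'; have [Wg pg] := gP (p e') (homo _ We').
  by apply: inj => //; rewrite inE.
exists g; split; first exact: gK.
move=> y' Uy'; split; first by have [] := gP _ Uy'.
move=> A; rewrite nbhsE => -[B [oB Bg] BA].
have [Wg pg] := gP _ Uy'.
have : nbhs y' (p @` (B `&` W i)).
  rewrite nbhsE; exists (p @` (B `&` W i)) => //; split.
    by apply: (openW i); [exact: openI|move=> ? []].
  by exists (g y').
apply: filterS => _ [e' [Be' We'] <-]; apply: BA; by rewrite gK.
Qed.

Lemma covering_locally_injective (e : E) : exists2 W : set E, open W /\ W e &
  forall x y, W x -> W y -> p x = p y -> x = y.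
Proof.
case: pcov => _ _ /(_ (p e))[U [oU Uy] [I [W [pU trivW oW bijW openW]]]].
have [i _ Wie] : (\bigcup_i W i) e by rewrite -pU.
exists (W i) => // x y Wx Wy; have [_ inj _] := bijW i.
by apply: inj; rewrite inE.
Qed.

Definition continuous01 {R : realType} (a : R -> E) :=
  forall t, 0 <= t <= 1 -> forall V, nbhs (a t) V ->
    exists2 e, 0 < e & forall s, 0 <= s <= 1 -> `|s - t| < e -> V (a s).

(** Agreement is an open condition because [p] is locally injective, and disagreement is one because
    [E] is Hausdorff. *)
Lemma path_lift_unique {R : realType} (a b : R -> E) : hausdorff_space E ->
  continuous01 a -> continuous01 b ->
  (forall t, 0 <= t <= 1 -> p (a t) = p (b t)) -> a 0 = b 0 -> a 1 = b 1.
Proof.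
move=> hE ca cb pab; apply: (@locally_constant01 _ (fun t => a t = b t)) => t t01.
have [abt|abt] := pselect (a t = b t).
  have [W [oW We] Winj] := covering_locally_injective (a t).
  have [e e0 eP] := ca t t01 W (open_nbhs_nbhs (conj oW We)).
  have [|e' e'0 eP'] := cb t t01 W; first by rewrite -abt; exact: open_nbhs_nbhs.
  exists (Num.min e e'); first by rewrite lt_min e0.
  move=> s s01; rewrite lt_min => /andP[se se']; split=> // _.
  by apply: Winj; [exact: eP|exact: eP'|exact: pab].
have /eqP := abt; move: hE; rewrite open_hausdorff => /[apply].
move=> [[A B] /= [/set_mem Aa /set_mem Bb] [oA oB AB]].
have [e e0 eP] := ca t t01 A (open_nbhs_nbhs (conj oA Aa)).
have [e' e'0 eP'] := cb t t01 B (open_nbhs_nbhs (conj oB Bb)).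
exists (Num.min e e'); first by rewrite lt_min e0.
move=> s s01; rewrite lt_min => /andP[se se']; split=> // abs; exfalso.
have : (A `&` B) (a s) by split; [exact: eP|rewrite abs; exact: eP'].
by move/eqP: AB => ->.
Qed.

End Covering.

Lemma continuous_comp_cont (S T U : topologicalType) (f : S -> T) (g : T -> U) :
  continuous f -> continuous g -> continuous (g \o f).
Proof. by move=> cf cg z; apply: continuous_comp; [exact: cf|exact: cg]. Qed.

(** * Segments and Moebius maps of the disc *)

Section HyperbolicPlane.
Context {R : realType}.
Implicit Types (z w : hplane R).

Lemma hplane_hausdorff : hausdorff_space (hplane R).
Proof.
move=> z w cl; apply: hval_inj; apply/eqP; rewrite -subr_eq0 -modulus_eq0.
apply: contrapT => /negP; rewrite modulus_eq0 -modulus_gt0 => d0.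
set d := modulus _ in d0.
have d20 : 0 < d / 2 by rewrite divr_gt0.
have [||u [/= uz uw]] := cl [set u | modulus (hval u - hval z) < d / 2]
    [set u | modulus (hval u - hval w) < d / 2].
- by apply/nbhs_hplaneP; exists (d / 2).
- by apply/nbhs_hplaneP; exists (d / 2).
have := modulusB3 (hval u) (hval z) (hval w).
rewrite (modulusC (hval z) (hval u)) -/d; lra.
Qed.

Lemma continuous_hplaneP (H : hplane R -> hplane R) z :
  {for z, continuous H} <-> forall e, 0 < e -> exists2 d, 0 < d &
   forall w, modulus (hval w - hval z) < d -> modulus (hval (H w) - hval (H z)) < e.
Proof.
split=> [cH e e0|H' A /nbhs_hplaneP[e e0 eA]].
  have /cH/nbhs_hplaneP[d d0 dP] :
    nbhs (H z) [set u | modulus (hval u - hval (H z)) < e] by apply/nbhs_hplaneP; exists e.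
  by exists d.
by have [d d0 dP] := H' _ e0; apply/nbhs_hplaneP; exists d => // w /dP/eA.
Qed.

Definition horigin : hplane R := hpoint (eq_ind_r (fun x => x < 1) (ltr01) modulus0).

Lemma horiginE : hval horigin = 0. Proof. by []. Qed.

(** A Euclidean segment: every Euclidean ball, whatever its centre, is convex for it. The default
    [z] is not reached for [t] in [[0, 1]]. *)
Definition hseg z w (t : R) : hplane R :=
  insubd z ((1 - t)%:C * hval z + t%:C * hval w).

Lemma modulus_seg (x y a : R[i]) (t r : R) : 0 <= t <= 1 ->
  modulus (x - a) <= r -> modulus (y - a) <= r ->
  modulus ((1 - t)%:C * x + t%:C * y - a) <= r.
Proof.
move=> /andP[t0 t1] xr yr.
have -> : (1 - t)%:C * x + t%:C * y - a = (1 - t)%:C * (x - a) + t%:C * (y - a).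
  by rewrite rmorphB rmorph1; ring.
apply: le_trans (modulusD _ _) _.
rewrite !modulusM !modulus_real ger0_norm ?subr_ge0// ger0_norm//.
by have : 0 <= 1 - t by [rewrite subr_ge0]; nra.
Qed.

Lemma modulus_seg_lt (x y a : R[i]) (t r : R) : 0 <= t <= 1 ->
  modulus (x - a) < r -> modulus (y - a) < r ->
  modulus ((1 - t)%:C * x + t%:C * y - a) < r.
Proof.
move=> t01 xr yr.
apply: (@le_lt_trans _ _ (Num.max (modulus (x - a)) (modulus (y - a)))).
  by apply: modulus_seg; rewrite ?le_max ?lexx ?orbT.
by rewrite gt_max xr.
Qed.

Lemma hval_seg z w t : 0 <= t <= 1 ->
  hval (hseg z w t) = (1 - t)%:C * hval z + t%:C * hval w.
Proof.
move=> t01; rewrite /hval /hseg set_valE insubdK//.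
apply/mem_set; rewrite /= -[X in modulus X]subr0.
by apply: modulus_seg_lt => //; rewrite subr0; exact: hval_lt1.
Qed.

Lemma hseg0 z w : hseg z w 0 = z.
Proof.
by apply: hval_inj; rewrite hval_seg ?lexx ?ler01// subr0 rmorph1 rmorph0 mul1r mul0r addr0.
Qed.

Lemma hseg1 z w : hseg z w 1 = w.
Proof.
by apply: hval_inj; rewrite hval_seg ?lexx ?ler01// subrr rmorph1 rmorph0 mul1r mul0r add0r.
Qed.

Lemma hseg_lt z w t (a : R[i]) r : 0 <= t <= 1 -> modulus (hval z - a) < r ->
  modulus (hval w - a) < r -> modulus (hval (hseg z w t) - a) < r.
Proof. by move=> t01 zr wr; rewrite hval_seg//; exact: modulus_seg_lt. Qed.

Lemma hseg_dist z w s t : 0 <= t <= 1 -> 0 <= s <= 1 ->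
  modulus (hval (hseg z w s) - hval (hseg z w t)) <= 2 * `|s - t|.
Proof.
move=> t01 s01; rewrite !hval_seg//.
have -> : (1 - s)%:C * hval z + s%:C * hval w - ((1 - t)%:C * hval z + t%:C * hval w) =
  (s - t)%:C * (hval w - hval z) by rewrite !rmorphB rmorph1; ring.
rewrite modulusM modulus_real mulrC ler_wpM2r//.
apply: le_trans (modulusD _ _) _; rewrite modulusN.
by have := hval_lt1 z; have := hval_lt1 w; lra.
Qed.

Lemma continuous01_seg (E : topologicalType) (H : hplane R -> E) z w :
  (forall t, 0 <= t <= 1 -> {for hseg z w t, continuous H}) ->
  continuous01 (fun t : R => H (hseg z w t)).
Proof.
move=> cH t t01 V /(cH t t01)/nbhs_hplaneP[e e0 eP].
exists (e / 2); first by rewrite divr_gt0.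
move=> s s01 st; apply: eP; apply: le_lt_trans (hseg_dist _ _ t01 s01) _; lra.
Qed.

Lemma mob_lipschitz (a b z w : R[i]) : su11 a b -> modulus z <= 1 -> modulus w <= 1 ->
  modulus (mob a b z - mob a b w) <= modulus (z - w) / (modulus a - modulus b) ^+ 2.
Proof.
move=> h z1 w1; rewrite mob_sub// modulusM modulusV modulusM ler_wpM2l ?modulus_ge0//.
have ab := su11_gt h.
have hd u : modulus u <= 1 -> modulus a - modulus b <= modulus (mden a b u).
  move=> u1; apply: le_trans _ (mden_ge _ _ u1).
  by rewrite lerB// ler_piMr// modulus_ge0.
rewrite lef_pV2 ?posrE ?exprn_gt0 ?mulr_gt0 ?mden_gt0 ?subr_gt0//.
by rewrite expr2 ler_pM ?hd// ltW// subr_gt0.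
Qed.

Definition hmob (a b : R[i]) (h : su11 a b) z : hplane R := hpoint (mob_lt1 h (hval_lt1 z)).

Definition moebius (a b : R[i]) (T : hplane R -> hplane R) :=
  su11 a b /\ forall z, hval (T z) = mob a b (hval z).

Lemma hmob_moebius a b (h : su11 a b) : moebius a b (hmob h).
Proof. by []. Qed.

Lemma moebius_continuous a b T : moebius a b T -> continuous T.
Proof.
move=> [h TE] z; apply/continuous_hplaneP => e e0.
have d0 : 0 < (modulus a - modulus b) ^+ 2 by rewrite exprn_gt0// subr_gt0 su11_gt.
exists (e * (modulus a - modulus b) ^+ 2); first by rewrite mulr_gt0.
move=> w wz; rewrite !TE; apply: le_lt_trans (mob_lipschitz h _ _) _.
- exact: ltW (hval_lt1 _).
- exact: ltW (hval_lt1 _).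
- by rewrite ltr_pdivrMr.
Qed.

Lemma moebius_comp a b c d S T : moebius a b S -> moebius c d T ->
  moebius (a * c + b * d^*) (a * d + b * c^*) (S \o T).
Proof.
move=> [h SE] [h' TE]; split; first exact: su11_comp.
by move=> z; rewrite /= SE TE mob_comp// ltW// hval_lt1.
Qed.

Lemma moebius_inv a b S T : moebius a b S -> cancel T S -> moebius a^* (- b) T.
Proof.
move=> [h SE] TK; split; first exact: su11_inv.
by move=> z; rewrite -{2}(TK z) SE mobK// ltW// hval_lt1.
Qed.

Lemma hmobK a b (h : su11 a b) : cancel (hmob h) (hmob (su11_inv h)).
Proof. by move=> z; apply: hval_inj; rewrite /= !hpointK mobK// ltW// hval_lt1. Qed.

Lemma hmobVK a b (h : su11 a b) : cancel (hmob (su11_inv h)) (hmob h).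
Proof. by move=> z; apply: hval_inj; rewrite /= !hpointK mobVK// ltW// hval_lt1. Qed.

End HyperbolicPlane.

Arguments horigin {R}.

(** * Lifting maps from the disc through a covering *)

Section Lifting.
Context {R : realType} {E X : topologicalType} (p : E -> X).
Hypothesis pcov : covering_map p.
Hypothesis hE : hausdorff_space E.

(** Continuity is asked only at the points of the segment, so that partial lifts, continuous on a
    smaller disc, are allowed. *)
Lemma seg_lift_unique (H H' : hplane R -> E) z w :
  (forall t, 0 <= t <= 1 -> let u := hseg z w t in
    [/\ {for u, continuous H}, {for u, continuous H'} & p (H u) = p (H' u)]) ->
  H z = H' z -> H w = H' w.
Proof.
move=> hyp zz; rewrite -(hseg1 z w).
apply: (@path_lift_unique _ _ p pcov R (fun t => H (hseg z w t)) (fun t => H' (hseg z w t))) => //.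
- by apply: continuous01_seg => t /hyp[].
- by apply: continuous01_seg => t /hyp[].
- by move=> t /hyp[].
- by rewrite hseg0.
Qed.

Lemma hplane_lift_unique (H H' : hplane R -> E) z :
  continuous H -> continuous H' -> p \o H = p \o H' -> H z = H' z -> H = H'.
Proof.
move=> cH cH' HH zz; apply/funext => w; apply: (@seg_lift_unique H H' z w) => //.
move=> t _ u; split; [exact: cH|exact: cH'|].
by have := congr1 (@^~ u) HH.
Qed.

Variables (f : hplane R -> X) (e0 : E).
Hypothesis cf : continuous f.
Hypothesis fe0 : p e0 = f horigin.

Definition partial_lift (s : R) (H : hplane R -> E) :=
  H horigin = e0 /\ forall z, modulus (hval z) < s -> p (H z) = f z /\ {for z, continuous H}.

Definition local_lift (d : R) (c : hplane R) :=
  forall e, p e = f c -> exists g : X -> E, g (f c) = e /\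
    forall z, modulus (hval z - hval c) < d -> p (g (f z)) = f z /\ {for f z, continuous g}.

Lemma local_lift_uniform (r : R) : r < 1 ->
  exists2 d, 0 < d & forall c, modulus (hval c) <= r -> local_lift d c.
Proof.
move=> r1.
have [||d d0 dP] := @disc_uniform R (fun d z =>
   modulus z <= r -> forall c, hval c = z -> local_lift d c).
- move=> d d' z dd dP zr c cz e pe; have [g [ge gP]] := dP zr c cz e pe.
  by exists g; split => // w wc; apply: gP; exact: lt_le_trans dd.
(* The centre [a] may lie outside the open disc. Beyond the midpoint of [r] and 1, the ball of
   radius [(1 - r) / 2] contains no point of modulus at most [r]. *)
- move=> a; have [ar|ra] := leP (modulus a) ((1 + r) / 2); last first.
    exists ((1 - r) / 2); first by rewrite divr_gt0// subr_gt0.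
    move=> z za zr; exfalso; have := modulus_subl a z; rewrite modulusC; lra.
  have a1 : modulus a < 1 by lra.
  have [U [oU Uf] Usec] := covering_section pcov (f (hpoint a1)).
  have /cf/nbhs_hplaneP[e e0' eP] := open_nbhs_nbhs (conj oU Uf).
  exists (e / 2); first by rewrite divr_gt0.
  move=> z za zr c cz e1 pe1.
  have Uc : U (f c) by apply: eP; rewrite hpointK cz; lra.
  have [|g [ge1 gP]] := Usec e1; first by rewrite pe1.
  exists g; split; first by rewrite -pe1.
  move=> w wc; apply: gP; apply: eP; rewrite hpointK.
  apply: le_lt_trans (modulusB3 (hval c) _ _) _; rewrite {2}cz; lra.
by exists d => // c cr; apply: (dP (hval c)) => //; exact: ltW (hval_lt1 _).
Qed.

(* A lift on the disc of radius [s] extends to radius [s + d / 2] by sections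
   of [p] over balls of radius [d] centred at [s / (s + d / 2) * z]. *)
Lemma partial_lift_extend (s d : R) H : 0 < s -> 0 < d -> s + d / 2 <= 1 ->
  (forall c, modulus (hval c) < s -> local_lift d c) ->
  partial_lift s H -> exists H', partial_lift (s + d / 2) H'.
Proof.
move=> s0 d0 sd1 loc [H0 HP].
have /choice[G GP] : forall c, exists g : X -> E, modulus (hval c) < s ->
    g (f c) = H c /\ forall z, modulus (hval z - hval c) < d ->
      p (g (f z)) = f z /\ {for f z, continuous g}.
  move=> c; have [cs|] := pselect (modulus (hval c) < s); last by exists (fun=> e0).
  have [g gP] := loc c cs (H c) (HP c cs).1; by exists g.
set k := s / (s + d / 2).
have sd0 : 0 < s + d / 2 by rewrite addr_gt0// divr_gt0.
have k01 : 0 <= k <= 1.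
  rewrite /k divr_ge0 ?(ltW s0) ?(ltW sd0)//= ler_pdivrMr// mul1r; lra.
pose c z := hseg horigin z k.
have cE z : hval (c z) = k%:C * hval z by rewrite hval_seg// horiginE mulr0 add0r.
have ctr z : modulus (hval z) < s + d / 2 ->
    modulus (hval (c z)) < s /\ modulus (hval z - hval (c z)) < d / 2.
  move=> zs; rewrite cE; split.
    rewrite modulusM modulus_real ger0_norm; last by case/andP: k01.
    by rewrite /k mulrAC ltr_pdivrMr// ltr_pM2l.
  have -> : hval z - k%:C * hval z = (1 - k)%:C * hval z by rewrite rmorphB rmorph1; ring.
  have -> : 1 - k = d / 2 / (s + d / 2) by apply/eqP; rewrite subr_eq -mulrDl (addrC _ s) divff // gt_eqF.
  rewrite modulusM modulus_real ger0_norm; last by rewrite divr_ge0 ?(ltW sd0)// divr_ge0 ?(ltW d0).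
  by rewrite mulrAC ltr_pdivrMr// ltr_pM2l// divr_gt0.
exists (fun z => G (c z) (f z)); split.
  have c0 : c horigin = horigin by apply: hval_inj; rewrite cE horiginE mulr0.
  by rewrite c0 (GP horigin _).1 ?H0// horiginE modulus0.
move=> z zs; have [czs czd] := ctr z zs.
have cfor (u : hplane R) (g : X -> E) : {for f u, continuous g} -> {for u, continuous (g \o f)}.
  by move=> cg; by apply: continuous_comp => //; exact: cf.
split; first by have [|] := (GP _ czs).2 z _ => //; lra.
(* The sections at [c z] and [c w] are compared in two moves: from [c z] to [c w], where both follow
   the given lift [H], then from [c w] to [w], inside both balls. *)
have eqn : \forall w \near z, G (c z) (f w) = G (c w) (f w).
  apply/nbhs_hplaneP; exists (Num.min (s + d / 2 - modulus (hval z)) (d / 2)).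
    by rewrite lt_min subr_gt0 zs divr_gt0.
  move=> w; rewrite lt_min => /andP[wz wzd].
  have ws : modulus (hval w) < s + d / 2.
    by have := modulus_subl (hval w) (hval z); lra.
  have [cws cwd] := ctr w ws.
  have cwz : modulus (hval (c w) - hval (c z)) < d.
    rewrite !cE -mulrBr modulusM modulus_real ger0_norm; last by case/andP: k01.
    have := modulus_ge0 (hval w - hval z); case/andP: k01 => k0 k1; nra.
  have wcz : modulus (hval w - hval (c z)) < d.
    by have := modulusB3 (hval z) (hval w) (hval (c z)); lra.
  have e1 : G (c z) (f (c w)) = H (c w).
    apply: (@seg_lift_unique (G (c z) \o f) H (c z) (c w)); last exact: (GP _ czs).1.
    move=> t t01 u.
    have us : modulus (hval u) < s by rewrite -[hval u]subr0; apply: hseg_lt; rewrite // subr0.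
    have ud : modulus (hval u - hval (c z)) < d.
      by apply: hseg_lt; rewrite // subrr modulus0.
    have [? /cfor ?] := (GP _ czs).2 u ud; have [Hu ?] := HP u us.
    by split => //; rewrite Hu.
  apply: (@seg_lift_unique (G (c z) \o f) (G (c w) \o f) (c w) w); last first.
    by rewrite /= e1 (GP _ cws).1.
  move=> t t01 u.
  have ud : modulus (hval u - hval (c z)) < d by apply: hseg_lt.
  have ud' : modulus (hval u - hval (c w)) < d.
    by apply: hseg_lt; rewrite // ?subrr ?modulus0//; lra.
  have [e2 /cfor ?] := (GP _ czs).2 u ud; have [e3 /cfor ?] := (GP _ cws).2 u ud'.
  by split => //; rewrite /= e2 e3.
have cz : {for z, continuous (G (c z) \o f)}.
  by apply: cfor; apply: ((GP _ czs).2 z _).2; lra.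
move=> A nA; have /nbhs_hplaneP[e1 e10 eP1] := cz A nA.
have /nbhs_hplaneP[e2 e20 eP2] := eqn.
apply/nbhs_hplaneP; exists (Num.min e1 e2); first by rewrite lt_min e10.
by move=> w; rewrite lt_min => /andP[w1 w2]; rewrite /= -eP2//; exact: eP1.
Qed.

(** For [r < 1] one [d] serves all centres of modulus at most [r], so finitely many increments of
    [d / 2] reach [r]. *)
Lemma partial_lift_exists (r : R) : r < 1 -> exists H, partial_lift r H.
Proof.
move=> r1; have [r0|r0] := leP r 0.
  exists (fun=> e0); split => // z zr; exfalso; have := modulus_ge0 (hval z); lra.
have [d d0 dP] := local_lift_uniform r1.
have start s : s <= d -> exists H, partial_lift s H.
  move=> sd; have [|g [ge gP]] := dP horigin _ e0 fe0.
    by rewrite horiginE modulus0 ltW.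
  exists (g \o f); split => // z zs; have [|e1 cg] := gP z.
    by rewrite horiginE subr0; exact: lt_le_trans sd.
  by split => //; apply: continuous_comp => //; exact: cf.
have step n s : s <= n%:R * (d / 2) -> s <= r -> exists H, partial_lift s H.
  elim: n s => [|n IH] s sn sr.
    by apply: start; rewrite mul0r in sn; apply: le_trans sn (ltW d0).
  have [sd|ds] := leP s d; first exact: start.
  rewrite -(subrK (d / 2) s); have [||H HP] := IH (s - d / 2).
  - by rewrite lerBlDr -{2}(mul1r (d / 2)) -mulrDl natr1.
  - by lra.
  apply: (partial_lift_extend _ d0 _ _ HP); [lra|lra|].
  by move=> c cs; apply: dP; lra.
apply: (step (Num.truncn (r / (d / 2))).+1) => //.
by rewrite -ler_pdivrMr ?divr_gt0// ltW// truncnS_gt.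
Qed.

Lemma hplane_lift0 : exists H : hplane R -> E,
  [/\ continuous H, p \o H = f & H horigin = e0].
Proof.
have /choice[L LP] : forall r : R, exists H, r < 1 -> partial_lift r H.
  move=> r; have [r1|] := pselect (r < 1); last by exists (fun=> e0).
  by have [H HP] := partial_lift_exists r1; exists H.
(* Partial lifts of different radii agree, by uniqueness along segments from the origin. The radius
   halfway between the modulus of [z] and 1 also contains a neighbourhood of [z]. *)
pose rad z := (1 + modulus (hval z)) / 2 : R.
have rad1 z : rad z < 1 by have := hval_lt1 z; rewrite /rad; lra.
have radz z : modulus (hval z) < rad z by have := hval_lt1 z; rewrite /rad; lra.
have agree r r' z : r < 1 -> r' < 1 -> modulus (hval z) < r -> modulus (hval z) < r' ->
    L r z = L r' z.
  move=> r1 r1' zr zr'; have [L0 LH] := LP r r1; have [L0' LH'] := LP r' r1'.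
  apply: (@seg_lift_unique (L r) (L r') horigin z); last by rewrite L0 L0'.
  move=> t t01 u.
  have um s : modulus (hval z) < s -> modulus (hval u) < s.
    move=> zs; rewrite -[hval u]subr0; apply: hseg_lt; rewrite // subr0// horiginE modulus0.
    exact: le_lt_trans (modulus_ge0 _) zs.
  by have [e1 ?] := LH u (um _ zr); have [e2 ?] := LH' u (um _ zr'); split; rewrite // e1.
exists (fun z => L (rad z) z); split.
- move=> z A nA; have [_ /(_ z (radz z))[_ /(_ A nA)/nbhs_hplaneP[e e0' eA]]] := LP _ (rad1 z).
  apply/nbhs_hplaneP; exists (Num.min e (rad z - modulus (hval z))).
    by rewrite lt_min e0' subr_gt0 radz.
  move=> w; rewrite lt_min => /andP[we wz]; rewrite /= (agree _ (rad z))//; first exact: eA.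
  by have := modulus_subl (hval w) (hval z); lra.
- by apply/funext => z /=; have [_ /(_ z (radz z))[]] := LP _ (rad1 z).
- by have [] := LP _ (rad1 horigin).
Qed.

End Lifting.

(** A Moebius map moves the base point to the origin. *)
Lemma hplane_lift {R : realType} {E X : topologicalType} (p : E -> X)
    (f : hplane R -> X) (z0 : hplane R) (e0 : E) :
  covering_map p -> hausdorff_space E -> continuous f -> p e0 = f z0 ->
  exists H : hplane R -> E, [/\ continuous H, p \o H = f & H z0 = e0].
Proof.
move=> pcov hE cf pe0; have [a [b [h ab]]] := mob_to (hval_lt1 z0).
have T0 : hmob h horigin = z0 by apply: hval_inj; rewrite hpointK horiginE.
have [||H [cH pH H0]] := @hplane_lift0 R E X p pcov hE (f \o hmob h) e0.
- by apply: continuous_comp_cont => //; exact: moebius_continuous (hmob_moebius h).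
- by rewrite /= T0.
exists (H \o hmob (su11_inv h)); split.
- by apply: continuous_comp_cont => //; exact: moebius_continuous (hmob_moebius _).
- by rewrite compA pH -compA; apply/funext => z /=; rewrite hmobVK.
- by rewrite /= -T0 hmobK.
Qed.

(** * The deck group *)

Section DeckGroup.
Context {R : realType} {X : topologicalType} (p : hplane R -> X).
Hypothesis pcov : covering_map p.

Lemma pi1_continuous k : pi1 p k -> continuous k. Proof. by move=> [[]]. Qed.

Lemma pi1_id : pi1 p id.
Proof.
split => //; split; first by move=> x A.
by exists id; split => // x A.
Qed.

Lemma pi1_comp k l : pi1 p k -> pi1 p l -> pi1 p (k \o l).
Proof.
move=> [[ck [k' [ck' kk' k'k]]] pk] [[cl [l' [cl' ll' l'l]]] pl].
split; last by rewrite compA pk pl.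
split; first exact: continuous_comp_cont.
by exists (l' \o k'); split; [exact: continuous_comp_cont|exact: can_comp|exact: can_comp].
Qed.

Lemma pi1_inv k : pi1 p k -> exists k', [/\ pi1 p k', cancel k k' & cancel k' k].
Proof.
move=> [[ck [k' [ck' kk' k'k]]] pk]; exists k'; split => //; split.
  by split => //; exists k.
by rewrite -{1}pk -compA; apply/funext => z /=; rewrite k'k.
Qed.

Lemma pi1_eq k l z : pi1 p k -> pi1 p l -> k z = l z -> k = l.
Proof.
move=> gk gl kl; apply: (hplane_lift_unique pcov hplane_hausdorff _ _ _ kl).
- exact: pi1_continuous.
- exact: pi1_continuous.
- by case: gk => _ ->; case: gl => _ ->.
Qed.

(** Coverings by the disc are normal: [p] lifts through itself with any prescribed value in the
    fibre, and the lifts obtained in the two directions are inverse to each other by uniqueness. *)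
Lemma pi1_transitive z w : p z = p w -> exists2 k, pi1 p k & k z = w.
Proof.
move=> pzw; have cp := covering_continuous pcov.
have [k [ck pk kz]] := hplane_lift pcov hplane_hausdorff cp (esym pzw).
have [l [cl pl lw]] := hplane_lift pcov hplane_hausdorff cp pzw.
have ci : continuous (@id (hplane R)) by move=> x A.
exists k => //; split => //; split => //; exists l; split => // x.
- apply: (congr1 (@^~ x) (@hplane_lift_unique _ _ _ p pcov hplane_hausdorff (l \o k) id z _ _ _ _)) => //.
  + exact: continuous_comp_cont.
  + by rewrite compA pl pk.
  + by rewrite /= kz.
- apply: (congr1 (@^~ x) (@hplane_lift_unique _ _ _ p pcov hplane_hausdorff (k \o l) id w _ _ _ _)) => //.
  + exact: continuous_comp_cont.
  + by rewrite compA pk pl.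
  + by rewrite /= lw.
Qed.

(** A neighbourhood on which [p] is injective contains no other point of the orbit of [horigin], and
    a deck transformation fixing a point is the identity. *)
Lemma pi1_discrete : exists2 e, 0 < e &
  forall k, pi1 p k -> modulus (hval (k horigin)) < e -> k = id.
Proof.
have [W [oW W0] Winj] := covering_locally_injective pcov (horigin : hplane R).
have /nbhs_hplaneP[e e0 eW] := open_nbhs_nbhs (conj oW W0).
exists e => // k gk ke; apply: (pi1_eq (z := horigin) gk pi1_id).
apply: Winj => //; first by apply: eW; rewrite horiginE subr0.
by case: gk => _ pk; exact: (congr1 (@^~ horigin) pk).
Qed.

End DeckGroup.

Section LiftsOfHomeomorphisms.
Context {R : realType} {X1 X2 : topologicalType}.
Variables (p1 : hplane R -> X1) (p2 : hplane R -> X2) (h : X1 -> X2).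
Hypotheses (pcov1 : covering_map p1) (pcov2 : covering_map p2).

Lemma lift_exists : continuous h -> exists H, is_lift p1 p2 h H.
Proof.
move=> ch; have [_ sp2 _] := pcov2.
have [e0 _ pe0] : range p2 (h (p1 horigin)) by rewrite sp2.
have cf : continuous (h \o p1).
  by apply: continuous_comp_cont => //; exact: covering_continuous pcov1.
have [H [cH pH _]] := hplane_lift pcov2 hplane_hausdorff cf pe0.
by exists H.
Qed.

Lemma lift_homeomorphism H : homeomorphism h -> is_lift p1 p2 h H ->
  exists H', [/\ continuous H', cancel H H' & cancel H' H].
Proof.
move=> [ch [h' [ch' hh' h'h]]] [cH pH].
have cp1 := covering_continuous pcov1.
have cp2 := covering_continuous pcov2.
have cf : continuous (h' \o p2) by exact: continuous_comp_cont.
have e1 : p1 horigin = (h' \o p2) (H horigin).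
  by have := congr1 (@^~ horigin) pH => /= ->; rewrite hh'.
have [H' [cH' pH' H'0]] := hplane_lift pcov1 hplane_hausdorff cf e1.
have ci : continuous (@id (hplane R)) by move=> x A.
exists H'; split => // z.
- apply: (congr1 (@^~ z) (@hplane_lift_unique _ _ _ p1 pcov1 hplane_hausdorff (H' \o H) id horigin _ _ _ _)) => //.
  + exact: continuous_comp_cont.
  + rewrite compA pH' -compA pH; apply/funext => x /=; by rewrite hh'.
- apply: (congr1 (@^~ z) (@hplane_lift_unique _ _ _ p2 pcov2 hplane_hausdorff (H \o H') id (H horigin) _ _ _ _)) => //.
  + exact: continuous_comp_cont.
  + rewrite compA pH -compA pH'; apply/funext => x /=; by rewrite h'h.
  + by rewrite /= H'0.
Qed.

End LiftsOfHomeomorphisms.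

(** * Deck transformations are Moebius *)

Section Derivatives.
Context {R : realType}.

Lemma nbhs0_complexP (A : set (Cplx R)) :
  nbhs (0^' : set_system (Cplx R)) A <-> exists2 e : R, 0 < e &
    forall h, h != 0 -> modulus h < e -> A h.
Proof.
split.
  move=> /nbhs_complexP[e e0 eA]; exists e => // h h0 he; apply: eA => //.
  by rewrite subr0.
by move=> [e e0 eA]; apply/nbhs_complexP; exists e => // h; rewrite subr0 => he /eqP/eqP h0; exact: eA.
Qed.

Lemma complex_derivative_approx (F : Cplx R -> Cplx R) (a : R[i]) : derivable F a 1 ->
  forall e : R, 0 < e -> exists2 d, 0 < d & forall w : R[i], modulus (w - a) < d ->
    modulus (F w - F a - 'D_1 F a * (w - a)) <= e * modulus (w - a).
Proof.
move=> dF e e0.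
have : nbhs ('D_1 F a) [set z | modulus (z - 'D_1 F a) < e] by apply/nbhs_complexP; exists e.
move=> /dF/nbhs0_complexP[d d0 dP]; exists d => // w wd.
have [->|wa] := eqVneq w a; first by rewrite !subrr mulr0 subr0 modulus0 mulr0.
have h0 : w - a != 0 by rewrite subr_eq0.
have := dP (w - a) h0 wd; rewrite /= /GRing.scale/= mulr1 subrK => lt_e.
have -> : F w - F a - 'D_1 F a * (w - a) =
  ((w - a)^-1 * (F w - F a) - 'D_1 F a) * (w - a).
  by rewrite mulrBl mulrAC mulVf// mul1r.
by rewrite modulusM ler_wpM2r ?modulus_ge0// ltW.
Qed.

Lemma is_derive_approx (f : R -> R) (t D : R) :
  (forall e, 0 < e -> exists2 d, 0 < d & forall s, `|s - t| < d ->
     `|f s - f t - D * (s - t)| <= e * `|s - t|) ->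
  is_derive t (1 : R) f D.
Proof.
move=> hyp.
suff cv : (fun h => h^-1 *: ((f \o shift t) (h *: (1 : R)) - f t)) @ 0^' --> D.
  by apply: DeriveDef; [apply/cvg_ex; exists D|exact/cvg_lim].
apply/cvgrPdist_le => e e0; have [d d0 dP] := hyp e e0.
exists d => //= h /=; rewrite sub0r normrN => hd h0.
have := dP (h + t); rewrite addrK => /(_ hd) le_e.
rewrite /shift/= -[h *: 1]/(h * 1) mulr1 -[_ *: _]/(h^-1 * (f (h + t) - f t)) distrC.
have -> : h^-1 * (f (h + t) - f t) - D = h^-1 * (f (h + t) - f t - D * h).
  by field.
rewrite normrM normfV mulrC ler_pdivrMr ?normr_gt0//.
Qed.

(** The complex derivative as a first-order estimate, since the disc is a subtype and not a vector
    space. *)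
Definition hderiv (k : hplane R -> hplane R) z (d : R[i]) :=
  forall e, 0 < e -> exists2 r, 0 < r & forall w, modulus (hval w - hval z) < r ->
    modulus (hval (k w) - hval (k z) - d * (hval w - hval z)) <=
      e * modulus (hval w - hval z).

(** Conformal invariance of [2 |dz| / (1 - |z|^2)], with no continuity of the derivative. *)
Definition infinitesimal_isometry (k : hplane R -> hplane R) := forall z,
  exists2 d, hderiv k z d &
    modulus d = (1 - modulus (hval (k z)) ^+ 2) / (1 - modulus (hval z) ^+ 2).

Lemma disc_gt0 (z : hplane R) : 0 < 1 - modulus (hval z) ^+ 2.
Proof.
by rewrite subr_gt0 -(expr1n _ 2) ltr_pXn2r// ?nnegrE ?modulus_ge0// hval_lt1.
Qed.

Lemma hderiv_comp k l z c d : hderiv k z c -> hderiv l (k z) d -> hderiv (l \o k) z (d * c).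
Proof.
move=> hk hl e e0.
have c1 : 0 < modulus c + 1 by rewrite ltr_wpDl ?modulus_ge0.
have d1 : 0 < modulus d + 1 by rewrite ltr_wpDl ?modulus_ge0.
pose e1 := Num.min 1 (e / 2 / (modulus d + 1)); pose e2 := e / 2 / (modulus c + 1).
have e10 : 0 < e1 by rewrite lt_min ltr01 !divr_gt0.
have e20 : 0 < e2 by rewrite !divr_gt0.
have [r1 r10 hr1] := hk e1 e10; have [r2 r20 hr2] := hl e2 e20.
exists (Num.min r1 (r2 / (modulus c + 1))); first by rewrite lt_min r10 divr_gt0.
move=> w; rewrite lt_min ltr_pdivlMr// => /andP[w1 w2].
set u := hval w - hval z in w1 w2 *; set v := hval (k w) - hval (k z).
have u0 := modulus_ge0 u.
have hv := hr1 w w1; rewrite -/v -/u in hv.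
have vle : modulus v <= (modulus c + 1) * modulus u.
  have := modulusD (v - c * u) (c * u); rewrite subrK modulusM => h.
  have : e1 <= 1 by rewrite ge_min lexx.
  nra.
have : modulus (hval (l (k w)) - hval (l (k z)) - d * v) <= e2 * modulus v.
  by apply: hr2; apply: le_lt_trans vle _; rewrite mulrC.
set L := hval _ - hval _ => hL.
have -> : hval ((l \o k) w) - hval ((l \o k) z) - d * c * u = (L - d * v) + d * (v - c * u).
  by rewrite /L /=; ring.
apply: le_trans (modulusD _ _) _; rewrite modulusM.
have b1 : e2 * modulus v <= e / 2 * modulus u.
  apply: le_trans (_ : e2 * ((modulus c + 1) * modulus u) <= _); first by rewrite ler_pM2l.
  by rewrite mulrA /e2 divfK// gt_eqF.
have b2 : modulus d * modulus (v - c * u) <= e / 2 * modulus u.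
  apply: le_trans (_ : (modulus d + 1) * (e1 * modulus u) <= _).
    by rewrite ler_pM ?modulus_ge0// lerDl.
  rewrite mulrA ler_wpM2r// mulrC -ler_pdivlMr// /e1 ge_min lexx orbT//.
lra.
Qed.

Lemma hderiv_mob a b T z : moebius a b T ->
  hderiv T z (mden a b (hval z) ^+ 2)^-1.
Proof.
move=> [h TE] e e0; pose m := modulus a - modulus b.
have m0 : 0 < m by rewrite subr_gt0 su11_gt.
have hd u : modulus u <= 1 -> m <= modulus (mden a b u).
  move=> u1; apply: le_trans _ (mden_ge _ _ u1).
  by rewrite lerB// ler_piMr// modulus_ge0.
have b1 : 0 < modulus b + 1 by rewrite ltr_wpDl ?modulus_ge0.
(* The remainder is exactly [- b^* u^2] over a product of three denominators, each of modulus at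
   least [m]. *)
exists (e * m ^+ 3 / (modulus b + 1)); first by rewrite divr_gt0// mulr_gt0// exprn_gt0.
move=> w; rewrite ltr_pdivlMr// => we.
have z1 := ltW (hval_lt1 z); have w1 := ltW (hval_lt1 w).
rewrite !TE mob_sub//.
set u := hval w - hval z in we *.
have dz0 := mden_neq0 h z1; have dw0 := mden_neq0 h w1.
have -> : u / (mden a b (hval w) * mden a b (hval z)) - (mden a b (hval z) ^+ 2)^-1 * u =
  u * (- b^* * u) / (mden a b (hval w) * mden a b (hval z) ^+ 2).
  have -> : - b^* * u = mden a b (hval z) - mden a b (hval w) by rewrite /mden /u; ring.
  by field; rewrite dz0 dw0.
rewrite modulusM modulusV !modulusM modulusN modulusJ.
rewrite mulrC ler_pdivrMl; last by rewrite !mulr_gt0// mden_gt0.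
rewrite [X in _ <= X](_ : _ = modulus u * (e * (modulus (mden a b (hval w)) * modulus (mden a b (hval z)) ^+ 2))); last first.
  by rewrite expr2; ring.
rewrite ler_wpM2l ?modulus_ge0//.
have hw := hd _ w1; have hz := hd _ z1.
have : m ^+ 3 <= modulus (mden a b (hval w)) * modulus (mden a b (hval z)) ^+ 2.
  by rewrite exprS ler_pM ?exprn_ge0 ?(ltW m0)// lerXn2r ?nnegrE ?modulus_ge0 ?(ltW m0).
move=> /(ler_wpM2l (ltW e0)); have := modulus_ge0 u; have := modulus_ge0 b; nra.
Qed.

Lemma infinitesimal_isometry_mob a b T : moebius a b T -> infinitesimal_isometry T.
Proof.
move=> hT z; exists (mden a b (hval z) ^+ 2)^-1; first exact: hderiv_mob.
have [h TE] := hT.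
rewrite TE mob_modulus// ?ltW ?hval_lt1// mulrAC divff ?mul1r ?gt_eqF ?disc_gt0//.
by rewrite modulusV expr2 modulusM -expr2.
Qed.

Lemma infinitesimal_isometry_comp k l : infinitesimal_isometry k ->
  infinitesimal_isometry l -> infinitesimal_isometry (l \o k).
Proof.
move=> hk hl z; have [c hc cE] := hk z; have [d hd dE] := hl (k z).
exists (d * c); first exact: hderiv_comp.
by rewrite modulusM cE dE /= mulrA divfK// gt_eqF ?disc_gt0.
Qed.

End Derivatives.

Section DeckIsometry.
Context {R : realType} {X : riemannSurface R} {m : conformalMetric X}.
Variable p : hplane R -> X.
Hypothesis hyp : hyperbolic_universal_covering m p.

(** As [p \o k = p], the chart expression [F] of [p] satisfies [F (k w) = F w] near [z], so [k] must
    have derivative [A / B], with [A] and [B] the derivatives of [F] at [z] and [k z]. The density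
    cancels, because it is taken at the same point of [X]. *)
Lemma pi1_infinitesimal_isometry k : pi1 p k -> infinitesimal_isometry k.
Proof.
move=> gk z; have [pcov chartP] := hyp.
have cp := covering_continuous pcov.
have pk w : p (k w) = p w by case: gk => _ pkE; exact: (congr1 (@^~ w) pkE).
have [c ac dz] := atlas_cover (p z).
have [F FP] := chartP c ac.
have dkz : dom c (p (k z)) by rewrite pk.
have [_ dA nA] := FP z dz; have [_ dB nB] := FP (k z) dkz.
rewrite pk in nB.
have D0 := density_gt0 m ac dz.
move: (density m c (p z)) D0 nA nB (complex_derivative_approx dA) (complex_derivative_approx dB).
move: ('D_1 F (hval z)) ('D_1 F (hval (k z))) => A B D D0 nA nB hA hB.
have gz := disc_gt0 z; have gkz := disc_gt0 (k z).
have {}nA : modulus A = 2 / (1 - modulus (hval z) ^+ 2) / D.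
  by rewrite -nA mulrAC divff ?mul1r// gt_eqF.
have {}nB : modulus B = 2 / (1 - modulus (hval (k z)) ^+ 2) / D.
  by rewrite -nB mulrAC divff ?mul1r// gt_eqF.
have B0 : 0 < modulus B by rewrite nB !divr_gt0.
have A0 := modulus_ge0 A.
exists (A / B); last first.
  have quot (x y u : R) : 0 < x -> 0 < y -> 0 < u -> 2 / x / u / (2 / y / u) = y / x.
    by move=> x0 y0 u0; field; rewrite !gt_eqF.
  by rewrite modulusM modulusV nA nB quot.
move=> e e0.
(* [K] is a Lipschitz constant of [k] at [z]: with [e1] at most half the modulus of [B], the error
   in [v] is absorbed on the left. Only continuity of [k] is known beforehand. *)
pose K := 1 + 2 * modulus A / modulus B.
have K0 : 0 < K + 1 by rewrite !ltr_wpDr// divr_ge0 ?(ltW B0)// mulr_ge0.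
pose e1 := Num.min (modulus B / 2) (e * modulus B / (K + 1)).
have e10 : 0 < e1 by rewrite lt_min !divr_gt0// mulr_gt0.
have [dd dd0 {}hA] := hA e1 e10.
have [d' d'0 {}hB] := hB e1 e10.
have [d2 d20 hk] : exists2 d2, 0 < d2 & forall w, modulus (hval w - hval z) < d2 ->
    modulus (hval (k w) - hval (k z)) < d'.
  by apply: (continuous_hplaneP k z).1 => //; exact: pi1_continuous gk z.
have /cp/nbhs_hplaneP[d3 d30 hd] := open_nbhs_nbhs (conj (@dom_open _ _ c) dz).
exists (Num.min dd (Num.min d2 d3)); first by rewrite !lt_min dd0 d20.
move=> w; rewrite !lt_min => /and3P[w1 w2 w3].
have [cw _ _] := FP w (hd _ w3).
have dkw : dom c (p (k w)) by rewrite pk; exact: hd.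
have [ckw _ _] := FP (k w) dkw.
have [cz _ _] := FP z dz; have [ckz _ _] := FP (k z) dkz.
rewrite pk in ckw; rewrite pk in ckz.
have := hA _ w1; have := hB _ (hk _ w2).
rewrite -ckw -ckz -cw -cz.
set u := hval w - hval z; set v := hval (k w) - hval (k z); set f := Defs.coord c _ - _.
move=> hv hu.
have ABle : modulus (B * v - A * u) <= e1 * modulus v + e1 * modulus u.
  have -> : B * v - A * u = (f - A * u) - (f - B * v) by ring.
  by apply: le_trans (modulusD _ _) _; rewrite modulusN addrC lerD.
have e1B : e1 <= modulus B / 2 by rewrite ge_min lexx.
have u0 := modulus_ge0 u; have v0 := modulus_ge0 v.
have vK : modulus v <= K * modulus u.
  have : modulus B * modulus v <= e1 * modulus v + e1 * modulus u + modulus A * modulus u.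
    rewrite -!modulusM -{1}(subrK (A * u) (B * v)).
    by apply: le_trans (modulusD _ _) _; rewrite lerD2r.
  move=> h; have h2 : modulus B * modulus v <= modulus B * (K * modulus u).
    rewrite /K mulrDl mulrDr mul1r.
    have -> : modulus B * (2 * modulus A / modulus B * modulus u) = 2 * modulus A * modulus u.
      by field; rewrite gt_eqF.
    nra.
  by rewrite ler_pM2l in h2.
rewrite -(ler_pM2l B0) -modulusM.
have -> : B * (v - A / B * u) = B * v - A * u.
  by field; rewrite -modulus_gt0.
apply: le_trans ABle _; rewrite -mulrDr.
apply: le_trans (_ : e1 * ((K + 1) * modulus u) <= _).
  by rewrite ler_pM2l// mulrDl mul1r lerD2r.
have : e1 * (K + 1) <= e * modulus B by rewrite -ler_pdivlMr// /e1 ge_min lexx orbT.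
nra.
Qed.

End DeckIsometry.

(** * A Schwarz-Pick argument for infinitesimal isometries *)

Section InfinitesimalIsometry.
Context {R : realType}.
Implicit Types (z w : hplane R).

Lemma Re_approx (a x y d v : R[i]) (t : R) :
  Re (a * x) - Re (a * y) - Re (a * d * v) * t = Re (a * (x - y - d * (t%:C * v))).
Proof. by rewrite !ReImE; ring. Qed.

Lemma Re_conj_scale (c : R) (x : R[i]) : Re ((c%:C * x)^* * x) = c * modulus x ^+ 2.
Proof. by rewrite modulus_sqr !ReImE; ring. Qed.

Lemma Re_mulJ_approx (x v d u : R[i]) (t : R) :
  Re (x * (v - d * (t%:C * u))^*) = Re (x * v^*) - t * Re (x * (d * u)^*).
Proof. by rewrite !ReImE; ring. Qed.

Lemma Re_mulJ_scale (x u : R[i]) (t : R) : Re (x * (t%:C * u)^*) = t * Re (x * u^*).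
Proof. by rewrite !ReImE; ring. Qed.

Lemma Re_mulJ_i (x d : R[i]) : Re (x * (d * 'i)^*) = Im (x * d^*).
Proof. by case: x => a b; case: d => c e /=; ring. Qed.

(* On the radius [t |-> t zeta] through [z], the component [f] of [k] along
   [k z] satisfies [f' <= (1 - f^2) / (1 - t^2)], hence [(f - t) / (1 - t f)]
   does not increase. *)
Lemma infinitesimal_isometry_contract (k : hplane R -> hplane R) z :
  infinitesimal_isometry k -> k horigin = horigin ->
  modulus (hval (k z)) <= modulus (hval z).
Proof.
move=> hk k0; pose r := modulus (hval z).
have [z0|z0] := eqVneq (hval z) 0.
  have -> : z = horigin by apply: hval_inj.
  by rewrite k0.
have [kz0|kz0] := eqVneq (modulus (hval (k z))) 0; first by rewrite kz0 modulus_ge0.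
have r0 : 0 < r by rewrite modulus_gt0.
have r1 : r < 1 := hval_lt1 z.
pose zeta := r^-1%:C * hval z; pose om := (modulus (hval (k z)))^-1%:C * hval (k z).
have zeta1 : modulus zeta = 1.
  by rewrite /zeta modulusM modulus_real gtr0_norm ?invr_gt0// mulVf// gt_eqF.
have om1 : modulus om = 1.
  by rewrite /om modulusM modulus_real ger0_norm ?invr_ge0 ?modulus_ge0// mulVf.
have zE : hval z = r%:C * zeta by rewrite /zeta mulrA -rmorphM divff ?gt_eqF// rmorph1 mul1r.
have tz1 (t : R) : `|t| < 1 -> modulus (t%:C * zeta) < 1.
  by rewrite modulusM modulus_real zeta1 mulr1.
pose g (t : R) : hplane R := insubd horigin (t%:C * zeta).
have gE t : `|t| < 1 -> hval (g t) = t%:C * zeta.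
  by move=> t1; rewrite /hval set_valE insubdK//; apply/mem_set/tz1.
pose f t := Re (om^* * hval (k (g t))).
have fle t : `|f t| <= modulus (hval (k (g t))).
  by apply: le_trans (Re_le_modulus _) _; rewrite modulusM modulusJ om1 mul1r.
have f1 t : `|f t| < 1 by apply: le_lt_trans (fle t) (hval_lt1 _).
have fD t : `|t| < 1 -> exists2 D, is_derive t (1 : R) f D & D * (1 - t ^+ 2) <= 1 - f t ^+ 2.
  move=> t1; have [d hd dE] := hk (g t).
  exists (Re (om^* * d * zeta)).
    apply: is_derive_approx => e e0; have [s s0 hs] := hd e e0.
    exists (Num.min s (1 - `|t|)); first by rewrite lt_min s0 subr_gt0.
    move=> u; rewrite lt_min => /andP[us ut].
    have u1 : `|u| < 1 by have := ler_normD (u - t) t; rewrite subrK; lra.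
    have gut : hval (g u) - hval (g t) = (u - t)%:C * zeta.
      by rewrite !gE// rmorphB mulrBl.
    have ngut : modulus (hval (g u) - hval (g t)) = `|u - t|.
      by rewrite gut modulusM modulus_real zeta1 mulr1.
    have := hs (g u); rewrite ngut => /(_ us); rewrite gut => h.
    have -> : f u - f t - Re (om^* * d * zeta) * (u - t) =
      Re (om^* * (hval (k (g u)) - hval (k (g t)) - d * ((u - t)%:C * zeta))).
      exact: Re_approx.
    by apply: le_trans (Re_le_modulus _) _; rewrite modulusM modulusJ om1 mul1r.
  have tg : modulus (hval (g t)) ^+ 2 = t ^+ 2.
    by rewrite gE// modulusM modulus_real zeta1 mulr1 real_normK// num_real.
  have t2 : 0 < 1 - t ^+ 2 by rewrite -tg disc_gt0.
  rewrite -ler_pdivlMr//.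
  have := Re_le_modulus (om^* * d * zeta); rewrite (modulusM _ zeta) (modulusM _ d) zeta1 modulusJ om1 mulr1 mul1r.
  rewrite dE tg ler_norml => /andP[_ h]; apply: le_trans h _.
  rewrite ler_pM2r ?invr_gt0// lerB//.
  rewrite -(real_normK (num_real (f t))) ler_pXn2r// ?nnegrE ?modulus_ge0//.
pose q t := (f t - t) * (1 - t * f t)^-1.
have qden t : `|t| < 1 -> 0 < 1 - t * f t.
  move=> t1; rewrite subr_gt0; apply: le_lt_trans (ler_norm _) _.
  rewrite normrM; have := f1 t; have := normr_ge0 (f t); have := normr_ge0 t; nra.
have qD t : `|t| < 1 -> exists2 D, is_derive t (1 : R) q D & D <= 0.
  move=> t1; have [D hD Dle] := fD t t1; have den0 := qden t t1.
  have h1 : is_derive t (1 : R) (fun s => 1 - s * f s) (- (t * D + f t)).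
    apply: is_derive_eq.
    by rewrite /GRing.scale/=; ring.
  have h2 := @is_deriveV R _ t _ 1 (lt0r_neq0 den0) h1.
  have h3 : is_derive t (1 : R) (fun s => f s - s) (D - 1) by apply: is_derive_eq.
  have h4 := is_deriveM h3 h2.
  exists ((D - 1) / (1 - t * f t) + (f t - t) * (t * D + f t) / (1 - t * f t) ^+ 2).
    apply: (is_derive_eq h4); rewrite /GRing.scale/=.
    by field; rewrite gt_eqF.
  have -> : (D - 1) / (1 - t * f t) + (f t - t) * (t * D + f t) / (1 - t * f t) ^+ 2 =
    (D * (1 - t ^+ 2) - (1 - f t ^+ 2)) / (1 - t * f t) ^+ 2.
    by field; rewrite gt_eqF.
  by rewrite pmulr_lle0 ?invr_gt0 ?exprn_gt0// subr_le0.
have in01 t : t \in `[0, r] -> `|t| < 1.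
  by rewrite in_itv/= => /andP[t0 tr]; rewrite ger0_norm//; lra.
have [||c cin qE] := @MVT_segment R q (fun t => 'D_1 q t) 0 r (ltW r0).
- move=> t tin; have [|D [dq _] _] := qD t; last exact: derivableP.
  by apply: in01; move: tin; rewrite !in_itv/= => /andP[/ltW -> /ltW ->].
- apply: derivable_within_continuous => t /in01/qD[D [dq _] _]; exact: dq.
have [D [_ cD] D0] := qD c (in01 _ cin).
have q0 : q 0 = 0.
  rewrite /q /f (_ : g 0 = horigin) ?k0 ?horiginE ?mulr0 ?subr0 ?mul0r//.
  by apply: hval_inj; rewrite gE ?normr0// mul0r.
have gr : g r = z by apply: hval_inj; rewrite gE ?gtr0_norm.
have fr : f r = modulus (hval (k z)).
  by rewrite /f gr /om Re_conj_scale expr2 mulrA mulVf// mul1r.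
(* By the mean value theorem [q r] is at most [q 0 = 0], which says that [f r] is at most [r]. *)
have qr : q r <= 0.
  by have := qE; rewrite q0 !subr0 cD => ->; rewrite mulr_le0_ge0// ltW.
have dr : 0 < 1 - r * f r by apply: qden; rewrite gtr0_norm.
move: qr; rewrite /q pmulr_lle0 ?invr_gt0// subr_le0 fr; exact.
Qed.

(* The square of [sinh (hdist z w / 2)]. *)
Definition hquot z w : R := modulus (hval z - hval w) ^+ 2 /
  ((1 - modulus (hval z) ^+ 2) * (1 - modulus (hval w) ^+ 2)).

Lemma hquot_mob a b T z w : moebius a b T -> hquot (T z) (T w) = hquot z w.
Proof.
move=> [h TE]; have z1 := ltW (hval_lt1 z); have w1 := ltW (hval_lt1 w).
have dz := mden_gt0 h z1; have dw := mden_gt0 h w1.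
have gz := disc_gt0 z; have gw := disc_gt0 w.
rewrite /hquot !TE !mob_modulus// mob_sub// !modulusM modulusV modulusM.
by field; rewrite !gt_eqF.
Qed.

Lemma hquot0 z : hquot horigin z = (1 - modulus (hval z) ^+ 2)^-1 - 1.
Proof.
rewrite /hquot horiginE sub0r modulusN modulus0 expr0n subr0 mul1r.
by field; rewrite gt_eqF// disc_gt0.
Qed.

(** The Schwarz-Pick inequality: Moebius maps bring [z] and [k z] to the origin, where the
    contraction along radii applies. *)
Lemma infinitesimal_isometry_hquot k z w : infinitesimal_isometry k ->
  hquot (k z) (k w) <= hquot z w.
Proof.
move=> hk; have [a [b [h ab]]] := mob_to (hval_lt1 z).
have [c [d [h' cd]]] := mob_to (hval_lt1 (k z)).
have T0 : hmob h horigin = z by apply: hval_inj; rewrite hpointK horiginE.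
have S0 : hmob h' horigin = k z by apply: hval_inj; rewrite hpointK horiginE.
pose L := hmob (su11_inv h') \o (k \o hmob h).
have L0 : L horigin = horigin by rewrite /L /= T0 -S0 hmobK.
have LI : infinitesimal_isometry L.
  apply: infinitesimal_isometry_comp; last exact: infinitesimal_isometry_mob (hmob_moebius _).
  by apply: infinitesimal_isometry_comp => //; exact: infinitesimal_isometry_mob (hmob_moebius _).
pose x := hmob (su11_inv h) w.
have wE : w = hmob h x by rewrite /x hmobVK.
have kw : k w = hmob h' (L x) by rewrite /L /= hmobVK -wE.
rewrite kw -{1}S0 (hquot_mob _ _ (hmob_moebius h')).
rewrite wE -{1}T0 (hquot_mob _ _ (hmob_moebius h)) !hquot0.
rewrite lerB// lef_pV2 ?posrE ?disc_gt0// lerB// ler_pXn2r// ?nnegrE ?modulus_ge0//.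
exact: infinitesimal_isometry_contract.
Qed.

(* Normalized by [K 0 = 0], the map [K] preserves [Re (z w^* )]; letting [w]
   tend to [0] gives [K z = K'(0) z]. *)
Lemma infinitesimal_isometry_moebius (k k' : hplane R -> hplane R) : infinitesimal_isometry k ->
  infinitesimal_isometry k' -> cancel k k' -> exists a b, moebius a b k.
Proof.
move=> hk hk' kk'.
have kq z w : hquot (k z) (k w) = hquot z w.
  apply/eqP; rewrite eq_le infinitesimal_isometry_hquot//=.
  by rewrite -{1}(kk' z) -{1}(kk' w) infinitesimal_isometry_hquot.
have [a [b [h ab]]] := mob_to (hval_lt1 (k horigin)).
have S0 : hmob h horigin = k horigin by apply: hval_inj; rewrite hpointK horiginE.
pose K := hmob (su11_inv h) \o k.
have K0 : K horigin = horigin by rewrite /K /= -S0 hmobK.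
have Kq z w : hquot (K z) (K w) = hquot z w.
  by rewrite /K /= (hquot_mob _ _ (hmob_moebius _)).
have KI : infinitesimal_isometry K.
  by apply: infinitesimal_isometry_comp => //; exact: infinitesimal_isometry_mob (hmob_moebius _).
have Kn z : modulus (hval (K z)) ^+ 2 = modulus (hval z) ^+ 2.
  have := Kq horigin z; rewrite K0 !hquot0 => /addIr/invr_inj/addrI/oppr_inj; exact.
have Kd z w : Re (hval (K z) * (hval (K w))^*) = Re (hval z * (hval w)^*).
  have := Kq z w; rewrite /hquot !Kn => /mulIf.
  rewrite invr_eq0 mulf_neq0 ?gt_eqF ?disc_gt0// => /(_ isT).
  rewrite !modulusB_sqr !Kn; lra.
have [d hd dE] := KI horigin.
have {}dE : modulus d = 1.
  by rewrite dE K0 horiginE modulus0 expr0n subr0 divr1.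
have Kdu z (u : R[i]) : modulus u = 1 -> Re (hval (K z) * (d * u)^*) = Re (hval z * u^*).
  move=> u1; apply/eqP; rewrite -subr_eq0 -normr_eq0.
  apply: contrapT => /negP ne0.
  have {ne0} e0 : 0 < `|Re (hval (K z) * (d * u)^*) - Re (hval z * u^*)| / 2.
    by rewrite divr_gt0// lt_def ne0 normr_ge0.
  set e := _ / 2 in e0.
  have [r r0 hr] := hd e e0.
  (* The invariance of [Re] is tested at the point [t u], inside the disc and within the range of
     the first-order estimate; division by [t] then gives the identity up to [e]. *)
  pose t := Num.min (r / 2) (1 / 2).
  have t0 : 0 < t by rewrite lt_min !divr_gt0.
  have tr : t < r by rewrite gt_min; apply/orP; left; lra.
  have t1 : t < 1 by rewrite gt_min; apply/orP; right; lra.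
  have nt : modulus (t%:C * u) = t by rewrite modulusM modulus_real u1 mulr1 gtr0_norm.
  have tu1 : modulus (t%:C * u) < 1 by rewrite nt.
  have := hr (hpoint tu1); rewrite K0 horiginE hpointK !subr0 nt => /(_ tr) h1.
  have h2 := Kd z (hpoint tu1); rewrite hpointK in h2.
  set v := hval (K (hpoint tu1)) in h1 h2.
  have : `|Re (hval (K z) * (v - d * (t%:C * u))^*)| <= e * t.
    apply: le_trans (Re_le_modulus _) _; rewrite modulusM modulusJ.
    by rewrite -[X in _ <= X]mul1r ler_pM ?modulus_ge0// ltW// hval_lt1.
  have -> : Re (hval (K z) * (v - d * (t%:C * u))^*) =
     - t * (Re (hval (K z) * (d * u)^*) - Re (hval z * u^*)).
    by rewrite Re_mulJ_approx h2 Re_mulJ_scale mulNr mulrBr opprB.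
  rewrite normrM normrN (gtr0_norm t0) mulrC (ler_pM2r t0); move: e0; rewrite /e; lra.
have KE z : hval (K z) = d * hval z.
  have h1 := Kdu z 1 modulus1; have h2 := Kdu z 'i modulus_i.
  have : hval (K z) * d^* = hval z.
    apply: complex_ext; first by move: h1; rewrite mulr1 rmorph1 mulr1.
    by move: h2; rewrite Re_mulJ_i -{1}['i]mul1r Re_mulJ_i rmorph1 mulr1.
  by move=> <-; rewrite mulrCA unit_mulJ// mulr1.
(* The rotation by [d] is given by the diagonal matrix with entries [c] and [c^*], since
   [c / c^* = c ^+ 2] on the circle. *)
pose c := sqrtc d.
have c2 : c ^+ 2 = d by exact: sqr_sqrtc.
have c1 : modulus c = 1.
  by apply/eqP; rewrite -sqrp_eq1 ?modulus_ge0// expr2 -modulusM -expr2 c2 dE.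
have hc : su11 c 0 by rewrite /su11 c1 modulus0 expr0n expr1n subr0.
have hK : moebius c 0 K.
  split => // z; rewrite KE /mob /mden rmorph0 mul0r add0r addr0 -c2.
  rewrite -[c^*](mulKf (x := c)); last by rewrite -modulus_gt0 c1.
  by rewrite unit_mulJ// mulr1 invrK expr2 mulrAC.
have -> : k = hmob h \o K by apply/funext => z; rewrite /K /= hmobVK.
eexists; eexists; exact: moebius_comp (hmob_moebius h) hK.
Qed.

End InfinitesimalIsometry.

Lemma pi1_moebius {R : realType} {X : riemannSurface R} {m : conformalMetric X}
    (p : hplane R -> X) k : hyperbolic_universal_covering m p -> pi1 p k ->
  exists a b, moebius a b k.
Proof.
move=> hyp gk; have [k' [gk' kk' _]] := pi1_inv gk.
by apply: (infinitesimal_isometry_moebius _ _ kk'); exact: pi1_infinitesimal_isometry hyp _ _.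
Qed.

(** * Orbits of groups of the first kind *)

Section HyperbolicDistance.
Context {R : realType}.
Implicit Types (z w u : hplane R).

Lemma modulus_1subJ_sqr (x y : R[i]) : modulus (1 - x^* * y) ^+ 2 =
  1 + modulus x ^+ 2 * modulus y ^+ 2 - 2 * Re (x * y^*).
Proof. by case: x => a b; case: y => c d; rewrite !modulus_sqr /=; ring. Qed.

Lemma disc_sub_lt (x y : R[i]) : modulus x < 1 -> modulus y < 1 ->
  modulus (x - y) < modulus (1 - x^* * y).
Proof.
move=> x1 y1; rewrite -(ltr_pXn2r (n := 2)) ?nnegrE ?modulus_ge0//.
rewrite modulusB_sqr modulus_1subJ_sqr ltrD2r.
have h (a : R) : 0 <= a -> a < 1 -> 0 < 1 - a ^+ 2 by move=> a0 a1; nra.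
have := mulr_gt0 (h _ (modulus_ge0 x) x1) (h _ (modulus_ge0 y) y1); lra.
Qed.

Lemma disc_1subJ_gt0 (x y : R[i]) : modulus x < 1 -> modulus y < 1 ->
  0 < modulus (1 - x^* * y).
Proof. by move=> x1 y1; apply: le_lt_trans (modulus_ge0 _) (disc_sub_lt x1 y1). Qed.

Lemma hdist_moebius a b T z w : moebius a b T -> hdist (T z) (T w) = hdist z w.
Proof.
move=> [h TE]; have z1 := ltW (hval_lt1 z); have w1 := ltW (hval_lt1 w).
have dz := mden_gt0 h z1; have dw := mden_gt0 h w1.
rewrite /hdist !TE mob_sub// mob_subJ// !modulusM !modulusV !modulusM modulusJ.
have quot (n d e : R) : 0 < d -> 0 < e -> n / e / (d / e) = n / d.
  by move=> d0 e0; field; rewrite !gt_eqF.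
by rewrite quot// ?mulr_gt0// disc_1subJ_gt0// hval_lt1.
Qed.

(** The equality case of the triangle inequality. Removing [ln] turns additivity into the addition
    law [t = (r + rho) / (1 + r rho)] of the hyperbolic tangent; combined with [t = N / D] it leaves
    [X + r rho = 0] up to positive factors. *)
Lemma hdist_through_origin z w : hdist z horigin + hdist horigin w = hdist z w ->
  Re (hval z * (hval w)^*) = - (modulus (hval z) * modulus (hval w)).
Proof.
have := disc_sub_lt (hval_lt1 z) (hval_lt1 w).
have := hval_lt1 z; have := hval_lt1 w.
rewrite /hdist horiginE rmorph0 mulr0 mul0r subr0 sub0r modulusN subr0 modulus1 !divr1.
have := modulusB_sqr (hval z) (hval w); have := modulus_1subJ_sqr (hval z) (hval w).
have := modulus_ge0 (hval z); have := modulus_ge0 (hval w).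
have D0 := disc_1subJ_gt0 (hval_lt1 z) (hval_lt1 w).
have N0 := modulus_ge0 (hval z - hval w).
move: D0 N0; move: (hval z) (hval w) => x y.
move: (modulus x) (modulus y) (Re (x * y^*)) (modulus (x - y)) (modulus (1 - x^* * y)).
move=> r rho X N D D0 N0 rho0 r0 DE NE rho1 r1 ND.
set t := N / D.
have t0 : 0 <= t by rewrite divr_ge0// (ltW D0).
have t1 : t < 1 by rewrite /t ltr_pdivrMr// mul1r.
have pos (v : R) : 0 <= v -> v < 1 -> 0 < (1 + v) / (1 - v).
  by move=> v0 v1; rewrite divr_gt0 ?subr_gt0// ltr_wpDr.
have pr := pos r r0 r1; have prho := pos rho rho0 rho1; have pt := pos t t0 t1.
rewrite -lnM ?posrE// => /ln_inj; rewrite !posrE mulr_gt0// pt => /(_ isT isT) E.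
have tE : t * (1 + r * rho) = r + rho.
  have h1 : (1 + r) / (1 - r) * ((1 + rho) / (1 - rho)) * (1 - t) * (1 - r) * (1 - rho) =
    (1 + t) / (1 - t) * (1 - t) * (1 - r) * (1 - rho) by rewrite E.
  rewrite divfK in h1; last by rewrite gt_eqF// subr_gt0.
  have : (1 + r) * (1 + rho) * (1 - t) = (1 + t) * (1 - r) * (1 - rho).
    by rewrite -h1; field; rewrite !gt_eqF// subr_gt0.
  lra.
have NE2 : N ^+ 2 = t ^+ 2 * D ^+ 2.
  by rewrite -exprMn /t divfK// gt_eqF.
have key : (r ^+ 2 + rho ^+ 2 - 2 * X) * (1 + r * rho) ^+ 2 =
   (r + rho) ^+ 2 * (1 + r ^+ 2 * rho ^+ 2 - 2 * X).
  by rewrite -NE -DE NE2 -tE; ring.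
have k2 : (1 - r ^+ 2) * (1 - rho ^+ 2) * (X + r * rho) = 0.
  have -> : (1 - r ^+ 2) * (1 - rho ^+ 2) * (X + r * rho) =
     ((r + rho) ^+ 2 * (1 + r ^+ 2 * rho ^+ 2 - 2 * X)
     - (r ^+ 2 + rho ^+ 2 - 2 * X) * (1 + r * rho) ^+ 2) / 2 by field.
  by rewrite key subrr mul0r.
have f1 : 0 < 1 - r ^+ 2 by nra.
have f2 : 0 < 1 - rho ^+ 2 by nra.
move/eqP: k2; rewrite mulf_eq0 gt_eqF ?mulr_gt0//= => /eqP; lra.
Qed.

Lemma Re_mul_real (x : R[i]) (t : R) : Re (x * t%:C) = Re x * t.
Proof. by rewrite cReM cRe_real cIm_real mulr0 subr0. Qed.

(* A closed half plane bounded by a geodesic (when [|a| < |c|]): the trace of a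
   linear half space in the hyperboloid model. *)
Definition half_plane (a : R) (c : R[i]) : set (hplane R) :=
  [set z | 2 * Re (c^* * hval z) <= a * (1 + modulus (hval z) ^+ 2)].

(** A half plane is where a Hermitian form in the vector of entries [z] and 1 is nonnegative. The
    witnesses are the coefficients of its pullback by the matrix of [T], after clearing the squared
    modulus of the denominator. *)
Lemma half_plane_moebius a c al be T : moebius al be T ->
  exists a' c', forall z, half_plane a' c' z <-> half_plane a c (T z).
Proof.
move=> [h TE].
exists (a * (modulus al ^+ 2 + modulus be ^+ 2) - 2 * Re (c^* * al * be)).
exists (c^* * al ^+ 2 + c * be^* ^+ 2 - 2 * a%:C * (al * be^*))^*.
move=> z; rewrite /half_plane /= conjcK TE.
have d0 := mden_gt0 h (ltW (hval_lt1 z)).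
move: (hval z) d0 => x d0.
rewrite -[X in _ <-> is_true X](ler_pM2r (exprn_gt0 2 d0)).
have e1 : (1 + modulus (mob al be x) ^+ 2) * modulus (mden al be x) ^+ 2 =
    (modulus al ^+ 2 + modulus be ^+ 2) * (1 + modulus x ^+ 2) + 4 * Re (al * be^* * x).
  rewrite mulrDl mul1r /mob modulusM modulusV -exprMn divfK ?gt_eqF//.
  rewrite /mden !modulusD_sqr !modulusM !modulusJ !exprMn.
  rewrite -!mulrA conjcK.
  have -> : Re (be^* * (x * al)) = Re (al * (be^* * x)) by congr Re; ring.
  have -> : Re (al * (x * be^*)) = Re (al * (be^* * x)) by congr Re; ring.
  ring.
have e2 : 2 * Re (c^* * mob al be x) * modulus (mden al be x) ^+ 2 =
   2 * Re (c^* * al * be) * (1 + modulus x ^+ 2) +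
   2 * Re ((c^* * al ^+ 2 + c * be^* ^+ 2) * x).
  have -> : 2 * Re (c^* * mob al be x) * modulus (mden al be x) ^+ 2 =
     2 * Re (c^* * mob al be x * (modulus (mden al be x) ^+ 2)%:C).
    by rewrite Re_mul_real -mulrA.
  have -> : c^* * mob al be x * (modulus (mden al be x) ^+ 2)%:C =
      c^* * ((al * x + be) * (mden al be x)^*).
    by rewrite -mulJ -[c^* * _ * _]mulrA [mob al be x * _]mulrA /mob divfK// -modulus_gt0.
  have -> : c^* * ((al * x + be) * (mden al be x)^*) =
    c^* * al * be * (1 + modulus x ^+ 2)%:C + c^* * al ^+ 2 * x + c^* * be ^+ 2 * x^*.
    have -> : (1 + modulus x ^+ 2)%:C = 1 + x * x^* by rewrite mulJ rmorphD rmorph1.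
    by rewrite /mden rmorphD rmorphM /= !conjcK; ring.
  rewrite !cReD Re_mul_real [(_ + c * _) * x]mulrDl cReD.
  have -> : Re (c^* * be ^+ 2 * x^*) = Re (c * be^* ^+ 2 * x).
    rewrite -cReJ !rmorphM /= !conjcK; congr Re; rewrite expr2 rmorphM; ring.
  ring.
rewrite e2 -[a * (1 + modulus (mob _ _ _) ^+ 2) * _]mulrA e1.
have -> : Re ((c^* * al ^+ 2 + c * be^* ^+ 2 - 2 * a%:C * (al * be^*)) * x) =
  Re ((c^* * al ^+ 2 + c * be^* ^+ 2) * x) - 2 * a * Re (al * be^* * x).
  rewrite mulrBl cReD cReN; congr (_ - _).
  have -> : 2 * a%:C * (al * be^*) * x = (2 * a)%:C * (al * be^* * x).
    by rewrite rmorphM rmorph_nat; ring.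
  by rewrite mulrC Re_mul_real mulrC.
move: (Re (c^* * al * be)) (Re (_ * x)) (Re (al * be^* * x)) => u v w.
by split; lra.
Qed.

(** Move the middle point [u] to the origin, so that [z] and [w] lie on opposite rays. If the origin
    were outside the half plane, [a'] would be negative and the linear form [Re (c'^* x)] would be
    negative on both rays. *)
Lemma half_plane_convex a c : geodesically_convex (half_plane a c).
Proof.
move=> z w u Az Aw uzw.
have [al [be [h ab]]] := mob_to (hval_lt1 u).
have T0 : hmob h horigin = u by apply: hval_inj; rewrite hpointK horiginE.
have [a' [c' ac']] := half_plane_moebius a c (hmob_moebius h).
pose z' := hmob (su11_inv h) z; pose w' := hmob (su11_inv h) w.
have zE : z = hmob h z' by rewrite hmobVK.
have wE : w = hmob h w' by rewrite hmobVK.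
move: Az Aw uzw; rewrite -T0 zE wE !(hdist_moebius _ _ (hmob_moebius h)).
move=> /ac' Az /ac' Aw /hdist_through_origin zw; apply/ac'.
move: Az Aw; rewrite /half_plane /mkset horiginE mulr0 modulus0 expr0n addr0 mulr1.
rewrite [X in _ -> _ -> is_true X]leNgt; move: (hval z') (hval w') zw (hval_lt1 z') => x y xy x1 Az Aw.
apply/negP; rewrite /= mulr0 => a0.
have xneg : Re (c'^* * x) < 0 by have := sqr_ge0 (modulus x); nra.
have yneg : Re (c'^* * y) < 0 by have := sqr_ge0 (modulus y); nra.
have x0 : 0 < modulus x.
  rewrite modulus_gt0; apply: contraTneq xneg => ->; by rewrite mulr0 ltxx.
have E : (modulus y)%:C * x = - (modulus x)%:C * y.
  apply/eqP; rewrite mulNr -subr_eq0 opprK -modulus_eq0 -sqrf_eq0 modulusD_sqr.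
  rewrite !modulusM !modulus_real !ger0_norm ?modulus_ge0//.
  have -> : Re ((modulus y)%:C * x * ((modulus x)%:C * y)^*) =
    modulus y * modulus x * Re (x * y^*) by rewrite !ReImE; ring.
  by rewrite xy; apply/eqP; ring.
have := congr1 (fun v => Re (c'^* * v)) E; rewrite /=.
have -> : Re (c'^* * ((modulus y)%:C * x)) = modulus y * Re (c'^* * x) by rewrite !ReImE; ring.
have -> : Re (c'^* * (- (modulus x)%:C * y)) = - (modulus x * Re (c'^* * y)) by rewrite !ReImE; ring.
have := modulus_ge0 y; nra.
Qed.

End HyperbolicDistance.

(** * Behaviour near the circle *)

Section BoundaryBehaviour.
Context {R : realType}.
Implicit Types (z w : hplane R) (xi : R[i]).

Lemma moebius_boundary a b (T : hplane R -> hplane R) xi : moebius a b T -> modulus xi = 1 ->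
  forall e, 0 < e -> exists2 d, 0 < d &
    forall z, modulus (hval z - xi) < d -> modulus (hval (T z) - mob a b xi) < e.
Proof.
move=> [h TE] xi1 e e0.
have d0 : 0 < (modulus a - modulus b) ^+ 2 by rewrite exprn_gt0// subr_gt0 su11_gt.
exists (e * (modulus a - modulus b) ^+ 2); first by rewrite mulr_gt0.
move=> w wz; rewrite TE; apply: le_lt_trans (mob_lipschitz h _ _) _.
- exact: ltW (hval_lt1 _).
- by rewrite xi1.
- by rewrite ltr_pdivrMr.
Qed.

Lemma hquot_ge0 z w : 0 <= hquot z w.
Proof. by rewrite /hquot divr_ge0 ?sqr_ge0// mulr_ge0// ltW// disc_gt0. Qed.

Lemma hquot_near z w xi M : modulus xi = 1 -> hquot z w <= M ->
  modulus (hval z - hval w) ^+ 2 <= 2 * M * modulus (hval z - xi).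
Proof.
move=> xi1 zwM; have M0 := le_trans (hquot_ge0 z w) zwM.
have gz := disc_gt0 z; have gw := disc_gt0 w.
move: zwM; rewrite /hquot ler_pdivrMr ?mulr_gt0// => h; apply: le_trans h _.
have : 1 - modulus (hval z) <= modulus (hval z - xi).
  by rewrite modulusC -xi1; exact: modulus_subl.
have := modulus_ge0 (hval z); have := hval_lt1 z.
have : 1 - modulus (hval w) ^+ 2 <= 1 by rewrite lerBlDr lerDl sqr_ge0.
move: gz gw.
move: (modulus (hval z)) (modulus (hval z - xi)) (1 - modulus (hval w) ^+ 2) => r d s.
move=> gz gw s1 r1 r0 rd; rewrite (mulrC 2) -mulrA ler_wpM2l//.
apply: le_trans (_ : 1 - r ^+ 2 <= _); [by rewrite ler_piMr// ltW|nra].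
Qed.

(** The factors [1 - |z|^2] in [hquot] vanish at the circle, so points at bounded hyperbolic
    distance merge in the Euclidean sense there. *)
Lemma hquot_converge xi M : modulus xi = 1 -> forall e, 0 < e -> exists2 d, 0 < d &
  forall z w, hquot z w <= M -> modulus (hval z - xi) < d -> modulus (hval w - xi) < e.
Proof.
move=> xi1 e e0; pose M' := Num.max 1 M.
have M0 : 0 < M' by rewrite lt_max ltr01.
exists (Num.min (e / 2) ((e / 2) ^+ 2 / (2 * M'))).
  by rewrite lt_min !divr_gt0 ?exprn_gt0 ?mulr_gt0 ?divr_gt0.
move=> z w zw; rewrite lt_min => /andP[z1]; rewrite ltr_pdivlMr ?mulr_gt0// => z2.
have := hquot_near xi1 (le_trans zw (_ : M <= M')); rewrite le_max lexx orbT => /(_ isT) h.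
have : modulus (hval z - hval w) < e / 2.
  rewrite -(ltr_pXn2r (n := 2))// ?nnegrE ?modulus_ge0 ?divr_ge0 ?(ltW e0)//.
  by apply: le_lt_trans h _; rewrite [_ * modulus _]mulrC.
have := modulusB3 (hval z) (hval w) xi; rewrite (modulusC (hval w) (hval z)); lra.
Qed.

(** Distance at least [e] from [xi0] means that [Re (la / xi0)] is at most [1 - e^2 / 2]. Half of
    this margin defines the half plane; the other half absorbs the passage from [la] to [z]. *)
Lemma near_half_plane (xi0 la : R[i]) (e : R) : modulus xi0 = 1 -> modulus la = 1 ->
  0 < e <= 1 -> e <= modulus (la - xi0) -> forall z, modulus (hval z - la) < e ^+ 2 / 8 ->
  half_plane (1 - e ^+ 2 / 4) xi0 z.
Proof.
move=> xi1 la1 /andP[e0 e1] far z zla; rewrite /half_plane /=.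
have : e ^+ 2 <= modulus (la - xi0) ^+ 2 by rewrite lerXn2r ?nnegrE ?modulus_ge0 ?(ltW e0).
rewrite modulusB_sqr la1 xi1 => far2.
have -> : Re (xi0^* * hval z) = Re (la * xi0^*) + Re (xi0^* * (hval z - la)).
  by rewrite [la * _]mulrC -cReD -mulrDr addrC subrK.
have b1 : Re (xi0^* * (hval z - la)) <= modulus (hval z - la).
  apply: le_trans (ler_norm _) _; apply: le_trans (Re_le_modulus _) _.
  by rewrite modulusM modulusJ xi1 mul1r.
have b2 : 1 - modulus (hval z) <= modulus (hval z - la).
  by rewrite modulusC -la1; exact: modulus_subl.
have := hval_lt1 z; have := modulus_ge0 (hval z).
have e21 : e ^+ 2 <= 1 by rewrite expr_le1// ltW.
have e20 : 0 < e ^+ 2 by rewrite exprn_gt0.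
move: far2 b1 b2 zla.
move: (e ^+ 2) e21 e20 (Re (la * _)) (Re (xi0^* * _)) (modulus (hval z - la)) (modulus (hval z)).
move=> E E1 E0 x y d r far2 b1 b2 zla r0 r1.
have r2 : 1 + r ^+ 2 >= 2 - 2 * d by nra.
have : (1 - E / 4) * (1 + r ^+ 2) >= (1 - E / 4) * (2 - 2 * d) by rewrite ler_wpM2l//; lra.
nra.
Qed.

End BoundaryBehaviour.

Section FirstKind.
Context {R : realType} {X : riemannSurface R} {m : conformalMetric X}.
Variable p : hplane R -> X.
Hypothesis hyp : hyperbolic_universal_covering m p.
Hypothesis core : convex_core p = [set: X].

Let pcov : covering_map p. Proof. by case: hyp. Qed.

(* Otherwise the limit set, hence its convex hull, would avoid a half plane,
   although the translates of the convex hull cover the disc. *)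
Lemma orbit_near_ideal_point (xi : R[i]) e : modulus xi = 1 -> 0 < e ->
  exists2 k, pi1 p k & modulus (hval (k horigin) - xi) < e.
Proof.
move=> xi1 e0; apply: contrapT => none.
have [e1 [e10 e11 far]] : exists e1, [/\ 0 < e1, e1 <= 1 &
    forall k, pi1 p k -> e1 <= modulus (hval (k horigin) - xi)].
  exists (Num.min e 1); rewrite lt_min e0 ltr01 ge_min lexx orbT; split=> // k gk.
  rewrite leNgt; apply/negP; rewrite lt_min => /andP[ke _]; apply: none; by exists k.
(* Limit points for an arbitrary base point; bounded hyperbolic distance between orbits transfers
   the gap at [xi] from the orbit of [horigin] to all of them. *)
pose L (la : R[i]) := exists z, forall d, 0 < d -> exists2 k, pi1 p k & modulus (hval (k z) - la) < d.
have Lfar la : modulus la = 1 -> L la -> e1 <= modulus (la - xi).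
  move=> la1 [z zla]; apply/ler_addgt0Pr => d d0.
  have [d' d'0 dP] := hquot_converge (hquot z horigin) la1 d0.
  have [k gk kd] := zla _ d'0.
  have [a [b ab]] := pi1_moebius hyp gk.
  have := dP (k z) (k horigin); rewrite (hquot_mob _ _ ab) lexx => /(_ isT kd) h.
  have := far k gk; have := modulusB3 la (hval (k horigin)) xi; lra.
have Linv k a b la : pi1 p k -> moebius a b k -> modulus la = 1 -> L la -> L (mob a b la).
  move=> gk ab la1 [z zla]; exists z => d d0.
  have [d' d'0 dP] := moebius_boundary ab la1 d0.
  have [l gl ld] := zla _ d'0; exists (k \o l); first exact: pi1_comp.
  exact: dP.
have e1s : 0 < 1 - e1 ^+ 2 / 4 < 1 by apply/andP; split; nra.
have all z : half_plane (1 - e1 ^+ 2 / 4) xi z.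
  have [z' hz' pz] : convex_core p (p z) by rewrite core.
  have [k gk kz] := pi1_transitive pcov pz.
  have [a [b ab]] := pi1_moebius hyp gk.
  (* The point [z'] of the hull satisfies [k z' = z]; the convex set tested against the hull is
     therefore the preimage of the half plane by [k]. *)
  rewrite -kz; apply: (hz' [set w | half_plane (1 - e1 ^+ 2 / 4) xi (k w)]).
    move=> u v w /= ku kv uvw; apply: (@half_plane_convex R _ _ (k u) (k v)) => //.
    by rewrite !(hdist_moebius _ _ ab).
  move=> g la mu Lla Lmu [giso gN gP] _ [t _ <-] /=.
  have conv (nu : ideal R) : limit_set (pi1 p) nu -> exists2 d, 0 < d & forall w,
      modulus (hval w - ival nu) < d -> half_plane (1 - e1 ^+ 2 / 4) xi (k w).
    move=> [w0 cl].
    have Lnu : L (ival nu).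
      exists w0 => d d0.
      have [|_ [[l gl <-] ld]] := cl [set u | modulus (u - ival nu) < d].
        by apply/nbhs_complexP; exists d.
      by exists l.
    have nu1 := ival_eq1 nu.
    have mnu1 : modulus (mob a b (ival nu)) = 1 by case: ab => h _; exact: mob_eq1.
    have far1 := Lfar _ mnu1 (Linv k a b _ gk ab nu1 Lnu).
    have c0 : 0 < e1 ^+ 2 / 8 by rewrite divr_gt0// exprn_gt0.
    have [d d0 dP] := moebius_boundary ab nu1 c0.
    exists d => // w /dP; apply: near_half_plane => //; by rewrite e10.
  have [d1 d10 dP1] := conv la Lla; have [d2 d20 dP2] := conv mu Lmu.
  have [M1 [_ MP1]] : ninfty_nbhs R (fun s => modulus (hval (g s) - ival la) < d1).
    by apply: (gN [set u | modulus (u - ival la) < d1]); apply/nbhs_complexP; exists d1.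
  have [M2 [_ MP2]] : pinfty_nbhs R (fun s => modulus (hval (g s) - ival mu) < d2).
    by apply: (gP [set u | modulus (u - ival mu) < d2]); apply/nbhs_complexP; exists d2.
  (* Parameters on both sides of [t], far enough for the images of [g s] and [g u] to lie in the
     half plane; convexity then catches [g t]. *)
  pose s := Num.min (t - 1) (M1 - 1); pose u := Num.max (t + 1) (M2 + 1).
  have st : s <= t - 1 by rewrite /s ge_min lexx.
  have sM : s < M1 by rewrite /s gt_min; apply/orP; right; lra.
  have tu : t + 1 <= u by rewrite /u le_max lexx.
  have uM : M2 < u by rewrite /u lt_max; apply/orP; right; lra.
  apply: (@half_plane_convex R _ _ (k (g s)) (k (g u))).
  - exact/dP1/MP1.
  - exact/dP2/MP2.
  - rewrite !(hdist_moebius _ _ ab) !giso.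
    by rewrite !ltr0_norm ?subr_lt0; lra.
move: e1s all; set s := 1 - _ => /andP[s0 s1] all.
(* The point [s xi] violates the inequality, which would read [2 s <= s (1 + s^2)] with
   [0 < s < 1]. *)
have sx : modulus (s%:C * xi) < 1 by rewrite modulusM modulus_real xi1 mulr1 gtr0_norm.
have := all (hpoint sx); rewrite /half_plane /mkset hpointK modulusM modulus_real xi1 mulr1 gtr0_norm//.
have -> : Re (xi^* * (s%:C * xi)) = s.
  have -> : xi^* * (s%:C * xi) = s%:C * (xi * xi^*) by ring.
  by rewrite unit_mulJ// mulr1.
nra.
Qed.

End FirstKind.

(** * Attracting fixed points *)

Section HyperbolicElements.
Context {R : realType}.
Implicit Types (a b c d : R[i]).

Lemma mob_fixE a b (x : R[i]) : su11 a b -> modulus x = 1 ->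
  mob a b x = x <-> b^* * x ^+ 2 + (a^* - a) * x - b = 0.
Proof.
move=> h x1; have d0 : mden a b x != 0 by apply: mden_neq0; rewrite ?x1.
have -> : b^* * x ^+ 2 + (a^* - a) * x - b = x * mden a b x - (a * x + b).
  by rewrite /mden; ring.
rewrite /mob; split; first by move=> {1}<-; rewrite divfK// subrr.
by move/eqP; rewrite subr_eq0 => /eqP <-; rewrite mulfK.
Qed.

(** The fixed-point equation is quadratic; with three roots all its coefficients vanish, so [b] is 0
    and [a] is real. *)
Lemma mob_fix3 a b (x y z u : R[i]) : su11 a b -> modulus x = 1 -> modulus y = 1 ->
  modulus z = 1 -> x != y -> x != z -> y != z ->
  mob a b x = x -> mob a b y = y -> mob a b z = z -> mob a b u = u.
Proof.
move=> h x1 y1 z1 xy xz yz /(mob_fixE h x1) ex /(mob_fixE h y1) ey /(mob_fixE h z1) ez.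
have e1 : b^* * (x + y) = a - a^*.
  apply/eqP; rewrite -subr_eq0; have : (x - y) * (b^* * (x + y) - (a - a^*)) = 0.
    by rewrite -[RHS](subrr 0) -{1}ex -ey; ring.
  by move/eqP; rewrite mulf_eq0 => /orP[/eqP/subr0_eq E|//]; rewrite E eqxx in xy.
have e2 : b^* * (x + z) = a - a^*.
  apply/eqP; rewrite -subr_eq0; have : (x - z) * (b^* * (x + z) - (a - a^*)) = 0.
    by rewrite -[RHS](subrr 0) -{1}ex -ez; ring.
  by move/eqP; rewrite mulf_eq0 => /orP[/eqP/subr0_eq E|//]; rewrite E eqxx in xz.
have b0 : b^* = 0.
  have : b^* * (y - z) = 0.
    have -> : b^* * (y - z) = b^* * (x + y) - b^* * (x + z) by ring.
    by rewrite e1 e2 subrr.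
  by move/eqP; rewrite mulf_eq0 => /orP[/eqP //|/eqP/subr0_eq E]; rewrite E eqxx in yz.
have b00 : b = 0 by apply/eqP; rewrite -conjc_eq0 b0.
rewrite b00; apply: mob_real; last exact: su11_neq0 h.
by apply/eqP; rewrite -subr_eq0 -opprB -e1 b0 mul0r oppr0.
Qed.

(* The derivative at [x] is [(mden a b x)^-2]. *)
Definition attracting a b (x : R[i]) :=
  [/\ su11 a b, modulus x = 1, mob a b x = x & 1 < modulus (mden a b x)].

(* The fixed points of [z |-> (a z + b) / (b^* z + a^* )] are the roots
   [(i Im a +- sqrt ((Re a)^2 - 1)) / b^*] of a quadratic equation. *)
Lemma attracting_exists a b : su11 a b -> 1 < `|Re a| ->
  exists2 x, attracting a b x & modulus (x - mob a b 0) <= (modulus a)^-1.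
Proof.
move=> h ra; pose X := Re a; pose Y := Im a.
have X2 : 1 < X ^+ 2 by rewrite -(real_normK (num_real X)) -(expr1n _ 2) ltr_pXn2r// ?nnegrE.
pose r := Num.sqrt (X ^+ 2 - 1); pose s := if 0 <= X then r else - r.
have r0 : 0 <= r by exact: sqrtr_ge0.
have s2 : s ^+ 2 = X ^+ 2 - 1.
  by rewrite /s; case: ifP => _; rewrite ?sqrrN sqr_sqrtr// subr_ge0 ltW.
have sX : 1 < `|s + X|.
  rewrite /s; move: ra; rewrite -/X; case: (leP 0 X) => X0.
    by rewrite !ger0_norm ?addr_ge0//; lra.
  by rewrite ltr0_norm// ltr0_norm; lra.
have bE : modulus b ^+ 2 = X ^+ 2 + Y ^+ 2 - 1.
  by move: h; rewrite /su11 modulus_sqr -/X -/Y; lra.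
have b0 : b != 0.
  rewrite -modulus_gt0 lt_def modulus_ge0 andbT -sqrf_eq0 bE.
  by rewrite gt_eqF//; have := sqr_ge0 Y; lra.
have bJ0 : b^* != 0 by rewrite conjc_eq0.
pose v : R[i] := s +i* Y; pose x := v / b^*.
have bx : b^* * x = v by rewrite /x mulrC divfK.
have x1 : modulus x = 1.
  rewrite /x modulusM modulusV modulusJ.
  have -> : modulus v = modulus b.
    apply/eqP; rewrite -(eqrXn2 (n := 2)) ?modulus_ge0//; apply/eqP.
    by rewrite bE modulus_sqr /= s2; ring.
  by rewrite divff// gt_eqF// modulus_gt0.
have denE : mden a b x = (s + X)%:C.
  by rewrite /mden bx; apply: complex_ext; rewrite ?(cReD, cImD, cReJ, cImJ) /= ?subrr.
have den1 : 1 < modulus (mden a b x) by rewrite denE modulus_real.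
have fixx : mob a b x = x.
  have dx0 : mden a b x != 0 by apply: mden_neq0 => //; rewrite x1.
  rewrite /mob; apply: (mulIf dx0); rewrite divfK//.
  apply: (mulfI bJ0); rewrite mulrDr mulrCA bx [RHS]mulrA bx mulJl bE denE.
  by apply: complex_ext; rewrite !ReImE /= -/X -/Y; move: s2; nra.
exists x; first by split.
rewrite -{1}fixx mob_sub// ?x1 ?modulus0 ?ler01// subr0 modulusM x1 mul1r modulusV modulusM.
have -> : modulus (mden a b 0) = modulus a by rewrite /mden mulr0 add0r modulusJ.
have a0 : 0 < modulus a by rewrite modulus_gt0 (su11_neq0 h).
rewrite lef_pV2 ?posrE// ?mulr_gt0// ?(lt_trans ltr01 den1)//.
by rewrite ler_peMl// ltW.
Qed.

(** Rational parametrization of the circle: [y] is [x (1 + i t) / (1 - i t)], and the sign of [t]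
    decides on which side of [x] it lies. *)
Lemma unit_point_near (x : R[i]) (t : R) : modulus x = 1 ->
  exists y, [/\ modulus y = 1, modulus (y - x) <= 2 * `|t| &
    Im (x^* * y) = 2 * t / (1 + t ^+ 2)].
Proof.
move=> x1; have t1 : 0 < 1 + t ^+ 2 by rewrite ltr_wpDr// sqr_ge0.
pose u : R[i] := ((1 - t ^+ 2) / (1 + t ^+ 2)) +i* (2 * t / (1 + t ^+ 2)).
have u1 : modulus u = 1.
  apply/eqP; rewrite -sqrp_eq1 ?modulus_ge0// modulus_sqr /=; apply/eqP.
  by field; rewrite gt_eqF.
have u2 : modulus (u - 1) <= 2 * `|t|.
  apply: modulus_le_sqr; first by rewrite mulr_ge0.
  have -> : (2 * `|t|) ^+ 2 = 2 ^+ 2 * t ^+ 2 by rewrite exprMn real_normK ?num_real.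
  rewrite modulus_sqr /= subr0.
  have -> : ((1 - t ^+ 2) / (1 + t ^+ 2) - 1) ^+ 2 + (2 * t / (1 + t ^+ 2)) ^+ 2 =
    2 ^+ 2 * t ^+ 2 / (1 + t ^+ 2) by field; rewrite gt_eqF.
  by rewrite ler_pdivrMr//; have := sqr_ge0 t; nra.
exists (x * u); split.
- by rewrite modulusM x1 u1 mulr1.
- by rewrite -{2}(mulr1 x) -mulrBr modulusM x1 mul1r.
- by rewrite mulrA [x^* * x]mulrC unit_mulJ// mul1r.
Qed.

(** The imaginary part of [c - y d^*] can vanish only if [y] is fixed. If it vanished at all points
    of the circle near [x], there would be three fixed points, forcing [d = 0]. *)
Lemma moebius_nonfixed_near c d (x : R[i]) e : su11 c d -> d != 0 -> modulus x = 1 -> 0 < e ->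
  exists y, [/\ modulus y = 1, modulus (y - x) < e & Im (c - y * d^*) != 0].
Proof.
move=> h d0 x1 e0.
have fixI y : modulus y = 1 -> Im (c - y * d^*) = 0 -> mob c d y = y.
  move=> y1 I0; apply/(mob_fixE h y1).
  have : (c - y * d^*)^* = c - y * d^*.
    by apply: complex_ext; rewrite ?cReJ ?cImJ// I0 oppr0.
  rewrite rmorphB rmorphM /= conjcK => E.
  have -> : d^* * y ^+ 2 + (c^* - c) * y - d = y * (c^* - y^* * d - (c - y * d^*)) + (y * y^* - 1) * d by ring.
  by rewrite E subrr mulr0 unit_mulJ// subrr mul0r addr0.
apply: contrapT => none.
have fixn y : modulus y = 1 -> modulus (y - x) < e -> mob c d y = y.
  move=> y1 yx; apply: fixI => //; apply: contrapT => /eqP ne; apply: none.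
  by exists y.
(* [e / 8] keeps the points of parameters [t] and [2 t] within [e] of [x]; [1 / 2] excludes
   [2 t^2 = 1], for which both would have the same imaginary part. *)
pose t := Num.min (e / 8) (1 / 2).
have t0 : 0 < t by rewrite lt_min !divr_gt0.
have te : t <= e / 8 by rewrite /t ge_min lexx.
have t1 : t <= 1 / 2 by rewrite /t ge_min lexx orbT.
have [y [y1 yx yI]] := unit_point_near t x1.
have [z [z1 zx zI]] := unit_point_near (2 * t) x1.
have I0 : Im (x^* * x) = 0 by rewrite mulJl.
have xy : x != y.
  apply/eqP => E; move: yI; rewrite -E I0 => /eqP.
  by rewrite eq_sym gt_eqF// divr_gt0// ?mulr_gt0// ltr_wpDr// sqr_ge0.
have xz : x != z.
  apply/eqP => E; move: zI; rewrite -E I0 => /eqP.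
  by rewrite eq_sym gt_eqF// divr_gt0// ?mulr_gt0// ltr_wpDr// sqr_ge0.
have yz : y != z.
  apply/eqP => E; move: zI; rewrite -E yI => /eqP.
  have p1 : 0 < 1 + t ^+ 2 by rewrite ltr_wpDr// sqr_ge0.
  have p2 : 0 < 1 + (2 * t) ^+ 2 by rewrite ltr_wpDr// sqr_ge0.
  rewrite eqr_div; [|by rewrite gt_eqF|by rewrite gt_eqF]; move/eqP => E2.
  have : t * (1 - 2 * t ^+ 2) = 0 by lra.
  by move/eqP; rewrite mulf_eq0 gt_eqF//= => /eqP; nra.
have f := @mob_fix3 c d x y z 0 h x1 y1 z1 xy xz yz.
have : mob c d 0 = 0.
  apply: f; apply: fixn => //; rewrite ?subrr ?modulus0//.
  - by apply: le_lt_trans yx _; rewrite gtr0_norm//; lra.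
  - by apply: le_lt_trans zx _; rewrite gtr0_norm ?mulr_gt0//; lra.
rewrite mob_0 => /eqP; rewrite mulf_eq0 (negPf d0) invr_eq0 conjc_eq0.
by rewrite (negPf (su11_neq0 h)).
Qed.

End HyperbolicElements.

Section AttractingDense.
Context {R : realType}.
Variable G : set (hplane R -> hplane R).
Hypothesis G_moebius : forall k, G k -> exists a b, moebius a b k.
Hypothesis G_comp : forall k l, G k -> G l -> G (k \o l).
Hypothesis G_near_ideal_point : forall (x : R[i]) e, modulus x = 1 -> 0 < e ->
  exists2 k, G k & modulus (hval (k horigin) - x) < e.

(** When [b] is close to [y a^*], the half trace of the product is close to a term bounded with
    [Re a], minus [Im a] times the imaginary part of [c - y d^*]. A large [Im a] thus makes the
    product hyperbolic. *)
Lemma Re_comp_bound (a b c d y w : R[i]) (dl M : R) :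
  b = (y + w) * a^* -> modulus y = 1 -> modulus w <= dl -> dl <= 1 ->
  `|Re a| <= 1 -> 2 * modulus d * dl <= `|Im (c - y * d^*)| ->
  2 * (M + modulus c + 2 * modulus d) <= `|Im a| * `|Im (c - y * d^*)| ->
  M <= `|Re (a * c + b * d^*)|.
Proof.
move=> bE y1 wd d1 ra1 dD big.
pose Dl := Im (c - y * d^*); rewrite -/Dl in dD big.
have E : Re (a * c + b * d^*) = Re a * Re (c + y * d^*) - Im a * Dl + Re (w * a^* * d^*).
  by rewrite bE /Dl !ReImE; ring.
have b1 : `|Re a * Re (c + y * d^*)| <= modulus c + modulus d.
  rewrite normrM; apply: le_trans (_ : 1 * modulus (c + y * d^*) <= _).
    by rewrite ler_pM// Re_le_modulus.
  by rewrite mul1r (le_trans (modulusD _ _))// modulusM y1 mul1r modulusJ.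
have am : modulus a <= 1 + `|Im a|.
  by apply: le_trans (modulus_le_ReIm _) _; rewrite lerD2r.
have b2 : `|Re (w * a^* * d^*)| <= dl * (1 + `|Im a|) * modulus d.
  apply: le_trans (Re_le_modulus _) _; rewrite !modulusM !modulusJ.
  by rewrite ler_wpM2r ?modulus_ge0// ler_pM ?modulus_ge0.
have b3 : `|Im a| * `|Dl| <= `|Re (a * c + b * d^*)| +
   `|Re a * Re (c + y * d^*)| + `|Re (w * a^* * d^*)|.
  rewrite -normrM; have -> : Im a * Dl = - Re (a * c + b * d^*) + Re a * Re (c + y * d^*)
     + Re (w * a^* * d^*) by rewrite E; ring.
  rewrite (le_trans (ler_normD _ _))// lerD2r (le_trans (ler_normD _ _))// normrN//.
have c0 := modulus_ge0 c; have d0 := modulus_ge0 d; have I0 := normr_ge0 (Im a).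
have dl0 : 0 <= dl := le_trans (modulus_ge0 w) wd.
have b4 : 2 * (dl * `|Im a| * modulus d) <= `|Im a| * `|Dl|.
  have := ler_wpM2l I0 dD; lra.
have b5 : dl * modulus d <= modulus d by rewrite ler_piMl.
lra.
Qed.

(* An element [k] with [k 0] close to a point [y] of the circle is hyperbolic,
   with attracting fixed point close to [y], unless [|Re a| <= 1]; in that case
   [k \o j] is, for any fixed [j] which does not fix [y]. *)
Lemma attracting_dense (x : R[i]) e : modulus x = 1 -> 0 < e -> exists k a b y,
  [/\ G k, moebius a b k, attracting a b y & modulus (y - x) < e].
Proof.
move=> x1 e0.
have half0 : 0 < 1 / 2 :> R by rewrite divr_gt0.
have [j Gj jx] := G_near_ideal_point x1 half0.
have [c [d [hj jE]]] := G_moebius Gj.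
have d0 : d != 0.
  apply/eqP => d0; have := jE horigin; rewrite horiginE mob_0 d0 mul0r => j0.
  by move: jx; rewrite j0 sub0r modulusN x1; lra.
have e2 : 0 < e / 2 by rewrite divr_gt0.
have [y [y1 yx Dl0]] := moebius_nonfixed_near hj d0 x1 e2.
have Dl1 : 0 < `|Im (c - y * d^*)| by rewrite normr_gt0.
set Dl := `|_| in Dl1.
pose M : R := 1 + 8 / e.
have M1 : 1 < M by rewrite ltrDl divr_gt0.
have M0 : 0 < M by lra.
have Me : M^-1 < e / 8.
  by rewrite -(invf_div 8 e) ltf_pV2 ?posrE ?divr_gt0// /M ltrDr.
(* The size of [Im a] that [Re_comp_bound] needs to produce a half trace of modulus at least [M]. *)
pose Y := 2 * (M + modulus c + 2 * modulus d) / Dl.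
have j1 : 0 < 1 - modulus (hval (j horigin)) by rewrite subr_gt0 hval_lt1.
have md0 := modulus_ge0 d.
have mdp : 0 < 2 * (modulus d + 1) by rewrite mulr_gt0// ltr_wpDl.
have Y2 : 0 < 2 * (1 + Y ^+ 2) by rewrite mulr_gt0// ltr_wpDr// sqr_ge0.
(* The first two bounds are hypotheses of [Re_comp_bound]. Those with [Y] and [M] force [a] to be
   large, through the identity between [1 - |k 0|^2] and the inverse square of the modulus of [a].
   The last two make the distances add up to less than [e]. *)
have [dl [dl0 [dl1 dl2 dl3] [dl4 dl5 dl6]]] : exists dl : R, [/\ 0 < dl,
   [/\ dl <= 1, dl <= Dl / (2 * (modulus d + 1)) & dl <= (2 * (1 + Y ^+ 2))^-1] &
   [/\ dl <= (2 * M ^+ 2)^-1, dl <= e * (1 - modulus (hval (j horigin))) / 32 & dl <= e / 16]].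
  exists (Num.min 1 (Num.min (Dl / (2 * (modulus d + 1))) (Num.min ((2 * (1 + Y ^+ 2))^-1)
   (Num.min ((2 * M ^+ 2)^-1) (Num.min (e * (1 - modulus (hval (j horigin))) / 32) (e / 16)))))).
  rewrite !lt_min !ge_min !lexx !orbT; split => //.
  by rewrite ltr01 !invr_gt0 Y2 !divr_gt0 ?mulr_gt0 ?exprn_gt0// ltr_wpDl.
have [k Gk ky] := G_near_ideal_point y1 dl0.
have [a [b [hk kE]]] := G_moebius Gk.
have k0E : hval (k horigin) = mob a b 0 by rewrite kE horiginE.
have a0 : 0 < modulus a ^+ 2 by rewrite exprn_gt0// modulus_gt0 (su11_neq0 hk).
have aV2 : (modulus a ^+ 2)^-1 <= 2 * dl.
  rewrite -(su11_mob0 hk) -k0E.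
  have := hval_lt1 (k horigin); have := modulus_ge0 (hval (k horigin)).
  have : 1 - modulus (hval (k horigin)) <= dl.
    by rewrite -y1; apply: le_trans (modulus_subl _ _) _; rewrite modulusC ltW.
  nra.
have ale (u : R) : 0 < u -> dl <= (2 * u)^-1 -> u <= modulus a ^+ 2.
  move=> u0 udl; rewrite -[X in _ <= X]invrK -[X in X <= _]invrK.
  rewrite lef_pV2 ?posrE ?invr_gt0//; apply: le_trans aV2 _.
  by move: udl; rewrite invfM; lra.
have aM : M <= modulus a.
  rewrite -(ler_pXn2r (n := 2)) ?nnegrE ?modulus_ge0 ?(ltW M0)//.
  by apply: ale; rewrite ?exprn_gt0.
have aV : (modulus a)^-1 < e / 8.
  by apply: le_lt_trans Me; rewrite lef_pV2 ?posrE// (lt_le_trans M0).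
have [ra|ra] := ltP 1 `|Re a|.
  have [z za zk] := attracting_exists hk ra.
  exists k, a, b, z; split => //.
  have := modulusB3 (mob a b 0) z y; have := modulusB3 y z x.
  rewrite -k0E in zk *; lra.
have bE : b = (y + (hval (k horigin) - y)) * a^*.
  by rewrite addrC subrK k0E mob_0 divfK// conjc_eq0 (su11_neq0 hk).
have Ia : Y <= `|Im a|.
  rewrite -(ler_pXn2r (n := 2)) ?nnegrE ?normr_ge0//; last first.
    apply: divr_ge0 (ltW Dl1); have := modulus_ge0 c; lra.
  rewrite real_normK ?num_real//.
  have : 1 + Y ^+ 2 <= modulus a ^+ 2.
    by apply: ale; rewrite // ltr_wpDr// sqr_ge0.
  have : Re a ^+ 2 <= 1 by rewrite -(real_normK (num_real (Re a))) expr_le1.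
  rewrite modulus_sqr; lra.
have rac : M <= `|Re (a * c + b * d^*)|.
  apply: (Re_comp_bound bE y1 (ltW ky) dl1 ra).
  - move: dl2; rewrite ler_pdivlMr// -/Dl; nra.
  - by rewrite -/Dl -ler_pdivrMr.
have hkj := moebius_comp (conj hk kE) (conj hj jE).
have [z za zk] := attracting_exists hkj.1 (lt_le_trans M1 rac).
exists (k \o j); do 2!eexists; exists z; split; [exact: G_comp|exact: hkj|exact: za|].
have b1 : (modulus (a * c + b * d^*))^-1 < e / 8.
  apply: le_lt_trans Me; have := le_trans rac (Re_le_modulus _) => h.
  by rewrite lef_pV2 ?posrE// (lt_le_trans M0).
have b2 : modulus (mob a b (hval (j horigin)) - mob a b 0) <= e / 16.
  apply: le_trans (mob_0_dist hk (hval_lt1 _)) _; rewrite invfM.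
  rewrite ler_pdivrMr//.
  lra.
have kj0 : mob (a * c + b * d^*) (a * d + b * c^*) 0 = mob a b (hval (j horigin)).
  by rewrite jE mob_comp// horiginE modulus0 ler01.
rewrite kj0 in zk; rewrite k0E in ky.
have := modulusB3 (mob a b (hval (j horigin))) z (mob a b 0).
have := modulusB3 (mob a b 0) z y; have := modulusB3 y z x; lra.
Qed.

End AttractingDense.

(** * Stabilizers of ideal points *)

Section Cayley.
Context {R : realType}.
Implicit Types (z w : hplane R) (xi : R[i]).

Lemma cRe_mk (s t : R) : Re (s +i* t) = s. Proof. by []. Qed.
Lemma cIm_mk (s t : R) : Im (s +i* t) = t. Proof. by []. Qed.

(* Isomorphism of the disc onto the right half plane sending [xi] to infinity. *)
Definition cayley xi (z : R[i]) := (xi + z) / (xi - z).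

(** In the half-plane coordinate, the maps [w |-> A w + i t] fixing infinity. *)
Definition affine_at xi (A t : R) (k : hplane R -> hplane R) :=
  forall z, cayley xi (hval (k z)) = A%:C * cayley xi (hval z) + Complex (0 : R) t.

Lemma cayley_den xi (z : R[i]) : modulus xi = 1 -> modulus z < 1 -> xi - z != 0.
Proof. by move=> xi1 z1; rewrite subr_eq0; apply: contraTneq z1 => <-; rewrite xi1 ltxx. Qed.

Lemma cayleyD1 xi (z : R[i]) : modulus xi = 1 -> modulus z < 1 ->
  cayley xi z + 1 = 2 * xi / (xi - z).
Proof. by move=> xi1 z1; rewrite /cayley; field; exact: cayley_den. Qed.

Lemma cayley_inj xi (z w : R[i]) : modulus xi = 1 -> modulus z < 1 -> modulus w < 1 ->
  cayley xi z = cayley xi w -> z = w.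
Proof.
move=> xi1 z1 w1 /(congr1 (fun v => v + 1)); rewrite !cayleyD1// => /mulfI.
have x0 : 2 * xi != 0 by rewrite mulf_neq0 ?pnatr_eq0// -modulus_gt0 xi1.
by move=> /(_ x0)/invr_inj/addrI/oppr_inj.
Qed.

(** The right-hand side is the Poisson kernel at [xi]. *)
Lemma Re_cayley xi (z : R[i]) : modulus xi = 1 -> modulus z < 1 ->
  Re (cayley xi z) = (1 - modulus z ^+ 2) / modulus (xi - z) ^+ 2.
Proof.
move=> xi1 z1; have d0 := cayley_den xi1 z1.
have d1 : (xi - z)^* != 0 by rewrite conjc_eq0.
have E : cayley xi z = (xi + z) * (xi - z)^* * ((modulus (xi - z) ^+ 2)^-1)%:C.
  by rewrite fmorphV /= -mulJ /cayley; move: (xi - z) d0 d1 => D d0 d1; field; rewrite d0 d1.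
rewrite E Re_mul_real; congr (_ / _).
rewrite -(expr1n _ 2) -xi1 !modulus_sqr !ReImE; ring.
Qed.

Lemma cayley_disc xi z : modulus xi = 1 -> 1 - modulus (hval z) ^+ 2 =
  4 * Re (cayley xi (hval z)) / modulus (cayley xi (hval z) + 1) ^+ 2.
Proof.
move=> xi1; have z1 := hval_lt1 z.
have d0 : 0 < modulus (xi - hval z) by rewrite modulus_gt0 cayley_den.
have -> : modulus (cayley xi (hval z) + 1) = 2 / modulus (xi - hval z).
  rewrite cayleyD1// modulusM modulusV modulusM xi1 mulr1.
  by congr (_ / _); rewrite -(ger0_norm (ler0n R 2)) -modulus_real rmorph_nat.
rewrite Re_cayley//; move: (1 - _) (modulus (xi - _)) d0 => x y y0.
by field; rewrite gt_eqF.
Qed.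

(** [cayley xi] sends the origin to 1; closeness to 1 is thus converted into the closeness to the
    origin that discreteness excludes. *)
Lemma cayley_near xi z : modulus xi = 1 ->
  modulus (hval z) <= modulus (cayley xi (hval z) - 1).
Proof.
move=> xi1; have z1 := hval_lt1 z; have d0 := cayley_den xi1 z1.
have -> : cayley xi (hval z) - 1 = 2 * hval z / (xi - hval z) by rewrite /cayley; field.
rewrite modulusM modulusV modulusM.
have -> : modulus (2 : R[i]) = 2 by rewrite -(ger0_norm (ler0n R 2)) -modulus_real rmorph_nat.
rewrite ler_pdivlMr ?modulus_gt0//.
have := modulusD xi (- hval z); rewrite modulusN xi1.
have := modulus_ge0 (hval z); nra.
Qed.

Lemma affine_at_comp xi A t B s k l : affine_at xi A t k -> affine_at xi B s l ->
  affine_at xi (A * B) (A * s + t) (k \o l).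
Proof.
move=> hk hl z; rewrite hk hl; move: (cayley _ _) => W; apply: complex_ext; rewrite !(ReImE, cRe_mk, cIm_mk); ring.
Qed.

Lemma affine_at_inv xi A t k k' : A != 0 -> affine_at xi A t k -> cancel k' k ->
  affine_at xi A^-1 (- t / A) k'.
Proof.
move=> A0 hk kk' z; have := hk (k' z); rewrite kk' => ->.
have AC : A%:C != 0 by rewrite (fmorph_eq0 (real_complex R)).
move: (cayley _ _) => W; apply: complex_ext; rewrite !(ReImE, cRe_mk, cIm_mk); by field.
Qed.

Lemma affine_at_eq xi A t k l : modulus xi = 1 -> affine_at xi A t k -> affine_at xi A t l -> k = l.
Proof.
move=> xi1 hk hl; apply/funext => z; apply: hval_inj.
by apply: (cayley_inj xi1); rewrite ?hval_lt1// hk hl.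
Qed.

Lemma Re_real_sub (s t : R) (v : R[i]) :
  Re (s%:C - (2 * t)%:C * v) = s - 2 * Re (t%:C * v^*).
Proof. by rewrite !ReImE; ring. Qed.

(** At a fixed point on the circle the denominator is a real number [mu], and the multiplier in the
    half-plane coordinate is [mu^2]. *)
Lemma mob_fix_affine a b xi k : moebius a b k -> modulus xi = 1 -> mob a b xi = xi ->
  exists t, affine_at xi (modulus (mden a b xi) ^+ 2) t k.
Proof.
move=> [h kE] xi1 fixx.
have d0 : mden a b xi != 0 by apply: mden_neq0; rewrite ?xi1.
pose mu := Re (mden a b xi).
have num : a * xi + b = xi * mden a b xi by rewrite -[X in X * mden a b xi]fixx /mob divfK.
have dJ : (mden a b xi)^* = mden a b xi.
  have e1 : mden a b xi = xi^* * (a * xi + b) by rewrite num mulrA (mulrC xi^*) unit_mulJ// mul1r.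
  have -> : (mden a b xi)^* = a * (xi * xi^*) + b * xi^*.
    by rewrite /mden rmorphD rmorphM /= !conjcK unit_mulJ//; ring.
  by rewrite e1; ring.
have dE : mden a b xi = mu%:C.
  apply: complex_ext => //=; have := congr1 (@complex.Im R) dJ; rewrite cImJ; lra.
have mu2 : modulus (mden a b xi) ^+ 2 = mu ^+ 2.
  by rewrite dE modulus_real real_normK// num_real.
have Re0 : Re (mu%:C ^+ 2 - 1 - 2 * mu%:C * xi * b^*) = 0.
  have aE : a^* = mu%:C - b^* * xi by rewrite -dE /mden; ring.
  have := h; rewrite /su11 -(modulusJ a) aE modulusB_sqr modulus_real modulusM modulusJ xi1 mulr1.
  rewrite real_normK ?num_real// => E.
  have -> : Re (mu%:C ^+ 2 - 1 - 2 * mu%:C * xi * b^*) =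
    mu ^+ 2 - 1 - 2 * Re (mu%:C * (b^* * xi)^*).
    have -> : mu%:C ^+ 2 - 1 - 2 * mu%:C * xi * b^* = (mu ^+ 2 - 1)%:C - (2 * mu)%:C * (b^* * xi).
      by rewrite !(rmorphB, rmorphM, rmorphXn, rmorph1) /= rmorph_nat; ring.
    exact: Re_real_sub.
  by move: E; lra.
(* The translation part is [mu^2 - 1 - 2 mu xi b^*]; the determinant condition makes it purely
   imaginary. *)
exists (Im (mu%:C ^+ 2 - 1 - 2 * mu%:C * xi * b^*)) => z; rewrite kE mu2.
have z1 := hval_lt1 z.
have -> : Complex (0 : R) (Im (mu%:C ^+ 2 - 1 - 2 * mu%:C * xi * b^*)) =
   mu%:C ^+ 2 - 1 - 2 * mu%:C * xi * b^*.
  by apply: complex_ext; rewrite //= Re0.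
have zx := cayley_den xi1 z1.
have D0 := mden_neq0 h (ltW z1).
have mz : mob a b (hval z) = xi - (xi - hval z) / (mu%:C * mden a b (hval z)).
  rewrite -dE -{1}(subrK (mob a b xi) (mob a b (hval z))) mob_sub ?xi1 ?(ltW z1)// fixx.
  by field; rewrite d0 D0.
have mu0 : mu%:C != 0 by rewrite -dE.
have DE : mden a b (hval z) = mu%:C - b^* * (xi - hval z) by rewrite -dE /mden; ring.
rewrite mz /cayley rmorphXn /= DE; rewrite DE in D0.
move: (hval z) mu%:C b^* mu0 zx D0 => x v c v0 zx D0.
by field; rewrite zx D0 v0.
Qed.

(** In the half-plane coordinate the radius to [xi] becomes part of the real axis and [k'] divides
    by [A > 1] after a vertical shift. Iterating it until the real part lies between 1 and [A] ends
    in a compact rectangle. *)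
Lemma attracting_cobounded a b xi k k' : moebius a b k -> attracting a b xi -> cancel k' k ->
  exists2 c, 0 < c & forall z (s : R), 0 <= s -> hval z = s%:C * xi ->
    exists m, c <= 1 - modulus (hval (iter m k' z)) ^+ 2.
Proof.
move=> hk [h xi1 fixx mu1] kk'.
have [t] := mob_fix_affine hk xi1 fixx.
set A := modulus _ ^+ 2 => hA.
have A1 : 1 < A by rewrite /A expr_gt1 ?modulus_ge0.
have A0 : 0 < A by lra.
have hA' := affine_at_inv (lt0r_neq0 A0) hA kk'.
(* The fixed point of [C |-> (C + |t|) / A], so that the strip of height [C] around the real axis is
   stable under [k']. *)
pose C := `|t| / (A - 1).
have C0 : 0 <= C by rewrite divr_ge0// subr_ge0 ltW.
have CA : C * A = C + `|t|.
  have : C * (A - 1) = `|t| by rewrite /C divfK// subr_eq0 gt_eqF.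
  lra.
pose ok z := 1 <= Re (cayley xi (hval z)) /\ `|Im (cayley xi (hval z))| <= C.
have step z : ok z -> A < Re (cayley xi (hval z)) -> ok (k' z) /\
    Re (cayley xi (hval (k' z))) = Re (cayley xi (hval z)) / A.
  move=> [r1 i1] rA.
  have ReE : Re (cayley xi (hval (k' z))) = Re (cayley xi (hval z)) / A.
    by rewrite hA'; move: (cayley _ _) => W; rewrite !(ReImE, cRe_mk, cIm_mk); ring.
  have ImE : Im (cayley xi (hval (k' z))) = (Im (cayley xi (hval z)) - t) / A.
    by rewrite hA'; move: (cayley _ _) => W; rewrite !(ReImE, cRe_mk, cIm_mk); ring.
  split=> //; split; first by rewrite ReE ler_pdivlMr// mul1r ltW.
  rewrite ImE normrM normfV (gtr0_norm A0) ler_pdivrMr// CA.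
  by apply: le_trans (ler_normB _ _) _; rewrite lerD2r.
have descend n z : ok z -> Re (cayley xi (hval z)) <= A ^+ n.+1 ->
    exists m, ok (iter m k' z) /\ Re (cayley xi (hval (iter m k' z))) <= A.
  elim: n z => [|n IH] z okz zA; first by exists 0%N.
  have [zA1|Az] := leP (Re (cayley xi (hval z))) A; first by exists 0%N.
  have [okz' zE] := step z okz Az.
  have [|m hm] := IH (k' z) okz'.
    by rewrite zE ler_pdivrMr// mulrC -exprS.
  by exists m.+1; rewrite iterSr.
(* From [cayley_disc], with real part at least 1 and [|W + 1|] at most [A + 1 + C]. *)
exists (4 / (A + 1 + C) ^+ 2); first by rewrite divr_gt0// exprn_gt0//; lra.
move=> z s s0 zE.
have s1 : s < 1.
  by have := hval_lt1 z; rewrite zE modulusM modulus_real xi1 mulr1 ger0_norm.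
have x0 : xi != 0 by rewrite -modulus_gt0 xi1.
have cE : cayley xi (hval z) = ((1 + s) / (1 - s))%:C.
  have d0 : 1 - s%:C != 0 :> R[i].
    by rewrite -(rmorph1 (real_complex R)) -rmorphB fmorph_eq0 subr_eq0 gt_eqF.
  rewrite /cayley zE rmorphM fmorphV rmorphD rmorphB rmorph1 /=.
  have -> : xi - s%:C * xi = xi * (1 - s%:C) by ring.
  have -> : xi + s%:C * xi = xi * (1 + s%:C) by ring.
  by rewrite -mulf_div divff// mul1r.
have okz : ok z.
  rewrite /ok cE /= normr0; split=> //.
  by rewrite ler_pdivlMr ?mul1r ?subr_gt0//; lra.
have [n hn] : exists n, Re (cayley xi (hval z)) <= A ^+ n.+1.
  pose N := (Num.truncn (Re (cayley xi (hval z)) / (A - 1))).+1.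
  exists N; apply: le_trans (_ : N%:R * (A - 1) <= _).
    by rewrite -ler_pdivrMr ?subr_gt0// ltW// truncnS_gt.
  elim: N => [|N IH]; first by rewrite mul0r exprn_ge0// ltW.
  rewrite exprS -natr1 mulrDl mul1r.
  have : 1 <= A ^+ N.+1 by rewrite exprn_ege1// ltW.
  nra.
have [m [[m1 m2] m3]] := descend n z okz hn; exists m.
rewrite (cayley_disc _ xi1).
set W := cayley xi _ in m1 m2 m3 *.
have W1 : modulus (W + 1) <= A + 1 + C.
  apply: le_trans (modulus_le_ReIm _) _; rewrite cReD cImD /= addr0.
  by apply: lerD => //; rewrite ger0_norm; lra.
have W0 : 0 < modulus (W + 1).
  rewrite modulus_gt0; apply/eqP => /(congr1 (@complex.Re R)); rewrite cReD /=; lra.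
rewrite ler_pM// ?invr_ge0 ?exprn_ge0//; [lra|lra|].
rewrite lef_pV2 ?posrE ?exprn_gt0//; last lra.
by rewrite ler_pXn2r// ?nnegrE ?modulus_ge0//; lra.
Qed.

End Cayley.

Section Stabilizers.
Context {R : realType} {X : topologicalType} (p : hplane R -> X).
Hypothesis pcov : covering_map p.

Definition stabilizes (xi : R[i]) (k : hplane R -> hplane R) :=
  exists a b, moebius a b k /\ mob a b xi = xi.

Lemma stabilizes_affine xi k : modulus xi = 1 -> stabilizes xi k ->
  exists A t, 0 < A /\ affine_at xi A t k.
Proof.
move=> xi1 [a [b [hk fixx]]]; have [t ht] := mob_fix_affine hk xi1 fixx.
exists (modulus (mden a b xi) ^+ 2), t; split=> //.
by rewrite exprn_gt0// mden_gt0 ?xi1//; case: hk.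
Qed.

Lemma exists_exp_lt (A M e : R) : 0 < A < 1 -> 0 < e -> exists n, A ^+ n * M < e.
Proof.
move=> /andP[A0 A1] e0.
have : (fun n => A ^+ n * M) @ \oo --> (0 : R).
  rewrite -(mul0r M); apply: cvgMl; apply: cvg_expr; by rewrite gtr0_norm.
move=> /cvgrPdist_lt/(_ e e0)[n _ /(_ n (leqnn n))] /=; rewrite sub0r normrN => h.
by exists n; apply: le_lt_trans (ler_norm _) h.
Qed.

(* A translation [w |-> w + i d] conjugated by a power of [u] tends to the
   identity, which contradicts discreteness unless [d = 0]. *)
Lemma pi1_translation_trivial xi A s d u c : modulus xi = 1 -> pi1 p u -> pi1 p c ->
  0 < A -> A != 1 -> affine_at xi A s u -> affine_at xi 1 d c -> d = 0.
Proof.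
move=> xi1.
wlog A1 : A s u / A < 1.
  move=> H gu gc A0 Ane hu hc.
  have [A1|A1|A1] := ltgtP A 1; [exact: (H A s u) | | by rewrite A1 eqxx in Ane].
  have [u' [gu' uu' u'u]] := pi1_inv gu.
  apply: (H A^-1 (- s / A) u') => //.
  - by rewrite invf_lt1.
  - by rewrite invr_gt0.
  - by rewrite invr_eq1.
  - exact: affine_at_inv (lt0r_neq0 A0) hu u'u.
move=> gu gc A0 _ hu hc.
have [u' [gu' uu' u'u]] := pi1_inv gu.
have hu' := affine_at_inv (lt0r_neq0 A0) hu u'u.
have conjugate n : exists2 c', pi1 p c' & affine_at xi 1 (A ^+ n * d) c'.
  elim: n => [|n [c' gc' hc']]; first by exists c; rewrite // mul1r.
  exists (u \o (c' \o u')); first by do 2!apply: pi1_comp => //.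
  have := affine_at_comp hu (affine_at_comp hc' hu').
  rewrite mul1r mulfV ?gt_eqF// exprS.
  by have -> : A * (1 * (- s / A) + A ^+ n * d) + s = A * A ^+ n * d by field; rewrite gt_eqF.
have [e e0 eP] := pi1_discrete pcov.
have [n nP] := @exists_exp_lt A `|d| e (introT andP (conj A0 A1)) e0.
have [c' gc' hc'] := conjugate n.
have W0 : cayley xi (hval (horigin : hplane R)) = 1.
  by rewrite /cayley horiginE addr0 subr0 divff// -modulus_gt0 xi1.
have c'id : c' = id.
  apply: eP => //; apply: le_lt_trans (cayley_near _ xi1) _.
  rewrite hc' W0 mulr1 addrC addKr.
  apply: le_lt_trans (modulus_le_ReIm _) _.
  by rewrite cRe_mk cIm_mk normr0 add0r normrM ger0_norm ?exprn_ge0// ltW.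
have := hc' horigin; rewrite c'id W0 mulr1 => /(congr1 (@complex.Im R)).
rewrite cImD cIm_mk /= add0r => /esym/eqP; rewrite mulf_eq0 expf_eq0 gt_eqF// andbF.
by move=> /eqP.
Qed.

(** The commutator has multiplier 1, hence is a translation. It is trivial by discreteness as soon
    as one multiplier differs from 1; otherwise both elements are translations. *)
Lemma stabilizer_commute xi g h : modulus xi = 1 -> pi1 p g -> pi1 p h ->
  stabilizes xi g -> stabilizes xi h -> g \o h = h \o g.
Proof.
move=> xi1 gg gh /(stabilizes_affine xi1)[A [s [A0 hg]]] /(stabilizes_affine xi1)[B [t [B0 hh]]].
have gh1 := affine_at_comp hg hh; have hg1 := affine_at_comp hh hg.
have [v [gv vv' v'v]] := pi1_inv (pi1_comp gh gg).
have BA0 : B * A != 0 by rewrite mulf_neq0 ?gt_eqF.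
have hv := affine_at_inv BA0 hg1 v'v.
have hc := affine_at_comp gh1 hv.
have E1 : A * B / (B * A) = 1 by rewrite (mulrC B) divff// mulrC.
rewrite E1 in hc.
have E : A * t + s = B * s + t.
  have [/andP[/eqP A1 /eqP B1]|] := boolP ((A == 1) && (B == 1)).
    by rewrite A1 B1 !mul1r addrC.
  rewrite negb_and => ne.
  have : A * B * (- (B * s + t) / (B * A)) + (A * t + s) = 0.
    have gc := pi1_comp (pi1_comp gg gh) gv.
    case/orP: ne => ne.
      exact: pi1_translation_trivial xi1 gg gc A0 ne hg hc.
    exact: pi1_translation_trivial xi1 gh gc B0 ne hh hc.
  have -> : A * B * (- (B * s + t) / (B * A)) = - (B * s + t) by field; rewrite !gt_eqF.
  lra.
apply: (affine_at_eq xi1 gh1); by rewrite E (mulrC A B).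
Qed.

End Stabilizers.

(** * Elements of bounded displacement *)

Section BoundedDisplacement.
Context {R : realType}.
Implicit Types (z w : hplane R) (xi : R[i]).

(** Near [xi], the point [g z] is close to the image of [xi] by continuity and close to [xi] by
    bounded displacement. *)
Lemma bounded_displacement_fix a b g xi M : moebius a b g -> modulus xi = 1 ->
  (forall d, 0 < d -> exists2 z, modulus (hval z - xi) < d & hquot z (g z) <= M) ->
  mob a b xi = xi.
Proof.
move=> hg xi1 disp; apply/eqP; rewrite -subr_eq0 -modulus_eq0 eq_le modulus_ge0 andbT.
apply/ler_addgt0Pr => e e0; rewrite add0r.
have e20 : 0 < e / 2 by rewrite divr_gt0.
have [d1 d10 P1] := hquot_converge M xi1 e20.
have [d2 d20 P2] := moebius_boundary hg xi1 e20.
have [|z] := disp (Num.min d1 d2); first by rewrite lt_min d10.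
rewrite lt_min => /andP[z1 z2] zM.
have := P1 _ _ zM z1; have := P2 _ z2.
have := modulusB3 (hval (g z)) (mob a b xi) xi; rewrite (modulusC _ (hval (g z))); lra.
Qed.

Lemma hquot_displacement_le a b g c : moebius a b g -> 0 < c ->
  exists M, forall z, c <= 1 - modulus (hval z) ^+ 2 -> hquot z (g z) <= M.
Proof.
move=> [h gE] c0; pose K := modulus a + modulus b.
(* 4 bounds the squared Euclidean distance, while [c] and [c / K^2] bound the two factors of the
   denominator from below. *)
exists (4 * K ^+ 2 / c ^+ 2) => z zc.
have z1 := ltW (hval_lt1 z); have D0 := mden_gt0 h z1; have DK := mden_le a b z1.
have K0 : 0 < K := lt_le_trans D0 DK.
have gz : c / K ^+ 2 <= 1 - modulus (hval (g z)) ^+ 2.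
  rewrite gE mob_modulus// ler_pM ?invr_ge0 ?sqr_ge0 ?(ltW c0)//.
  by rewrite lef_pV2 ?posrE ?exprn_gt0// lerXn2r ?nnegrE ?(ltW D0) ?(ltW K0).
rewrite /hquot; have -> : 4 * K ^+ 2 / c ^+ 2 = 4 / (c * (c / K ^+ 2)).
  by field; rewrite !gt_eqF.
have p1 : 0 < c * (c / K ^+ 2) by rewrite !mulr_gt0// invr_gt0 exprn_gt0.
apply: ler_pM; rewrite ?sqr_ge0 ?invr_ge0 ?mulr_ge0 ?(ltW (disc_gt0 _))//.
  have : modulus (hval z - hval (g z)) <= 2.
    apply: le_trans (modulusD _ _) _; rewrite modulusN.
    by have := hval_lt1 z; have := hval_lt1 (g z); lra.
  by have := modulus_ge0 (hval z - hval (g z)); nra.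
rewrite lef_pV2 ?posrE//; last by rewrite mulr_gt0 ?disc_gt0.
by rewrite ler_pM ?(ltW c0)// divr_ge0 ?(ltW c0)// exprn_ge0// ltW.
Qed.

Lemma hquot_iter_displacement a b g g' z m : moebius a b g -> cancel g g' -> cancel g' g ->
  hquot (iter m g' z) (g (iter m g' z)) = hquot z (g z).
Proof.
move=> hg gg' g'g; elim: m => //= m <-.
set w := iter m g' z.
by rewrite g'g -(hquot_mob (g' w) w hg) g'g.
Qed.

Lemma point_near_boundary xi (d : R) : modulus xi = 1 -> 0 < d ->
  exists z s, [/\ modulus (hval z - xi) < d, 0 <= s & hval z = s%:C * xi].
Proof.
move=> xi1 d0; pose t := Num.min (d / 2) (1 / 2).
have t0 : 0 < t by rewrite lt_min !divr_gt0.
have t1 : t <= 1 / 2 by rewrite ge_min lexx orbT.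
have td : t <= d / 2 by rewrite ge_min lexx.
have s1 : modulus ((1 - t)%:C * xi) < 1.
  by rewrite modulusM modulus_real xi1 mulr1 ger0_norm; lra.
exists (hpoint s1), (1 - t); rewrite hpointK; split=> //; last by lra.
have -> : (1 - t)%:C * xi - xi = - (t%:C * xi) by rewrite rmorphB rmorph1; ring.
by rewrite modulusN modulusM modulus_real xi1 mulr1 gtr0_norm//; lra.
Qed.

(** Commutation makes the displacement of [l] constant along orbits of [k], hence bounded on the
    radius to [xi], which the powers of [k'] bring back to a compact disc. *)
Lemma attracting_commute a b c d k k' l xi : moebius a b k -> attracting a b xi ->
  cancel k k' -> cancel k' k -> moebius c d l -> k \o l = l \o k -> mob c d xi = xi.
Proof.
move=> hk at_k kk' k'k hl comm; have [_ xi1 _ _] := at_k.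
have [c0 c00 cP] := attracting_cobounded hk at_k k'k.
have [M MP] := hquot_displacement_le hl c00.
have hk' := moebius_inv hk k'k.
have comm' w : l (k' w) = k' (l w).
  by rewrite -{2}(k'k w) -[l (k (k' w))]/((l \o k) (k' w)) -comm /= kk'.
apply: (bounded_displacement_fix (M := M) hl xi1) => e e0.
have [z [s [ze s0 zE]]] := point_near_boundary xi1 e0.
exists z => //; have [m mP] := cP z s s0 zE.
have -> : hquot z (l z) = hquot (iter m k' z) (l (iter m k' z)).
  elim: m {mP} => //= m ->; by rewrite comm' (hquot_mob _ _ hk').
exact: MP.
Qed.

(** Three fixed points force [b = 0], and then the denominator has modulus 1 everywhere. *)
Lemma attracting_fix3 a b x y (z : R[i]) : attracting a b x -> modulus y = 1 -> modulus z = 1 ->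
  x != y -> x != z -> y != z -> mob a b y = y -> mob a b z = z -> False.
Proof.
move=> [h x1 fx D1] y1 z1 xy xz yz fy fz.
have := mob_fix3 0 h x1 y1 z1 xy xz yz fx fy fz.
rewrite mob_0 => /eqP; rewrite mulf_eq0 invr_eq0 conjc_eq0 (negPf (su11_neq0 h)) orbF => /eqP b0.
move: D1; rewrite /mden b0 rmorph0 mul0r add0r modulusJ.
by move: h; rewrite /su11 b0 modulus0; have := modulus_ge0 a; nra.
Qed.

(** Compact discs go into compact discs. Applied to the inverse of a homeomorphism, this is
    properness. *)
Lemma continuous_disc_bound (H : hplane R -> hplane R) c : continuous H -> 0 < c ->
  exists2 c', 0 < c' & forall z, c <= 1 - modulus (hval z) ^+ 2 ->
     c' <= 1 - modulus (hval (H z)) ^+ 2.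
Proof.
move=> cH c0.
have [||d d0 dP] := @disc_uniform R (fun d (x : R[i]) => forall w, hval w = x ->
   c <= 1 - modulus x ^+ 2 -> d <= 1 - modulus (hval (H w)) ^+ 2).
- by move=> d d' z dd dP w wz wc; apply: le_trans dd _; exact: dP.
- move=> a; have [a1|a1] := ltP (modulus a) 1; last first.
    exists (c / 2); first by rewrite divr_gt0.
    move=> z za w wz; have := hval_lt1 w; rewrite wz => z1 zc; exfalso.
    have := modulus_subl a z; rewrite modulusC; have := modulus_ge0 z; nra.
  have g0 := disc_gt0 (H (hpoint a1)).
  set g := 1 - _ in g0.
  have g40 : 0 < g / 4 by rewrite divr_gt0.
  have [e e0 eP] := (continuous_hplaneP H (hpoint a1)).1 (cH (hpoint a1)) _ g40.
  exists (Num.min e (g / 4)); first by rewrite lt_min e0.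
  move=> z; rewrite lt_min => /andP[ze _] w wz _.
  have := eP w; rewrite hpointK wz => /(_ ze) h.
  have := modulus_subl (hval (H w)) (hval (H (hpoint a1))).
  have : Num.min e (g / 4) <= g / 4 by rewrite ge_min lexx orbT.
  have := modulus_ge0 (hval (H w)); have := hval_lt1 (H w).
  have := modulus_ge0 (hval (H (hpoint a1))); have := hval_lt1 (H (hpoint a1)).
  rewrite /g in g0 g40 h *; nra.
by exists d => // z zc; exact: (dP (hval z) (ltW (hval_lt1 z)) z).
Qed.

End BoundedDisplacement.

(** * Boundary extension of lifts *)

Section Sectors.
Context {R : realType}.
Implicit Types (u v y : R[i]).

(** If [u v^*] has positive imaginary part, this is the open cone spanned by [u] and [v]: by
    Cramer's rule the two quantities are, up to that positive factor, the coordinates of [y]. *)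
Definition sector u v y := 0 < Im (y * v^*) /\ 0 < Im (u * y^*).

Lemma on_ray u y : modulus u = 1 -> Im (y * u^*) = 0 -> y = (Re (y * u^*))%:C * u.
Proof.
move=> u1 I0; have -> : (Re (y * u^*))%:C = y * u^* by apply: complex_ext.
by rewrite -mulrA (mulrC u^*) unit_mulJ// mulr1.
Qed.

(** Off the two bounding rays, failing to be in the sector is witnessed by a strict inequality,
    hence is an open condition. *)
Lemma not_sector u v y : modulus u = 1 -> modulus v = 1 -> 0 < Im (u * v^*) ->
  ~ (exists2 s : R, 0 <= s & y = s%:C * u \/ y = s%:C * v) ->
  ~ sector u v y -> Im (y * v^*) < 0 \/ Im (u * y^*) < 0.
Proof.
move=> u1 v1 uv nray nsec.
have [h1|h1] := ltP (Im (y * v^*)) 0; first by left.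
have [h2|h2] := ltP (Im (u * y^*)) 0; first by right.
have pos (s : R) : 0 <= s * Im (u * v^*) -> 0 <= s by rewrite pmulr_lge0.
exfalso; move: h1 h2; rewrite le_eqVlt => /orP[/eqP/esym e1|p1].
  have yE := on_ray v1 e1; move: (Re _) yE => s yE h2; apply: nray; exists s; last by right.
  apply: pos; apply: le_trans h2 _; rewrite yE le_eqVlt; apply/orP; left.
  by apply/eqP; rewrite !ReImE; ring.
rewrite le_eqVlt => /orP[/eqP/esym e2|p2]; last exact: nsec.
have e2' : Im (y * u^*) = 0 by rewrite -[Im _]opprK -cImJ rmorphM /= conjcK mulrC e2 oppr0.
have yE := on_ray u1 e2'; move: (Re _) yE => s yE; apply: nray; exists s; last by left.
apply: pos; apply: le_trans (ltW p1) _; rewrite yE le_eqVlt; apply/orP; left.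
by apply/eqP; rewrite !ReImE; ring.
Qed.

Lemma Im_mulJ_near (x x' u : R[i]) : modulus u = 1 ->
  `|Im (x * u^*) - Im (x' * u^*)| <= modulus (x - x').
Proof.
move=> u1; have -> : Im (x * u^*) - Im (x' * u^*) = Im ((x - x') * u^*).
  by rewrite mulrBl cImD cImN.
by apply: le_trans (Im_le_modulus _) _; rewrite modulusM modulusJ u1 mulr1.
Qed.

Lemma Im_Jmul_near (x x' u : R[i]) : modulus u = 1 ->
  `|Im (u * x^*) - Im (u * x'^*)| <= modulus (x - x').
Proof.
move=> u1; have -> : Im (u * x^*) - Im (u * x'^*) = Im (u * (x - x')^*).
  by rewrite rmorphB mulrBr cImD cImN.
by apply: le_trans (Im_le_modulus _) _; rewrite modulusM modulusJ u1 mul1r.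
Qed.

(** If the image of the segment avoided both rays, membership in the sector would be locally
    constant along it. *)
Lemma sector_crossing u v (H : hplane R -> hplane R) z w : continuous H ->
  modulus u = 1 -> modulus v = 1 -> 0 < Im (u * v^*) ->
  sector u v (hval (H z)) -> ~ sector u v (hval (H w)) ->
  exists2 t, 0 <= t <= 1 & exists2 s, 0 <= s &
    hval (H (hseg z w t)) = s%:C * u \/ hval (H (hseg z w t)) = s%:C * v.
Proof.
move=> cH u1 v1 uv Sz nSw; apply: contrapT => none.
apply: nSw; rewrite -(hseg1 z w).
apply: (@locally_constant01 _ (fun t => sector u v (hval (H (hseg z w t))))); last by rewrite hseg0.
move=> t t01.
have cont e : 0 < e -> exists2 d, 0 < d & forall s, 0 <= s <= 1 -> `|s - t| < d ->
    modulus (hval (H (hseg z w s)) - hval (H (hseg z w t))) < e.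
  move=> e0; apply: (@continuous01_seg R _ H z w _ t t01
    [set x | modulus (hval x - hval (H (hseg z w t))) < e]) => [? ?|]; first exact: cH.
  by apply/nbhs_hplaneP; exists e.
have near x (q := hval (H (hseg z w t))) : Im (x * v^*) - modulus (x - q) <= Im (q * v^*) /\
   Im (q * v^*) - modulus (x - q) <= Im (x * v^*) /\
   Im (u * x^*) - modulus (x - q) <= Im (u * q^*) /\
   Im (u * q^*) - modulus (x - q) <= Im (u * x^*).
  have := Im_mulJ_near x q v1; have := Im_Jmul_near x q u1.
  by rewrite !ler_norml => /andP[? ?] /andP[? ?]; split; [|split; [|split]]; lra.
have [[S1 S2]|nS] := pselect (sector u v (hval (H (hseg z w t)))).
  have [|d d0 dP] := cont (Num.min (Im (hval (H (hseg z w t)) * v^*)) (Im (u * (hval (H (hseg z w t)))^*))).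
    by rewrite lt_min S1.
  exists d => // s s01 sd; split=> // _.
  have := dP s s01 sd; rewrite lt_min => /andP[m1 m2].
  have [n1 [n2 [n3 n4]]] := near (hval (H (hseg z w s))).
  by split; lra.
have nray : ~ (exists2 s : R, 0 <= s & hval (H (hseg z w t)) = s%:C * u \/ hval (H (hseg z w t)) = s%:C * v).
  by move=> r; apply: none; exists t.
have [S1|S1] := not_sector u1 v1 uv nray nS.
- have [|d d0 dP] := cont (- Im (hval (H (hseg z w t)) * v^*)); first by rewrite oppr_gt0.
  exists d => // s s01 sd; split=> // -[T1 T2]; exfalso.
  have := dP s s01 sd; have [n1 [n2 [n3 n4]]] := near (hval (H (hseg z w s))); lra.
- have [|d d0 dP] := cont (- Im (u * (hval (H (hseg z w t)))^*)); first by rewrite oppr_gt0.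
  exists d => // s s01 sd; split=> // -[T1 T2]; exfalso.
  have := dP s s01 sd; have [n1 [n2 [n3 n4]]] := near (hval (H (hseg z w s))); lra.
Qed.

(** Rotating [a] to 1 puts [u] and [v] in the right half plane, above and below the real axis, so
    the angle from [v] to [u] is less than a half turn. *)
Lemma Im_sides_gt0 (a u v : R[i]) : modulus a = 1 -> modulus (u - a) < 1 -> modulus (v - a) < 1 ->
  0 < Im (a^* * u) -> Im (a^* * v) < 0 -> 0 < Im (u * v^*).
Proof.
move=> a1 ua va Iu Iv.
have Rpos x : modulus (x - a) < 1 -> 0 < Re (a^* * x).
  move=> xa; have -> : a^* * x = 1 + a^* * (x - a).
    by rewrite mulrBr (mulrC _ a) unit_mulJ//; ring.
  rewrite cReD /=; have := Re_le_modulus (a^* * (x - a)).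
  rewrite modulusM modulusJ a1 mul1r ler_norml => /andP[h _]; lra.
have -> : u * v^* = (a^* * u) * (a^* * v)^*.
  rewrite rmorphM /= conjcK.
  have -> : a^* * u * (a * v^*) = (a * a^*) * (u * v^*) by ring.
  by rewrite unit_mulJ// mul1r.
have := Rpos u ua; have := Rpos v va.
move: (a^* * u) (a^* * v) Iu Iv => p q Ip Iq Rq Rp.
by rewrite cImM cImJ cReJ; nra.
Qed.

(** Writing [y = s u + t v] with [s] and [t] positive, [y] is close to [(s + t) a], and [|y|] close
    to 1 makes [s + t] close to 1. *)
Lemma sector_near (a u v y : R[i]) (e : R) : modulus a = 1 -> modulus u = 1 -> modulus v = 1 ->
  0 < Im (u * v^*) -> 0 < e -> modulus (u - a) < Num.min (1 / 4) (e / 8) ->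
  modulus (v - a) < Num.min (1 / 4) (e / 8) -> sector u v y ->
  modulus y < 1 -> 1 - e / 8 < modulus y -> modulus (y - a) < e.
Proof.
move=> a1 u1 v1 uv e0; set e1 := Num.min _ _ => ua va [y1 y2] ym yM.
have e10 : 0 < e1 by rewrite lt_min !divr_gt0.
have e14 : e1 <= 1 / 4 by rewrite ge_min lexx.
have e18 : e1 <= e / 8 by rewrite ge_min lexx orbT.
pose s := Im (y * v^*) / Im (u * v^*); pose t := Im (u * y^*) / Im (u * v^*).
have s0 : 0 < s by rewrite divr_gt0.
have t0 : 0 < t by rewrite divr_gt0.
have yE : y = s%:C * u + t%:C * v.
  have : (Im (u * v^*))%:C * y = (Im (y * v^*))%:C * u + (Im (u * y^*))%:C * v.
    by apply: complex_ext; rewrite !ReImE; ring.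
  have D0 : (Im (u * v^*))%:C != 0 by rewrite (fmorph_eq0 (real_complex R)) gt_eqF.
  move=> E; apply: (mulfI D0); rewrite E /s /t !rmorphM !fmorphV /=.
  by move: (Im (u * v^*))%:C (Im (y * v^*))%:C (Im (u * y^*))%:C D0 => D p q D0; field.
have st1 : modulus y <= s + t.
  rewrite yE; apply: le_trans (modulusD _ _) _.
  by rewrite !modulusM !modulus_real u1 v1 !mulr1 !gtr0_norm.
have st2 : modulus (y - (s + t)%:C * a) <= (s + t) * e1.
  have -> : y - (s + t)%:C * a = s%:C * (u - a) + t%:C * (v - a).
    by rewrite yE rmorphD; ring.
  apply: le_trans (modulusD _ _) _; rewrite !modulusM !modulus_real !gtr0_norm//.
  nra.
have st3 : modulus ((s + t)%:C * a) = s + t.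
  by rewrite modulusM modulus_real a1 mulr1 gtr0_norm// addr_gt0.
have st4 : (s + t) * (1 - e1) < 1.
  have := modulus_subl ((s + t)%:C * a) y; rewrite modulusC st3; lra.
have st5 : s + t < 1 + 2 * e1 by nra.
have := modulusB3 ((s + t)%:C * a) y a.
have -> : (s + t)%:C * a - a = (s + t - 1)%:C * a by rewrite rmorphB rmorph1; ring.
rewrite (modulusM _ a) modulus_real a1 mulr1.
have : `|s + t - 1| < e / 4.
  by rewrite ltr_norml; apply/andP; split; lra.
nra.
Qed.

End Sectors.

Section BoundaryExtension.
Context {R : realType} {X1 X2 : topologicalType}.
Variables (p1 : hplane R -> X1) (p2 : hplane R -> X2).
Hypotheses (pcov1 : covering_map p1).
Hypothesis moebius1 : forall k, pi1 p1 k -> exists a b, moebius a b k.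
Hypothesis moebius2 : forall k, pi1 p2 k -> exists a b, moebius a b k.
Hypothesis near_ideal_point2 : forall (x : R[i]) e, modulus x = 1 -> 0 < e ->
  exists2 k, pi1 p2 k & modulus (hval (k horigin) - x) < e.
Variables H H' : hplane R -> hplane R.
Hypotheses (cH : continuous H) (cH' : continuous H').
Hypotheses (HK : cancel H H') (HK' : cancel H' H).
Hypothesis conj_pi1 : forall k, pi1 p2 k -> pi1 p1 (H' \o (k \o H)).

Definition reaches_ray (xi eta : R[i]) := forall d, 0 < d ->
  exists2 z, modulus (hval z - xi) < d & exists2 s : R, 0 <= s & hval (H z) = s%:C * eta.

(* Points of the ray towards [eta] stay at bounded distance from the orbit
   [k^m 0], so [H^-1 k H] moves points close to [xi] by a bounded distance. *)
Lemma reaches_ray_stabilizes xi eta k a b : modulus xi = 1 -> reaches_ray xi eta ->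
  pi1 p2 k -> moebius a b k -> attracting a b eta -> stabilizes xi (H' \o (k \o H)).
Proof.
move=> xi1 reach gk hk at_k; have gg := conj_pi1 gk.
set g := H' \o _ in gg *.
have [c [d hg]] := moebius1 gg; exists c, d; split=> //.
have [k' [gk' kk' k'k]] := pi1_inv gk.
have [c0 c00 cP] := attracting_cobounded hk at_k k'k.
have [c1 c10 c1P] := continuous_disc_bound cH' c00.
have [M MP] := hquot_displacement_le hg c10.
pose g' := H' \o (k' \o H).
have gg' : cancel g g' by move=> z; rewrite /g /g' /= HK' kk' HK.
have g'g : cancel g' g by move=> z; rewrite /g /g' /= HK' k'k HK.
apply: (bounded_displacement_fix (M := M) hg xi1) => e e0.
have [z ze [s s0 zE]] := reach e e0; exists z => //.
have [m mP] := cP (H z) s s0 zE.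
rewrite -(hquot_iter_displacement z m hg gg' g'g); apply: MP.
have -> : iter m g' z = H' (iter m k' (H z)).
  elim: m {mP} => [|m IH]; first by rewrite /= HK.
  by rewrite !iterS IH /g' /= HK'.
exact: c1P.
Qed.

Lemma attracting_side (a : R[i]) (sg : R) e : modulus a = 1 -> sg != 0 -> 0 < e ->
  exists k c d eta, [/\ pi1 p2 k, moebius c d k, attracting c d eta,
    modulus (eta - a) < e & 0 < sg * Im (a^* * eta)].
Proof.
move=> a1 sg0 e0.
have nsg : 0 < `|sg| by rewrite normr_gt0.
(* The sign of [sg] chooses the side; the resulting [y] is within [e / 4] of [a]. *)
pose t := e / 8 * (sg / `|sg|).
have nt : `|t| = e / 8.
  have n1 : `|sg / `|sg| | = 1 by rewrite normrM normfV normr_id divff ?gt_eqF.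
  by rewrite /t normrM n1 mulr1 gtr0_norm ?divr_gt0.
have sgt : 0 < sg * t.
  have -> : sg * t = e / 8 * (sg ^+ 2 / `|sg|) by rewrite /t; ring.
  by rewrite mulr_gt0 ?divr_gt0// exprn_even_gt0.
have [y [y1 ya yI]] := unit_point_near t a1.
have t2 : 0 < 1 + t ^+ 2 by rewrite ltr_wpDr// sqr_ge0.
have sI : 0 < sg * Im (a^* * y).
  rewrite yI; have -> : sg * (2 * t / (1 + t ^+ 2)) = 2 * (sg * t) / (1 + t ^+ 2) by ring.
  by rewrite divr_gt0// mulr_gt0.
(* The second bound is small enough to keep [eta] on the same side of [a] as [y]. *)
pose e' := Num.min (e / 2) (sg * Im (a^* * y) / `|sg|).
have e'0 : 0 < e' by rewrite lt_min !divr_gt0.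
have [k [c [d [eta [gk hk ak ky]]]]] := attracting_dense moebius2 (@pi1_comp R X2 p2) near_ideal_point2 y1 e'0.
exists k, c, d, eta; move: ky; rewrite lt_min => /andP[k1 k2]; split=> //.
  by have := modulusB3 y eta a; rewrite nt in ya; lra.
have -> : sg * Im (a^* * eta) = sg * Im (a^* * y) + sg * Im (a^* * (eta - y)).
  by rewrite -mulrDr -cImD -mulrDr addrC subrK.
have : `|sg * Im (a^* * (eta - y))| < sg * Im (a^* * y).
  rewrite normrM; apply: le_lt_trans (_ : `|sg| * modulus (eta - y) < _).
    rewrite ler_pM2l//; apply: le_trans (Im_le_modulus _) _.
    by rewrite modulusM modulusJ a1 mul1r.
  by rewrite mulrC -ltr_pdivlMr.
rewrite ltr_norml => /andP[h _]; lra.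
Qed.

(* Three deck transformations attracting on the same side of [a] would be
   conjugate to elements of the commutative stabilizer of [xi], and so would
   share their fixed points. *)
Lemma not_reaches_side (xi a : R[i]) (sg : R) e : modulus xi = 1 -> modulus a = 1 ->
  sg != 0 -> 0 < e ->
  ~ (forall eta, modulus eta = 1 -> modulus (eta - a) < e -> 0 < sg * Im (a^* * eta) ->
      reaches_ray xi eta).
Proof.
move=> xi1 a1 sg0 e0 good.
have neq_a x : 0 < sg * Im (a^* * x) -> 0 < modulus (x - a).
  move=> h; rewrite modulus_gt0 subr_eq0; apply: contraTneq h => ->.
  by rewrite mulJl /= mulr0 ltxx.
have [k1 [c1 [d1 [x1 [gk1 hk1 ak1 x1e x1s]]]]] := attracting_side a1 sg0 e0.
(* Each new point is chosen strictly closer to [a] than the previous one, which makes the three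
   points distinct. *)
have [k2 [c2 [d2 [x2 [gk2 hk2 ak2 x2e x2s]]]]] := attracting_side a1 sg0 (neq_a _ x1s).
have [k3 [c3 [d3 [x3 [gk3 hk3 ak3 x3e x3s]]]]] := attracting_side a1 sg0 (neq_a _ x2s).
have x12 : x1 != x2 by apply: contraTneq x2e => ->; rewrite ltxx.
have x23 : x2 != x3 by apply: contraTneq x3e => ->; rewrite ltxx.
have x13 : x1 != x3 by apply: contraTneq (lt_trans x3e x2e) => ->; rewrite ltxx.
have u1 : modulus x1 = 1 by case: ak1.
have u2 : modulus x2 = 1 by case: ak2.
have u3 : modulus x3 = 1 by case: ak3.
have r1 := good x1 u1 x1e x1s.
have r2 := good x2 u2 (lt_trans x2e x1e) x2s.
have r3 := good x3 u3 (lt_trans x3e (lt_trans x2e x1e)) x3s.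
have s1 := reaches_ray_stabilizes xi1 r1 gk1 hk1 ak1.
have comm k x c d : pi1 p2 k -> moebius c d k -> attracting c d x -> reaches_ray xi x ->
    k \o k1 = k1 \o k.
  move=> gk hk ak rk; have sk := reaches_ray_stabilizes xi1 rk gk hk ak.
  have E := stabilizer_commute pcov1 xi1 (conj_pi1 gk) (conj_pi1 gk1) sk s1.
  apply/funext => z; have := congr1 (fun f => H (f (H' z))) E.
  by rewrite /= !HK'.
have fixes k x c d : pi1 p2 k -> moebius c d k -> attracting c d x -> reaches_ray xi x ->
    mob c1 d1 x = x.
  move=> gk hk ak rk; have [k' [_ kk' k'k]] := pi1_inv gk.
  exact: (attracting_commute hk ak kk' k'k hk1 (comm _ _ _ _ gk hk ak rk)).
apply: (attracting_fix3 ak1 u2 u3 x12 x13 x23).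
  exact: fixes gk2 hk2 ak2 r2.
exact: fixes gk3 hk3 ak3 r3.
Qed.

(** Otherwise [H'] would send points of a compact disc arbitrarily close to the circle. *)
Lemma escapes (xi : R[i]) c : modulus xi = 1 -> 0 < c -> exists2 d, 0 < d &
  forall z, modulus (hval z - xi) < d -> 1 - modulus (hval (H z)) ^+ 2 < c.
Proof.
move=> xi1 c0; have [c1 c10 cP] := continuous_disc_bound cH' c0.
exists (c1 / 2); first by rewrite divr_gt0.
move=> z zd; rewrite ltNge; apply/negP => /cP; rewrite HK.
have : 1 - modulus (hval z) <= modulus (hval z - xi).
  by rewrite modulusC -xi1; exact: modulus_subl.
have := modulus_ge0 (hval z); have := hval_lt1 z; nra.
Qed.

(* If [H] has a cluster value [a] but no limit at [xi], then images of short
   segments near [xi] leave every small sector around [a], so they cross all the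
   rays ending on one side of [a]. *)
Lemma boundary_extension (xi : R[i]) : modulus xi = 1 -> exists2 eta, modulus eta = 1 &
  forall e, 0 < e -> exists2 d, 0 < d &
    forall z, modulus (hval z - xi) < d -> modulus (hval (H z) - eta) < e.
Proof.
move=> xi1.
have [||a aP] := @disc_cluster R (fun d y => exists2 z, modulus (hval z - xi) < d & hval (H z) = y).
- by move=> d d' y dd [z zd zy]; exists z => //; exact: lt_le_trans dd.
- move=> d d0; have [z [s [zd _ _]]] := point_near_boundary xi1 d0.
  by exists (hval (H z)); [exact: ltW (hval_lt1 _)|exists z].
have {}aP e : 0 < e -> exists2 z, modulus (hval z - xi) < e & modulus (hval (H z) - a) < e.
  by move=> e0; have [y ya [z zd zy]] := aP e e0; exists z => //; rewrite zy.
have a1 : modulus a = 1.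
  apply/eqP; rewrite eq_le; apply/andP; split; apply/ler_addgt0Pr => e e0.
    have [z _ za] := aP e e0; have := modulus_subl a (hval (H z)); rewrite modulusC.
    by have := hval_lt1 (H z); lra.
  have e20 : 0 < e / 2 by rewrite divr_gt0.
  have [d d0 dP] := escapes xi1 e20.
  have [|z zd za] := aP (Num.min d (e / 2)); first by rewrite lt_min d0.
  move: zd za; rewrite !lt_min => /andP[zd _] /andP[_ za].
  have := dP z zd; have := modulus_subl (hval (H z)) a.
  have := modulus_ge0 (hval (H z)); have := hval_lt1 (H z); nra.
exists a => // e e0; apply: contrapT => nlim.
have far d : 0 < d -> exists2 w, modulus (hval w - xi) < d & e <= modulus (hval (H w) - a).
  move=> d0; apply: contrapT => nw; apply: nlim; exists d => // z zd.
  by rewrite ltNge; apply/negP => ze; apply: nw; exists z.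
pose e1 := Num.min (1 / 4) (e / 8).
have e10 : 0 < e1 by rewrite lt_min !divr_gt0.
(* Of any two rays on opposite sides of [a], at least one is reached: [H z] lies in the sector
   between them when close to [a], and [H w] lies outside when far from [a] but close to the
   circle. *)
have sides u v : modulus u = 1 -> modulus v = 1 -> modulus (u - a) < e1 ->
    modulus (v - a) < e1 -> 0 < Im (a^* * u) -> Im (a^* * v) < 0 ->
    reaches_ray xi u \/ reaches_ray xi v.
  move=> u1 v1 ua va Iu Iv.
  have e11 : e1 < 1 by rewrite gt_min; apply/orP; left; lra.
  have uv := Im_sides_gt0 a1 (lt_trans ua e11) (lt_trans va e11) Iu Iv.
  apply: contrapT => /not_orP[nu nv].
  have nreach x : ~ reaches_ray xi x -> exists2 d, 0 < d & forall z,
      modulus (hval z - xi) < d -> ~ exists2 s : R, 0 <= s & hval (H z) = s%:C * x.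
    move=> nx; apply: contrapT => nd; apply: nx => d d0; apply: contrapT => nz.
    by apply: nd; exists d => // z zd hz; apply: nz; exists z.
  have [d1 d10 dP1] := nreach u nu; have [d2 d20 dP2] := nreach v nv.
  have e80 : 0 < e / 8 by rewrite divr_gt0.
  have [d3 d30 dP3] := escapes xi1 e80.
  have Sa1 : 0 < Im (a * v^*) by rewrite -[Im _]opprK -cImJ rmorphM /= conjcK oppr_gt0.
  have Sa2 : 0 < Im (u * a^*) by rewrite mulrC.
  have [|z zd za] := aP (Num.min (Num.min d1 d2) (Num.min (Im (a * v^*)) (Im (u * a^*)))).
    by rewrite !lt_min d10 d20 Sa1 Sa2.
  have [|w wd wa] := far (Num.min (Num.min d1 d2) d3); first by rewrite !lt_min d10 d20.
  move: zd za; rewrite !lt_min => /andP[/andP[zd1 zd2] _] /andP[_ /andP[za1 za2]].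
  move: wd; rewrite !lt_min => /andP[/andP[wd1 wd2] wd3].
  have Sz : sector u v (hval (H z)).
    have := Im_mulJ_near (hval (H z)) a v1; have := Im_Jmul_near (hval (H z)) a u1.
    by rewrite !ler_norml => /andP[? ?] /andP[? ?]; split; lra.
  have nSw : ~ sector u v (hval (H w)).
    move=> Sw; move: wa; rewrite leNgt => /negP; apply.
    apply: (sector_near a1 u1 v1 uv e0 ua va Sw (hval_lt1 _)).
    have := dP3 w wd3; have := modulus_ge0 (hval (H w)).
    have := hval_lt1 (H w); nra.
  have [t t01 [s s0 [sE|sE]]] := sector_crossing cH u1 v1 uv Sz nSw.
    by apply: (dP1 (hseg z w t)); [exact: hseg_lt|exists s].
  by apply: (dP2 (hseg z w t)); [exact: hseg_lt|exists s].
(* Either all rays on one side are reached, or one of them is missed and then [sides] gives all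
   those on the other side. *)
have [all_left|] := pselect (forall u, modulus u = 1 -> modulus (u - a) < e1 ->
    0 < 1 * Im (a^* * u) -> reaches_ray xi u).
  exact: (not_reaches_side xi1 a1 (oner_neq0 _) e10 all_left).
move=> nleft; have n10 : -1 != 0 :> R by rewrite oppr_eq0 oner_neq0.
apply: (not_reaches_side xi1 a1 n10 e10) => v v1 va; rewrite mulN1r oppr_gt0 => Iv.
apply: contrapT => nv; apply: nleft => u u1 ua; rewrite mul1r => Iu.
by have [] := sides u v u1 v1 ua va Iu Iv.
Qed.

End BoundaryExtension.

(** * Limits at ideal points and boundary maps *)

Section BoundaryLimits.
Context {R : realType}.
Implicit Types (xi eta zeta : ideal R) (T S : hplane R -> hplane R).

Definition boundary_limit T xi eta := forall e, 0 < e -> exists2 d, 0 < d &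
  forall z, modulus (hval z - ival xi) < d -> modulus (hval (T z) - ival eta) < e.

Lemma boundary_limitP T xi eta :
  boundary_limit T xi eta <-> (hval (T z) @[z --> nbhs_ideal xi] --> ival eta).
Proof.
split=> [lim A /nbhs_complexP[e e0 eA]|cvg e e0].
  have [d d0 dP] := lim e e0; apply/nbhs_idealE; exists d => // w wd.
  exact/eA/dP.
have /cvg/nbhs_idealE[d d0 dP] : nbhs (ival eta) [set w : Cplx R | modulus (w - ival eta) < e].
  by apply/nbhs_complexP; exists e.
by exists d.
Qed.

Lemma boundary_limit_unique T xi eta zeta :
  boundary_limit T xi eta -> boundary_limit T xi zeta -> eta = zeta.
Proof.
move=> l1 l2; apply: ival_inj; apply/eqP; rewrite -subr_eq0 -modulus_eq0 eq_le modulus_ge0 andbT.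
apply/ler_addgt0Pr => e e0; rewrite add0r.
have e20 : 0 < e / 2 by rewrite divr_gt0.
have [d1 d10 P1] := l1 _ e20; have [d2 d20 P2] := l2 _ e20.
have d0 : 0 < Num.min d1 d2 by rewrite lt_min d10.
have [z [s [zd _ _]]] := point_near_boundary (ival_eq1 xi) d0.
move: zd; rewrite lt_min => /andP[/P1 z1 /P2 z2].
have := modulusB3 (hval (T z)) (ival eta) (ival zeta).
rewrite (modulusC (ival eta) (hval (T z))); lra.
Qed.

Lemma boundary_mapE T xi eta : boundary_limit T xi eta -> boundary_map T xi = eta.
Proof.
move=> lim; apply: xget_unique; first exact/boundary_limitP.
by move=> zeta /boundary_limitP h; exact: boundary_limit_unique h lim.
Qed.

Lemma boundary_limit_comp T S xi eta zeta : boundary_limit T xi eta ->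
  boundary_limit S eta zeta -> boundary_limit (S \o T) xi zeta.
Proof.
move=> l1 l2 e e0; have [d d0 P2] := l2 e e0; have [d' d'0 P1] := l1 d d0.
by exists d' => // z /P1/P2.
Qed.

Lemma boundary_limit_id xi : boundary_limit id xi xi.
Proof. by move=> e e0; exists e. Qed.

(** Limits at all ideal points already force continuity: an interior point close to [eta], itself
    near [xi], has its image close to both [f eta] and [f xi]. *)
Lemma boundary_limit_continuous T (f : ideal R -> ideal R) :
  (forall xi, boundary_limit T xi (f xi)) -> continuous f.
Proof.
move=> lim xi A /nbhs_idealP[e e0 eA].
have e20 : 0 < e / 2 by rewrite divr_gt0.
have [d d0 dP] := lim xi _ e20.
have d20 : 0 < d / 2 by rewrite divr_gt0.
apply/nbhs_idealP; exists (d / 2) => // eta etad; apply: eA.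
have [d' d'0 dP'] := lim eta _ e20.
have m0 : 0 < Num.min (d / 2) d' by rewrite lt_min d20.
have [z [s [zd _ _]]] := point_near_boundary (ival_eq1 eta) m0.
move: zd; rewrite lt_min => /andP[z1 /dP' z2].
have /dP z3 : modulus (hval z - ival xi) < d.
  by have := modulusB3 (ival eta) (hval z) (ival xi); lra.
have := modulusB3 (hval (T z)) (ival (f eta)) (ival (f xi)).
rewrite (modulusC (ival (f eta)) (hval (T z))); lra.
Qed.

Lemma moebius_boundary_limit a b T xi : moebius a b T -> exists eta, boundary_limit T xi eta.
Proof.
move=> hT; have [h _] := hT.
exists (ipoint (mob_eq1 h (ival_eq1 xi))) => e e0.
exact: moebius_boundary hT (ival_eq1 xi) e e0.
Qed.

End BoundaryLimits.

(** * The space of geodesics *)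

Section GeodesicMaps.
Context {R : realType}.
Implicit Types (f g : ideal R -> ideal R).

Definition pair_map f (u : ideal_pair R) : ideal_pair R :=
  insubd u (f (set_val u).1, f (set_val u).2).

Definition ends_map f (l : geodesics R) : geodesics R :=
  \pi_(geodesics R) (pair_map f (repr l)).

Lemma set_val_pair_map f u : injective f ->
  set_val (pair_map f u) = (f (set_val u).1, f (set_val u).2).
Proof.
move=> finj; rewrite /pair_map set_valE insubdK//; apply/mem_set => /=.
by move=> /finj; exact: (set_valP u).
Qed.

Lemma pair_map_comp f g u : injective f -> injective g ->
  pair_map f (pair_map g u) = pair_map (f \o g) u.
Proof.
move=> finj ginj; apply: val_inj; rewrite -!set_valE !set_val_pair_map//.
exact: inj_comp.
Qed.

(** [repr] may return the pair with its ends exchanged, and [pair_map] respects this exchange. *)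
Lemma ends_map_pi f u : injective f ->
  ends_map f (\pi_(geodesics R) u) = \pi_(geodesics R) (pair_map f u).
Proof.
move=> finj; apply/eqmodP; rewrite /= /same_ends !set_val_pair_map//.
have /eqmodP : \pi_(geodesics R) (repr (\pi_(geodesics R) u)) = \pi_(geodesics R) u by rewrite reprK.
rewrite /= /same_ends => /orP[/eqP ->|/eqP ->]; first by rewrite eqxx.
by rewrite eqxx orbT.
Qed.

Lemma ends_map_comp f g l : injective f -> injective g ->
  ends_map f (ends_map g l) = ends_map (f \o g) l.
Proof. by move=> finj ginj; rewrite {2}/ends_map ends_map_pi// pair_map_comp. Qed.

Lemma ends_map_id l : ends_map id l = l.
Proof.
rewrite /ends_map (_ : pair_map id (repr l) = repr l) ?reprK//.
by apply: val_inj; rewrite -!set_valE set_val_pair_map//; case: (set_val (repr l)).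
Qed.

Lemma ends_map_continuous f : injective f -> continuous f -> continuous (ends_map f).
Proof.
move=> finj cf; apply/quotient_continuous.
have -> : ends_map f \o \pi_(geodesics R) = \pi_(geodesics R) \o pair_map f.
  by apply/funext => u; exact: ends_map_pi.
apply: continuous_comp_cont; last exact: pi_continuous.
apply: continuous_comp_initial.
have -> : set_val \o pair_map f = (fun v : ideal R * ideal R => (f v.1, f v.2)) \o set_val.
  by apply/funext => u; exact: set_val_pair_map.
apply: continuous_comp_cont; first exact: initial_continuous.
move=> -[x y] A [[B C] /= [nB nC] BC]; exists (f @^-1` B, f @^-1` C).
  by split; exact: cf.
by move=> [x' y'] [/= Bx Cy]; exact: (BC (_, _)).
Qed.

Lemma geodesics_mapE T f l : boundary_map T = f -> geodesics_map T l = ends_map f l.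
Proof. by move=> <-. Qed.

End GeodesicMaps.

(** The last condition says that [H] maps fibres to fibres; stated without a map between the bases,
    it serves a lift and its inverse alike. *)
Lemma pi1_conj {R : realType} {X Y : topologicalType} (p : hplane R -> X) (q : hplane R -> Y)
    (H H' : hplane R -> hplane R) k : continuous H -> continuous H' ->
  cancel H H' -> cancel H' H -> (forall x y, p x = p y -> q (H x) = q (H y)) ->
  pi1 p k -> pi1 q (H \o (k \o H')).
Proof.
move=> cH cH' HK HK' pq gk; have [k' [gk' kk' k'k]] := pi1_inv gk.
have ck := pi1_continuous gk; have ck' := pi1_continuous gk'.
split; last first.
  apply/funext => z /=; rewrite -{2}(HK' z); apply: pq.
  by case: gk => _ pk; exact: (congr1 (@^~ (H' z)) pk).
split; first by do 2!apply: continuous_comp_cont => //.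
exists (H \o (k' \o H')); split.
- by do 2!apply: continuous_comp_cont => //.
- by move=> z /=; rewrite HK kk' HK'.
- by move=> z /=; rewrite HK k'k HK'.
Qed.

Unset Implicit Arguments.

Theorem theorem1p2 (R : realType) (X1 X2 : riemannSurface R)
    (m1 : conformalMetric X1) (m2 : conformalMetric X2)
    (p1 : hplane R -> X1) (p2 : hplane R -> X2)
    (hyp1 : hyperbolic_universal_covering m1 p1)
    (hyp2 : hyperbolic_universal_covering m2 p2)
    (inf1 : ~ finitely_generated (pi1 p1))
    (inf2 : ~ finitely_generated (pi1 p2))
    (core1 : convex_core p1 = [set: X1])
    (core2 : convex_core p2 = [set: X2])
    (h : X1 -> X2) (homeo_h : homeomorphism h) :
  (exists H, is_lift p1 p2 h H) /\
  (forall H, is_lift p1 p2 h H ->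
    exists rho, [/\ group_isomorphism (pi1 p1) (pi1 p2) rho,
      (forall k, pi1 p1 k -> H \o k = rho k \o H) &
      exists ht : geodesics R -> geodesics R,
        homeomorphism ht /\ equivariant (pi1 p1) rho ht]).
Proof.
have pcov1 : covering_map p1 by case: hyp1.
have pcov2 : covering_map p2 by case: hyp2.
split; first by apply: lift_exists => //; case: homeo_h.
move=> H lift_H; have [H' [cH' HK HK']] := lift_homeomorphism pcov1 pcov2 homeo_h lift_H.
have [cH pH] := lift_H.
have pHE z : p2 (H z) = h (p1 z) by exact: (congr1 (@^~ z) pH).
have conj12 k : pi1 p1 k -> pi1 p2 (H \o (k \o H')).
  by apply: pi1_conj => // x y; rewrite !pHE => ->.
have conj21 k : pi1 p2 k -> pi1 p1 (H' \o (k \o H)).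
  apply: pi1_conj => // x y; rewrite -{1}(HK' x) -{1}(HK' y) !pHE.
  by case: homeo_h => _ [h' [_ hh' _]]; exact: can_inj hh' _ _.
exists (fun k => H \o (k \o H')); split.
- split; last by move=> k l _ _; apply/funext => z /=; rewrite HK.
  split=> [k /conj12 //|k l _ _ E|k gk].
    apply/funext => z; have := congr1 (fun f => H' (f (H z))) E.
    by rewrite /= !HK.
  exists (H' \o (k \o H)); first exact: conj21.
  by apply/funext => z /=; rewrite !HK'.
- by move=> k _; apply/funext => z /=; rewrite HK.
have mo1 k : pi1 p1 k -> exists a b, moebius a b k by exact: pi1_moebius hyp1.
have mo2 k : pi1 p2 k -> exists a b, moebius a b k by exact: pi1_moebius hyp2.
have ext xi : exists eta, boundary_limit H xi eta.
  have [eta eta1 lim] := boundary_extension pcov1 mo1 mo2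
    (fun x e => @orbit_near_ideal_point R X2 m2 p2 hyp2 core2 x e) cH cH' HK HK' conj21 (ival_eq1 xi).
  by exists (ipoint eta1).
have ext' xi : exists eta, boundary_limit H' xi eta.
  have [eta eta1 lim] := boundary_extension pcov2 mo2 mo1
    (fun x e => @orbit_near_ideal_point R X1 m1 p1 hyp1 core1 x e) cH' cH HK' HK conj12 (ival_eq1 xi).
  by exists (ipoint eta1).
have [f fP] := choice ext; have [f' fP'] := choice ext'.
have fK : cancel f f'.
  move=> xi; apply: boundary_limit_unique (boundary_limit_comp (fP xi) (fP' (f xi))) _.
  have -> : H' \o H = id by apply/funext => z /=; rewrite HK.
  exact: boundary_limit_id.
have fK' : cancel f' f.
  move=> xi; apply: boundary_limit_unique (boundary_limit_comp (fP' xi) (fP (f' xi))) _.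
  have -> : H \o H' = id by apply/funext => z /=; rewrite HK'.
  exact: boundary_limit_id.
have finj := can_inj fK; have finj' := can_inj fK'.
exists (ends_map f); split.
  split; first exact: ends_map_continuous finj (boundary_limit_continuous fP).
  exists (ends_map f'); split.
  - exact: ends_map_continuous finj' (boundary_limit_continuous fP').
  - move=> l; rewrite ends_map_comp//.
    by have -> : f' \o f = id by [apply/funext => xi /=; rewrite fK]; rewrite ends_map_id.
  - move=> l; rewrite ends_map_comp//.
    by have -> : f \o f' = id by [apply/funext => xi /=; rewrite fK']; rewrite ends_map_id.
(* For deck transformations the default value in [boundary_map] is never taken, and the boundary map
   of the inverse shows injectivity. *)
have binj (X : topologicalType) (p : hplane R -> X) k : (forall l, pi1 p l -> exists a b, moebius a b l) ->
    pi1 p k -> (forall xi, boundary_limit k xi (boundary_map k xi)) /\ injective (boundary_map k).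
  move=> mo gk; have lim l : pi1 p l -> forall xi, boundary_limit l xi (boundary_map l xi).
    move=> gl xi; have [a [b ab]] := mo l gl; have [eta et] := moebius_boundary_limit xi ab.
    by rewrite (boundary_mapE et).
  split; first exact: lim.
  have [k' [gk' kk' _]] := pi1_inv gk.
  apply: (@can_inj _ _ _ (boundary_map k')) => xi.
  apply: boundary_limit_unique (boundary_limit_comp (lim k gk xi) (lim k' gk' _)) _.
  have -> : k' \o k = id by apply/funext => z /=; rewrite kk'.
  exact: boundary_limit_id.
move=> k l gk.
have [klim kinj] := binj _ p1 k mo1 gk.
have [rlim rinj] := binj _ p2 _ mo2 (conj12 k gk).
rewrite (geodesics_mapE l (erefl (boundary_map k))).
rewrite (geodesics_mapE _ (erefl (boundary_map (H \o (k \o H'))))).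
rewrite !ends_map_comp//; congr (ends_map _ l); apply/funext => xi /=.
(* Equivariance on the circle: both sides are the limit at [xi] of the single map [H \o k],
   rewritten as the conjugate of [k] followed after [H]. *)
apply: boundary_limit_unique (boundary_limit_comp (klim xi) (fP _)) _.
have -> : H \o k = (H \o (k \o H')) \o H by apply/funext => z /=; rewrite HK.
exact: boundary_limit_comp (fP xi) (rlim _).
Qed.
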